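(* Let $p>2$, $\alpha>\frac p{p-2}$, $C>0$. Let $u_0\ge0$ be continuous on $\mathbb{R}$ with $\sup\{x:u_0(x)>0\}=0$ and $u_0(x)\sim C(-x)^\alpha$ as $x\to0-$, and let $u$ be the solution of $$u_t-(|u_x|^{p-2}u_x)_x=0\ \ (x\in\mathbb{R},\ t>0),\qquad u(x,0)=u_0(x).$$ Then the interface $\eta(t)=\sup\{x:u(x,t)>0\}$ initially remains stationary, and for every $\varepsilon>0$ there exist $x_\varepsilon<0$ and $\delta_\varepsilon>0$ such that $$(C-\varepsilon)(-x)_+^\alpha\le u(x,t)\le(C+\varepsilon)(-x)_+^\alpha(1-\varepsilon t)^{\frac1{2-p}},\qquad x\ge x_\varepsilon,\ 0\le t\le\delta_\varepsilon.$$
   Context: Notation: $y_+=\max\{y,0\}$; $F\sim G$ means $F/G\to1$ in the indicated limit. ''Initially remains stationary'' means $\eta(t)=0$ for all sufficiently small $t\ge0$. Weak solution: a measurable $u\ge0$ with $u\in C_{loc}(0,T;L^2_{loc}(\mathbb{R}))\cap L^p_{loc}(0,T;W^{1,p}_{loc}(\mathbb{R}))$ such that for every $[t_0,t_1]\subset(0,T]$ and all $\mu_1<\mu_2$ in $C^1[t_0,t_1]$, $$\int_{\mu_1(t)}^{\mu_2(t)}u\phi\,dx\Big|_{t_0}^{t_1}+\int_{t_0}^{t_1}\int_{\mu_1(t)}^{\mu_2(t)}\big(-u\phi_t+|u_x|^{p-2}u_x\phi_x\big)dx\,dt=0$$ for every $\phi\in C^{2,1}_{x,t}(\overline D)$ vanishing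 on $x=\mu_i(t)$, where $D=\{\mu_1(t)<x<\mu_2(t),\,t_0<t<t_1\}$. A solution of the Cauchy problem is a weak solution continuous up to $t=0$ with the prescribed initial values. Standing growth assumption: $u_0$ is bounded, or $u_0(x)\le K(1+|x|)^\gamma$ for some $K>0$, $0<\gamma<p/(p-2)$; in these classes there is a unique global solution and comparison holds. *)

(* Defs.v *)
From HB Require Import structures.
From mathcomp Require Import all_boot all_order all_algebra.
From mathcomp Require Import all_classical all_reals all_analysis.
Set Implicit Arguments.
Unset Strict Implicit.
Unset Printing Implicit Defensive.
Import Order.TTheory GRing.Theory Num.Theory.
Import numFieldNormedType.Exports.
Local Open Scope classical_set_scope.
Local Open Scope ring_scope.

(* A function of space and time is a function u : R * R -> R, with u (x, t)
   its value at the point x and the time t. *)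

(* The times of (0, T], where T may be +oo. *)
Definition times {R : realType} (T : \bar R) : set R :=
  [set t | 0 < t /\ (t%:E <= T)%E].

Definition strip {R : realType} (T : \bar R) : set (R * R) :=
  [set z | times T z.2].

Definition closed_strip {R : realType} (T : \bar R) : set (R * R) :=
  [set z | 0 <= z.2 /\ (z.2%:E <= T)%E].

Definition C1c {R : realType} (phi : R -> R) : Prop :=
  [/\ forall x, derivable phi x 1,
      continuous (derive1 phi) &
      exists M : R, forall x, M < `|x| -> phi x = 0].

Definition weak_derivative {R : realType} (f g : R -> R) : Prop :=
  [/\ locally_integrable [set: R] f,
      locally_integrable [set: R] g &
      forall phi : R -> R, C1c phi ->
        \int[lebesgue_measure]_x (f x * derive1 phi x) =
        - \int[lebesgue_measure]_x (g x * phi x)].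

(* u belongs to C_loc(0, T; L^2_loc(R)). *)
Definition C_loc_L2_loc {R : realType} (T : \bar R) (u : R * R -> R) : Prop :=
  forall a b : R, a < b -> forall t, times T t ->
    [/\ measurable_fun `[a, b] (fun x => u (x, t)),
        (\int[lebesgue_measure]_(x in `[a, b]) (u (x, t) ^+ 2)%:E < +oo)%E &
        (\int[lebesgue_measure]_(x in `[a, b])
            ((u (x, s) - u (x, t)) ^+ 2)%:E)%E
          @[s --> within (times T) (nbhs t)] --> 0%E].

(* u belongs to L^p_loc(0, T; W^{1,p}_loc(R)), with weak derivative ux in x. *)
Definition Lp_loc_W1p_loc {R : realType} (p : R) (T : \bar R)
    (u ux : R * R -> R) : Prop :=
  [/\ measurable_fun (strip T) u,
      measurable_fun (strip T) ux,
      {ae lebesgue_measure, forall t, times T t ->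
        weak_derivative (fun x => u (x, t)) (fun x => ux (x, t))} &
      forall a b t0 t1 : R, a < b -> 0 < t0 -> t0 < t1 -> (t1%:E <= T)%E ->
        (\int[lebesgue_measure]_(t in `[t0, t1])
           \int[lebesgue_measure]_(x in `[a, b])
             (`|u (x, t)| `^ p + `|ux (x, t)| `^ p)%:E < +oo)%E].

(* The one-sided derivatives at the endpoints are the values of the continuous
   extension dmu of the derivative on the open interval. *)
Definition C1_on {R : realType} (t0 t1 : R) (mu : R -> R) : Prop :=
  {within `[t0, t1], continuous mu} /\
  exists dmu : R -> R, {within `[t0, t1], continuous dmu} /\
    forall t, t0 < t < t1 -> is_derive t 1 mu (dmu t).

Definition region {R : realType} (t0 t1 : R) (mu1 mu2 : R -> R) :
    set (R * R) :=
  [set z | t0 < z.2 < t1 /\ mu1 z.2 < z.1 < mu2 z.2].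

(* phi belongs to C^{2,1}_{x,t} of the closure of the open set D: its
   derivatives phix, phixx and phit in D extend continuously to the closure. *)
Definition C21_closure {R : realType} (D : set (R * R))
    (phi phix phixx phit : R * R -> R) : Prop :=
  [/\ {within closure D, continuous phi},
      {within closure D, continuous phix},
      {within closure D, continuous phixx},
      {within closure D, continuous phit} &
      forall z, D z ->
        [/\ is_derive z.1 1 (fun x => phi (x, z.2)) (phix z),
            is_derive z.1 1 (fun x => phix (x, z.2)) (phixx z) &
            is_derive z.2 1 (fun t => phi (z.1, t)) (phit z)]].

Definition weak_identity {R : realType} (p : R) (T : \bar R)
    (u ux : R * R -> R) : Prop :=
  forall (t0 t1 : R) (mu1 mu2 : R -> R),
    0 < t0 -> t0 < t1 -> (t1%:E <= T)%E ->
    C1_on t0 t1 mu1 -> C1_on t0 t1 mu2 ->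
    (forall t, t0 <= t <= t1 -> mu1 t < mu2 t) ->
  forall phi phix phixx phit : R * R -> R,
    C21_closure (region t0 t1 mu1 mu2) phi phix phixx phit ->
    (forall t, t0 <= t <= t1 -> phi (mu1 t, t) = 0 /\ phi (mu2 t, t) = 0) ->
    \int[lebesgue_measure]_(x in `[mu1 t1, mu2 t1]) (u (x, t1) * phi (x, t1))
    - \int[lebesgue_measure]_(x in `[mu1 t0, mu2 t0]) (u (x, t0) * phi (x, t0))
    + \int[lebesgue_measure]_(t in `[t0, t1])
        \int[lebesgue_measure]_(x in `[mu1 t, mu2 t])
          (- (u (x, t) * phit (x, t))
           + `|ux (x, t)| `^ (p - 2) * ux (x, t) * phix (x, t))
    = 0.

(* Weak solution of u_t - (|u_x|^{p-2} u_x)_x = 0 for x in R and 0 < t <= T. *)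
Definition weak_solution {R : realType} (p : R) (T : \bar R)
    (u : R * R -> R) : Prop :=
  [/\ forall z, strip T z -> 0 <= u z,
      measurable_fun (strip T) u,
      C_loc_L2_loc T u &
      exists ux : R * R -> R, Lp_loc_W1p_loc p T u ux /\ weak_identity p T u ux].

Definition cauchy_solution {R : realType} (p : R) (T : \bar R) (u0 : R -> R)
    (u : R * R -> R) : Prop :=
  [/\ weak_solution p T u,
      {within closed_strip T, continuous u} &
      forall x, u (x, 0) = u0 x].

Definition growth_condition {R : realType} (p : R) (u0 : R -> R) : Prop :=
  (exists M : R, forall x, u0 x <= M) \/
  (exists K gamma : R, [/\ 0 < K, 0 < gamma, gamma < p / (p - 2) &
     forall x, u0 x <= K * (1 + `|x|) `^ gamma]).

(* The supremum of the positivity set of f, in the extended reals: the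
   real-valued sup takes the value 0 on empty and on unbounded sets. *)
Definition positivity_sup {R : realType} (f : R -> R) : \bar R :=
  ereal_sup [set x%:E | x in [set x | 0 < f x]].

Definition interface {R : realType} (u : R * R -> R) (t : R) : \bar R :=
  positivity_sup (fun x => u (x, t)).

Definition initially_stationary {R : realType} (u : R * R -> R) : Prop :=
  exists2 t1 : R, 0 < t1 &
    forall t, 0 <= t -> t <= t1 -> interface u t = 0%E.

(* Main.v *)
Require Import Defs.
From HB Require Import structures.
From mathcomp Require Import all_boot all_order all_algebra.
From mathcomp Require Import ring lra.
From mathcomp Require Import all_classical all_reals all_analysis.
From mathcomp Require Import measurable_realfun.
Set Implicit Arguments.
Unset Strict Implicit.
Unset Printing Implicit Defensive.
Import Order.TTheory GRing.Theory Num.Theory.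
Import numFieldNormedType.Exports.
Local Open Scope classical_set_scope.
Local Open Scope ring_scope.

(* Write F q = |q|^(p-2) q and beta = p/(p-2).

   Comparison.  By the du Bois-Reymond lemma in x, the integral of F(u_x) over a
   time interval [t0, t1] is for a.e. x a primitive of u(., t1) - u(., t0), and
   u(., t) is a primitive of u_x(., t) for a.e. t.  If a subsolution u1 lies below a
   supersolution u2 on the parabolic boundary of a box, the integral of the cube of
   w = (u1 - u2)_+ is nonincreasing in time: pair the difference of the fluxes,
   averaged over [t - h, t], with the x-derivative of w^2 at the time t, and let h
   tend to 0.  Fatou's lemma applies because the product is at least
   - c (|u1_x|^p + |u2_x|^p) evaluated at the two times, and the limit of the product
   is nonnegative by monotonicity of F.

   Barriers.  A |x - y|^a (1 - k t)^(-1/(p-2)) is a supersolution near y if a > beta,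
   and everywhere if a = beta and k is large; A |x|^a is a stationary subsolution.
   The barrier with a = beta gives u = 0 on [0, 1/2] for a short time.  Comparing u
   with its reflections, u is then nondecreasing in x >= 0.  If u were large
   compared with x^beta at some point, a Barenblatt solution below u would reach
   x = 1/4 too early; so u <= K x^beta on x >= 0, which makes the barrier applicable
   around every y >= 0 and yields u = 0 there, up to a time independent of y.  The two
   bounds follow by comparison on an interval [xeps, 0]. *)

(** A weak solution comes without a time derivative, so the equation is used through increments
    between two times. Convexity of the cube replaces the chain rule in time, and the multiplier w^2
    is absolutely continuous in x, which is all that the integration by parts requires. No norm
    convergence of the averaged fluxes is established: the lower bound that makes Fatou's lemma
    applicable is added on both sides, and its finite integral cancels in the limit.

    Stationarity concerns all x >= 0 at once, whereas a barrier centred at y needs a bound at a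
    right end beyond y with a constant independent of y. The exponent beta is the one for which u(x,
    t) -> L^beta u(x / L, t) preserves the equation without rescaling time; hence the life span of
    the barrier with a = beta is independent of y. For a > beta the supersolution inequality gains a
    factor |x - y|^(a (p-2) - p), which is small near y, and k may then be any eps > 0. *)

Local Notation mu := lebesgue_measure.

(** * Uniform continuity, small increments, integrability and almost-everywhere reasoning *)

Lemma uniform_continuity_compact (R : realType) (T : pseudoMetricType R)
    (A : set T) (f : T -> R) : compact A -> {within A, continuous f} ->
  forall e : R, 0 < e -> exists2 d : R, 0 < d &
    forall x y, A x -> A y -> ball x d y -> `|f x - f y| < e.
Proof.
move=> cA cf e e0.
pose P d x := forall y, A y -> ball x d y -> `|f x - f y| < e.
have Ploc x : A x -> \forall x' \near x & d \near 0^'+, A x' -> P d x'.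
  move=> Ax.
  have e20 : 0 < e / 2 by rewrite divr_gt0.
  have /subspace_continuousP/(_ x Ax)/cvgrPdist_lt/(_ _ e20) := cf.
  rewrite nearE/= => /nbhs_ballP[d /= d0 dx].
  exists (ball x (d / 2), [set r | 0 < r < d / 2]) => /=.
    split; first by apply: nbhsx_ballx; rewrite divr_gt0.
    near=> r; rewrite /=; apply/andP; split; first by near: r; exact: nbhs_right_gt.
    by near: r; apply: nbhs_right_lt; rewrite divr_gt0.
  move=> [z r] /= [xz /andP[r0 rd]] Az y Ay zy.
  have h1 := dx z _ Az; have h2 := dx y _ Ay.
  rewrite (splitr e) (le_lt_trans (ler_distD (f x) _ _))//.
  rewrite ltrD//; last first.
    apply: h2; rewrite (splitr d); apply: (ball_triangle xz).
    exact: le_ball (ltW rd) _ zy.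
  rewrite distrC; apply: h1; apply: le_ball xz.
  by rewrite ler_pdivrMr// ler_peMr ?ltW// ltr1n.
have /near_covering_withinP cov := (compact_near_coveringP A).1 cA.
have [d /= d0 H] := cov R _ P _ Ploc.
exists (d / 2); first by rewrite divr_gt0.
move=> x y Ax Ay xy; apply: (H (d / 2)) => //=.
  by rewrite sub0r normrN gtr0_norm ?divr_gt0// ltr_pdivrMr// ltr_pMr// ltr1n.
by rewrite divr_gt0.
Unshelve. all: by end_near. Qed.

(** The increments of [V] act as a total variation: summing over a partition of mesh below [d] gives
    |G b - G a| <= e (V b - V a) for every e. This yields the chain and product rules for functions
    that are only absolutely continuous. *)
Lemma small_increments_eq (R : realType) (a b : R) (G V : R -> R) : a <= b ->
  (forall e : R, 0 < e -> exists2 d : R, 0 < d & forall x y, a <= x -> x <= y ->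
     y <= b -> y - x < d -> `|G y - G x| <= e * (V y - V x)) ->
  G b = G a.
Proof.
move=> ab H.
have key e : 0 < e -> `|G b - G a| <= e * (V b - V a).
  move=> e0; have [d d0 Hd] := H e e0.
  pose n := (Num.truncn ((b - a) / d)).+1.
  have n0 : 0 < n%:R :> R by rewrite ltr0n.
  have nd : (b - a) / n%:R < d.
    by rewrite ltr_pdivrMr// mulrC -ltr_pdivrMr// truncnS_gt.
  pose x i := a + i%:R * ((b - a) / n%:R).
  have xS i : x i.+1 - x i = (b - a) / n%:R.
    by rewrite /x -natr1; ring.
  have x0 : x 0%N = a by rewrite /x mul0r addr0.
  have xn : x n = b.
    by rewrite /x mulrCA divff ?gt_eqF// mulr1 addrC subrK.
  have stp0 : 0 <= (b - a) / n%:R by rewrite divr_ge0 ?subr_ge0// ltW.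
  have xa i : a <= x i by rewrite /x lerDl mulr_ge0.
  have xb i : (i <= n)%N -> x i <= b.
    move=> ni; rewrite -xn /x lerD2l ler_wpM2r// ler_nat//.
  rewrite -x0 -xn -!(telescope_sumr (fun i => _ (x i)))//.
  rewrite (le_trans (ler_norm_sum _ _ _))// mulr_sumr.
  rewrite !big_nat; apply: ler_sum => i /andP[_ ni].
  apply: Hd => //.
  - by rewrite -subr_ge0 xS.
  - exact: xb.
  - by rewrite xS.
apply/eqP; rewrite -subr_eq0 -normr_le0; apply/ler_addgt0Pr => e e0.
rewrite add0r; have V0 : 0 <= V b - V a.
  by have := key 1 ltr01; rewrite mul1r; exact: le_trans.
have V1 : 0 < V b - V a + 1 by rewrite ltr_wpDl.
have c0 : 0 < e / (V b - V a + 1) by rewrite divr_gt0.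
apply: (le_trans (key _ c0)).
by rewrite mulrAC ler_pdivrMr// ler_pM2l// lerDl.
Qed.

Section real_integrable.
Context d (T : measurableType d) (R : realType).
Variable m : {measure set T -> \bar R}.
Implicit Types (I : set T) (f g : T -> R).

Lemma integrable_mull I k f : measurable I -> m.-integrable I (EFin \o f) ->
  m.-integrable I (EFin \o (fun x => k * f x)).
Proof. by move=> mI; exact: (@integrableZl _ _ _ m I mI k (EFin \o f)). Qed.

Lemma integrable_add I f g : measurable I -> m.-integrable I (EFin \o f) ->
  m.-integrable I (EFin \o g) -> m.-integrable I (EFin \o (fun x => f x + g x)).
Proof.
by move=> mI; exact: (@integrableD _ _ _ m I mI (EFin \o f) (EFin \o g)).
Qed.

Lemma integrable_sub I f g : measurable I -> m.-integrable I (EFin \o f) ->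
  m.-integrable I (EFin \o g) -> m.-integrable I (EFin \o (fun x => f x - g x)).
Proof.
by move=> mI; exact: (@integrableB _ _ _ m I mI (EFin \o f) (EFin \o g)).
Qed.

End real_integrable.

Section ae_logic.
Context d (T : measurableType d) (R : realType).
Variable m : {measure set T -> \bar R}.
Implicit Types P Q : T -> Prop.

Lemma ae_imply P Q : (forall x, P x -> Q x) ->
  {ae m, forall x, P x} -> {ae m, forall x, Q x}.
Proof. by move=> PQ; apply: negligibleS => x /= nQ /PQ. Qed.

Lemma ae_imply2 P Q S : (forall x, P x -> Q x -> S x) ->
  {ae m, forall x, P x} -> {ae m, forall x, Q x} -> {ae m, forall x, S x}.
Proof.
move=> PQS aP aQ; apply: negligibleS (negligibleU aP aQ) => x /= nS.
have [Px|nPx] := pselect (P x); last by left.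
by right => /= Qx; exact: nS (PQS _ Px Qx).
Qed.

Lemma ae_imply3 P Q S U : (forall x, P x -> Q x -> S x -> U x) ->
  {ae m, forall x, P x} -> {ae m, forall x, Q x} -> {ae m, forall x, S x} ->
  {ae m, forall x, U x}.
Proof.
move=> H aP aQ aS; have aPQ := ae_imply2 (fun x Px Qx => conj Px Qx) aP aQ.
by apply: ae_imply2 aPQ aS => x [Px Qx]; exact: H.
Qed.

End ae_logic.

(** * Absolutely continuous functions *)

(** The density [g] is carried as an argument, so that absolute continuity can be used without
    differentiating [f] almost everywhere. *)
Definition ac_on (R : realType) (a b : R) (f g : R -> R) : Prop :=
  mu.-integrable `[a, b] (EFin \o g) /\
  forall x, a <= x <= b -> f x = f a + \int[mu]_(y in `[a, x]) g y.

Section ac_on_theory.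
Context {R : realType}.
Implicit Types (a b x y c : R) (f g h D w : R -> R).

Lemma integrable_itvS a b x y (b0 b1 c0 c1 : bool) g :
  mu.-integrable [set` Interval (BSide b0 a) (BSide b1 b)] (EFin \o g) ->
  (BSide b0 a <= BSide c0 x)%O -> (BSide c1 y <= BSide b1 b)%O ->
  mu.-integrable [set` Interval (BSide c0 x) (BSide c1 y)] (EFin \o g).
Proof.
move=> ig h1 h2; apply: integrableS ig => //.
exact: subset_itv.
Qed.

Lemma ac_on_increment a b f g x y : ac_on a b f g -> a <= x -> x <= y ->
  y <= b -> f y - f x = \int[mu]_(s in `]x, y]) g s.
Proof.
move=> [ig fE] ax xy yb.
rewrite (fE y) ?(le_trans ax xy)// (fE x) ?ax ?(le_trans xy)//.
rewrite -(@Rintegral_itvB _ g (BLeft a) (BRight y) x) ?bnd_simp//.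
  by rewrite opprD addrACA subrr add0r.
by apply: integrable_itvS ig _ _; rewrite bnd_simp.
Qed.

Lemma ac_on_within a b f g : a <= b -> ac_on a b f g ->
  {within `[a, b], continuous f}.
Proof.
move=> ab [ig fE].
have h := parameterized_integral_continuous ab ig.
have : {within `[a, b], continuous
    (fun x => f a + parameterized_integral mu a x g)}.
  by apply/subspace_continuousP => x xab; apply: cvgD;
     [exact: cvg_cst|move/subspace_continuousP : h; exact].
apply: subspace_eq_continuous => x; rewrite inE/= in_itv/= => xab.
by rewrite [RHS]fE.
Qed.

Lemma ac_on_modulus a b f g : a <= b -> ac_on a b f g ->
  forall e : R, 0 < e -> exists2 d : R, 0 < d & forall x y, a <= x <= b ->
    a <= y <= b -> `|x - y| < d -> `|f x - f y| < e.
Proof.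
move=> ab acf e e0.
have [d d0 H] := uniform_continuity_compact (@segment_compact _ a b)
  (ac_on_within ab acf) e0.
by exists d => // x y xab yab xy; apply: H; rewrite //= in_itv.
Qed.

Lemma within_integrable a b f : {within `[a, b], continuous f} ->
  mu.-integrable `[a, b] (EFin \o f).
Proof.
by move=> cf; apply: continuous_compact_integrable => //; exact: segment_compact.
Qed.

Lemma within_integrableM a b f g : {within `[a, b], continuous f} ->
  mu.-integrable `[a, b] (EFin \o g) ->
  mu.-integrable `[a, b] (EFin \o (fun x => f x * g x)).
Proof.
move=> cf ig.
rewrite (_ : EFin \o _ = (EFin \o f) \* (EFin \o g))%E//.
apply: integrableMr => //.
  exact: subspace_continuous_measurable_fun.
have /compact_bounded[M [_ mrt]] := continuous_compact cf (@segment_compact _ a b).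
by exists M; split; rewrite ?num_real // => ? ? ? ?; exact: mrt.
Qed.

Lemma Rintegral_norm_bound (I : set R) f g (M : R) : measurable I ->
  mu.-integrable I (EFin \o f) -> mu.-integrable I (EFin \o g) ->
  (forall x, x \in I -> `|f x| <= M * `|g x|) ->
  `|\int[mu]_(x in I) f x| <= M * \int[mu]_(x in I) `|g x|.
Proof.
move=> mI fi gi fg.
have gn := integrable_norm gi.
have h1 : `|\int[mu]_(x in I) f x| <= \int[mu]_(x in I) `|f x|.
  exact: le_normr_Rintegral.
apply: (le_trans h1); rewrite -RintegralZl//; apply: le_Rintegral => //.
- exact: integrable_norm.
- exact: integrable_mull.
- by move=> x Ix; apply: fg; rewrite inE.
Qed.

Lemma continuous_pos : continuous (fun x : R => Num.max x 0).
Proof.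
move=> x; rewrite (_ : (fun _ => _) = (fun x => (x + `|x|) / 2)); last first.
  by apply/funext => y; rewrite maxr_absE addr0 subr0.
apply: cvgM; last exact: cvg_cst.
by apply: cvgD => //; exact: norm_continuous.
Qed.

Lemma cvg_pos (T : Type) (F : set_system T) (FF : Filter F) (f : T -> R) l :
  f @ F --> l -> Num.max (f x) 0 @[x --> F] --> Num.max l 0.
Proof.
move=> fl; exact: (@cvg_comp _ _ _ f (fun x : R => Num.max x 0) F (nbhs l)
  (nbhs (Num.max l 0)) fl (@continuous_pos l)).
Qed.

Lemma continuous_pos_exp (T : topologicalType) (f : T -> R) n :
  continuous f -> continuous (fun x : T => Num.max (f x) 0 ^+ n).
Proof.
move=> cf x.
have h : {for x, continuous (fun x : T => Num.max (f x) 0)}.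
  exact: (@cvg_pos T (nbhs x) _ f (f x) (cf x)).
exact: (@continuous_comp _ _ _ (fun x : T => Num.max (f x) 0)
  (fun y : R => y ^+ n) x h (@exprn_continuous R n _)).
Qed.

(** Chain rule by [small_increments_eq], with the integral of |g| as [V]: on a short interval the
    tangent error of the squared positive part is at most the square of the increment of [f], and
    the derivative of that square varies little. *)
Lemma ac_on_pos_sqr a b f g : a <= b -> ac_on a b f g ->
  ac_on a b (fun x => Num.max (f x) 0 ^+ 2)
            (fun x => 2 * Num.max (f x) 0 * g x).
Proof.
move=> ab acf.
have cf := ac_on_within ab acf.
have ig := acf.1.
have cmf : {within `[a, b], continuous (fun x => 2 * Num.max (f x) 0)}.
  move=> x; apply: cvgM; first exact: cvg_cst.
  exact: cvg_pos (cf x).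
split; first exact: within_integrableM.
move=> x0 /andP[ax0 x0b].
pose h x := 2 * Num.max (f x) 0 * g x.
have ih : mu.-integrable `[a, b] (EFin \o h) by exact: within_integrableM.
pose G x := Num.max (f x) 0 ^+ 2 - \int[mu]_(y in `[a, x]) h y.
pose V x := \int[mu]_(y in `[a, x]) `|g y|.
have Ga : G a = Num.max (f a) 0 ^+ 2.
  by rewrite /G set_itv1 Rintegral_set1 subr0.
suff GE : G x0 = G a by apply/eqP; rewrite -subr_eq -/(G x0) GE Ga.
apply: (@small_increments_eq _ a x0 G V) => // e e0.
have e30 : 0 < e / 3 by rewrite divr_gt0.
have [d d0 Hd] := ac_on_modulus ab acf e30.
exists d => // x y ax xy yx0 yxd.
have yb : y <= b by exact: le_trans x0b.
have itv2 (k : R -> R) : mu.-integrable `[a, b] (EFin \o k) ->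
    \int[mu]_(s in `[a, y]) k s - \int[mu]_(s in `[a, x]) k s =
    \int[mu]_(s in `]x, y]) k s.
  move=> ik; rewrite -(@Rintegral_itvB _ k (BLeft a) (BRight y) x) ?bnd_simp//.
  by apply: integrable_itvS ik _ _; rewrite bnd_simp.
have igxy : mu.-integrable `]x, y] (EFin \o g).
  by apply: integrable_itvS ig _ _; rewrite bnd_simp// (le_trans ax).
have ihxy : mu.-integrable `]x, y] (EFin \o h).
  by apply: integrable_itvS ih _ _; rewrite bnd_simp// (le_trans ax).
have fyx := ac_on_increment acf ax xy yb.
rewrite /V itv2; last exact: integrable_norm.
set W := \int[mu]_(s in `]x, y]) `|g s|.
have W0 : 0 <= W by apply: Rintegral_ge0.
have fW : `|f y - f x| <= W.
  by rewrite fyx; apply: le_normr_Rintegral.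
have fe : `|f y - f x| <= e / 3.
  apply/ltW/Hd; rewrite ?ax ?yb ?(le_trans ax)//= ?(le_trans xy)//.
  by rewrite ger0_norm ?subr_ge0.
have -> : G y - G x = (Num.max (f y) 0 ^+ 2 - Num.max (f x) 0 ^+ 2 -
    2 * Num.max (f x) 0 * (f y - f x)) -
    \int[mu]_(s in `]x, y]) ((2 * Num.max (f s) 0 - 2 * Num.max (f x) 0) * g s).
  rewrite (_ : \int[mu]_(s in `]x, y]) _ =
    \int[mu]_(s in `]x, y]) h s - 2 * Num.max (f x) 0 * (f y - f x)).
    by rewrite /G -(itv2 h)//; ring.
  rewrite fyx -RintegralZl// -RintegralB//.
    by apply: eq_Rintegral => s _; rewrite mulrBl.
  exact: integrable_mull.
(* One third of [e] pays for the tangent error at [f x], two thirds for the oscillation of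
   [2 * Num.max (f s) 0] on []x, y]]. *)
have -> : e * W = e / 3 * W + 2 * (e / 3) * W by field.
rewrite (le_trans (ler_normB _ _))// lerD//.
  have pos2 (s t : R) : `|Num.max t 0 ^+ 2 - Num.max s 0 ^+ 2 -
      2 * Num.max s 0 * (t - s)| <= (t - s) ^+ 2.
    have [t0|t0] := leP t 0; have [s0|s0] := leP s 0.
    - by rewrite !(expr0n, mulr0, mul0r, subr0)/= normr0 sqr_ge0.
    - have st := mulr_ge0_le0 (ltW s0) t0; have := sqr_ge0 t.
      by rewrite ler_norml => t2; apply/andP; split; nra.
    - have st := mulr_le0_ge0 s0 (ltW t0); have := sqr_ge0 s.
      by rewrite ler_norml => s2; apply/andP; split; nra.
    - have -> : t ^+ 2 - s ^+ 2 - 2 * s * (t - s) = (t - s) ^+ 2 by ring.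
      by rewrite ger0_norm ?sqr_ge0.
  apply: (le_trans (pos2 _ _)).
  by rewrite -real_normK ?num_real// expr2 ler_pM.
apply: Rintegral_norm_bound => //.
  rewrite (_ : (fun s => _) = (fun s => h s - 2 * Num.max (f x) 0 * g s)).
    by apply: integrable_sub => //; exact: integrable_mull.
  by apply/funext => s; rewrite mulrBl.
move=> s; rewrite inE/= in_itv/= => /andP[xs sy].
rewrite normrM ler_wpM2r// -mulrBr normrM ger0_norm// ler_wpM2l//.
have : `|f s - f x| <= e / 3.
  apply/ltW/Hd; rewrite ?ax ?(le_trans sy)//= ?(le_trans ax)//= ?(ltW xs)//.
    by rewrite (le_trans (ltW xs))// (le_trans sy).
  rewrite gtr0_norm ?subr_gt0// (le_lt_trans _ yxd)// lerB//.
apply: le_trans.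
have [s0|s0] := leP (f s) 0; have [t0|t0] := leP (f x) 0.
- by rewrite subrr normr0.
- by rewrite sub0r normrN (gtr0_norm t0) distrC (le_trans _ (ler_norm _))//; lra.
- by rewrite subr0 (gtr0_norm s0) (le_trans _ (ler_norm _))//; lra.
- exact: lexx.
Qed.

(** The defect of the product rule on []x, y]] is exactly the integral of (g y - g s) D s plus that
    of (f x - f s) h s. Uniform continuity makes both first factors small, so [small_increments_eq]
    applies with the sum of the two variations. *)
Lemma ac_onM a b f g D h : a <= b -> ac_on a b f D -> ac_on a b g h ->
  ac_on a b (fun x => f x * g x) (fun x => g x * D x + f x * h x).
Proof.
move=> ab acf acg.
have cf := ac_on_within ab acf.
have cg := ac_on_within ab acg.
have iD := acf.1; have ih := acg.1.
have igD : mu.-integrable `[a, b] (EFin \o (fun x => g x * D x)).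
  exact: within_integrableM.
have ifh : mu.-integrable `[a, b] (EFin \o (fun x => f x * h x)).
  exact: within_integrableM.
pose k x := g x * D x + f x * h x.
have ik : mu.-integrable `[a, b] (EFin \o k).
  exact: integrable_add.
split; first exact: ik.
move=> x0 /andP[ax0 x0b].
pose G x := f x * g x - \int[mu]_(y in `[a, x]) k y.
pose V x := \int[mu]_(y in `[a, x]) `|D y| + \int[mu]_(y in `[a, x]) `|h y|.
have Ga : G a = f a * g a.
  by rewrite /G set_itv1 Rintegral_set1 subr0.
suff GE : G x0 = G a by apply/eqP; rewrite -subr_eq -/(G x0) GE Ga.
apply: (@small_increments_eq _ a x0 G V) => // e e0.
have [d1 d10 Hd1] := ac_on_modulus ab acf e0.
have [d2 d20 Hd2] := ac_on_modulus ab acg e0.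
exists (Num.min d1 d2); first by rewrite lt_min d10 d20.
move=> x y ax xy yx0; rewrite lt_min => /andP[yxd1 yxd2].
have yb : y <= b by exact: le_trans x0b.
have itv2 (l : R -> R) : mu.-integrable `[a, b] (EFin \o l) ->
    \int[mu]_(s in `[a, y]) l s - \int[mu]_(s in `[a, x]) l s =
    \int[mu]_(s in `]x, y]) l s.
  move=> il; rewrite -(@Rintegral_itvB _ l (BLeft a) (BRight y) x) ?bnd_simp//.
  by apply: integrable_itvS il _ _; rewrite bnd_simp.
have sub (l : R -> R) : mu.-integrable `[a, b] (EFin \o l) ->
    mu.-integrable `]x, y] (EFin \o l).
  by move=> il; apply: integrable_itvS il _ _; rewrite bnd_simp// (le_trans ax).
have fyx := ac_on_increment acf ax xy yb.
have gyx := ac_on_increment acg ax xy yb.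
have -> : V y - V x = \int[mu]_(s in `]x, y]) `|D s| +
    \int[mu]_(s in `]x, y]) `|h s|.
  by rewrite /V opprD addrACA !itv2//; exact: integrable_norm.
have -> : G y - G x =
    \int[mu]_(s in `]x, y]) ((g y - g s) * D s) +
    \int[mu]_(s in `]x, y]) ((f x - f s) * h s).
  have -> : \int[mu]_(s in `]x, y]) ((g y - g s) * D s) =
      g y * (f y - f x) - \int[mu]_(s in `]x, y]) (g s * D s).
    rewrite fyx -RintegralZl//; last exact: sub.
    rewrite -RintegralB//; last 2 first.
    + by apply: integrable_mull => //; exact: sub.
    + exact: sub.
    by apply: eq_Rintegral => s _; rewrite mulrBl.
  have -> : \int[mu]_(s in `]x, y]) ((f x - f s) * h s) =
      f x * (g y - g x) - \int[mu]_(s in `]x, y]) (f s * h s).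
    rewrite gyx -RintegralZl//; last exact: sub.
    rewrite -RintegralB//; last 2 first.
    + by apply: integrable_mull => //; exact: sub.
    + exact: sub.
    by apply: eq_Rintegral => s _; rewrite mulrBl.
  rewrite (_ : G y - G x = f y * g y - f x * g x -
    (\int[mu]_(s in `[a, y]) k s - \int[mu]_(s in `[a, x]) k s)); last by rewrite /G; ring.
  rewrite itv2//.
  rewrite /k RintegralD//; [|exact: sub..].
  by ring.
have bd (l m : R -> R) : (forall s, x < s -> s <= y -> `|l s| <= e) ->
   {within `[a, b], continuous l} ->
   mu.-integrable `[a, b] (EFin \o m) ->
   `|\int[mu]_(s in `]x, y]) (l s * m s)| <=
     e * \int[mu]_(s in `]x, y]) `|m s|.
  move=> le cl im; apply: Rintegral_norm_bound => //; [exact: sub (within_integrableM _ _)|exact: sub|].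
  by move=> s; rewrite inE/= in_itv/= => /andP[xs sy];
    rewrite normrM ler_wpM2r// le.
rewrite mulrDr (le_trans (ler_normD _ _))// lerD// bd//.
- move=> s xs sy; apply/ltW/Hd2.
  + by rewrite yb (le_trans ax).
  + by rewrite (le_trans ax (ltW xs)) (le_trans sy).
  + by rewrite ger0_norm ?subr_ge0// (le_lt_trans _ yxd2)// lerB// ltW.
- by move=> s; apply: cvgB; [exact: cvg_cst|exact: cg].
- move=> s xs sy; apply/ltW/Hd1.
  + by rewrite ax (le_trans xy).
  + by rewrite (le_trans ax (ltW xs)) (le_trans sy).
  + by rewrite distrC gtr0_norm ?subr_gt0// (le_lt_trans _ yxd1)// lerB.
- by move=> s; apply: cvgB; [exact: cvg_cst|exact: cf].
Qed.

End ac_on_theory.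

(** * Derivatives of positive powers, and a smooth step *)

Section caratheodory.
Context {R : realType}.
Implicit Types (f g : R -> R) (c z : R).

(** Caratheodory's form of differentiability. It settles points where a formula changes, such as 0
    for powers of the positive part. *)
Lemma is_derive_caratheodory f g c :
  (forall x, f x - f c = (x - c) * g x) -> {for c, continuous g} ->
  is_derive c 1 f (g c).
Proof.
move=> fg cg.
have H : h^-1 *: (f (h *: 1 + c) - f c) @[h --> 0^'] --> g c.
  have : g (h + c) @[h --> 0^'] --> g c.
    apply: (@cvg_comp _ _ _ (fun h => h + c) g (0^') (nbhs c)) => //.
    have h : (fun h => h + c) @ nbhs (0 : R) --> 0 + c.
      by apply: cvgD => //; exact: cvg_cst.
    by rewrite add0r in h; apply: cvg_trans h; apply: cvg_fmap2; exact: nbhs_dnbhs.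
  apply: cvg_trans; apply: near_eq_cvg; near=> h.
  have h0 : h != 0 by near: h; exact: nbhs_dnbhs_neq.
  rewrite fg /GRing.scale/= mulr1 addrK mulrA mulVf// mul1r//.
split; first by apply/cvg_ex; exists (g c).
exact: cvg_lim H.
Unshelve. all: by end_near. Qed.

Lemma continuous_is_derive f (df : R -> R) : (forall x : R, is_derive x 1 f (df x)) ->
  continuous f.
Proof.
move=> H x; apply: differentiable_continuous; apply/derivable1_diffP.
by case: (H x).
Qed.

Lemma is_derive_pos_exp n z : is_derive z 1 (fun x => Num.max x 0 ^+ n.+2)
  (n.+2%:R * Num.max z 0 ^+ n.+1).
Proof.
have [z0|z0|->] := ltgtP z 0.
- rewrite expr0n/= mulr0.
  apply: (@near_eq_is_derive _ _ _ (fun=> 0 : R)).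
  near=> x; have x0 : x < 0 by near: x; exact: lt_nbhsl.
  by rewrite max_r ?ltW// expr0n.
-
  apply: (@near_eq_is_derive _ _ _ (fun x : R => x ^+ n.+2)).
    near=> x; have x0 : 0 < x by near: x; exact: lt_nbhsr.
    by rewrite max_l ?ltW.
  have := @is_deriveX R R id n.+2 z 1 1 (is_derive_id _ _).
  rewrite (_ : id ^+ n.+2 = (fun x : R => x ^+ n.+2)); last first.
    by apply/funext => x; rewrite fctE.
  by rewrite /GRing.scale/= mulr1.
- rewrite expr0n mulr0.
  have := @is_derive_caratheodory (fun x => Num.max x 0 ^+ n.+2)
    (fun x => Num.max x 0 ^+ n.+1) 0; rewrite /= maxxx !expr0n; apply.
    move=> x; rewrite !subr0 [LHS]exprS.
    by have [x0|x0] := leP x 0; rewrite ?expr0n ?mulr0.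
  exact: (@cvg_comp _ _ _ (fun x : R => Num.max x 0) (fun x => x ^+ n.+1) _ _ _
    (@continuous_pos _ 0) (@exprn_continuous _ n.+1 _)).
Unshelve. all: by end_near. Qed.

End caratheodory.

Section smooth_step.
Context {R : realType}.
Implicit Types (z : R).
Local Notation pos z := (Num.max (z) 0).

(* A C^2 spline that increases from 0 to 1 on [0, 3]. *)
Definition step z := (pos z ^+ 3 - 3 * pos (z - 1) ^+ 3
  + 3 * pos (z - 2) ^+ 3 - pos (z - 3) ^+ 3) / 6.
(** The quadratic B-spline with knots 0, 1, 2, 3. Rescaled, it is the mollifying kernel of
    [bump_mean_bound]. *)
Definition step1 z := (pos z ^+ 2 - 3 * pos (z - 1) ^+ 2
  + 3 * pos (z - 2) ^+ 2 - pos (z - 3) ^+ 2) / 2.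
Definition step2 z := pos z - 3 * pos (z - 1) + 3 * pos (z - 2) - pos (z - 3).

Lemma is_derive_pos_shift n (c : R) z :
  is_derive z 1 (fun x => pos (x - c) ^+ n.+2) (n.+2%:R * pos (z - c) ^+ n.+1).
Proof.
have h1 : is_derive z 1 (fun x : R => x - c) 1.
  by apply: is_derive_eq; rewrite subr0.
have h2 := is_derive_pos_exp n (z - c).
have := @is_derive1_comp _ (fun x : R => pos x ^+ n.+2) (fun x : R => x - c)
  z _ _ h2 h1.
by rewrite mulr1.
Qed.

Lemma is_derive_step z : is_derive z 1 step (step1 z).
Proof.
have h0 := is_derive_pos_exp 1 z.
have h1 := is_derive_pos_shift 1 1 z.
have h2 := is_derive_pos_shift 1 2 z.
have h3 := is_derive_pos_shift 1 3 z.
rewrite /step; apply: is_derive_eq.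
by rewrite /GRing.scale/= /step1; field.
Qed.

Lemma is_derive_step1 z : is_derive z 1 step1 (step2 z).
Proof.
have h0 := is_derive_pos_exp 0 z.
have h1 := is_derive_pos_shift 0 1 z.
have h2 := is_derive_pos_shift 0 2 z.
have h3 := is_derive_pos_shift 0 3 z.
rewrite /step1; apply: is_derive_eq.
by rewrite /GRing.scale/= /step2; field.
Qed.

Lemma continuous_step2 : continuous step2.
Proof.
have cs (c : R) : continuous (fun x : R => pos (x - c)).
  move=> x; apply: cvg_pos.
  by apply: cvgB => //; exact: cvg_cst.
move=> x; apply: cvgB; last exact: cs.
apply: cvgD; last by apply: cvgM; [exact: cvg_cst|exact: cs].
apply: cvgB; last by apply: cvgM; [exact: cvg_cst|exact: cs].
exact: continuous_pos.
Qed.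

Lemma step_le0 z : z <= 0 -> step z = 0.
Proof.
by move=> z0; rewrite /step !max_r ?(expr0n,mulr0,subr0,addr0,mul0r)//; lra.
Qed.

Lemma step1_le0 z : z <= 0 -> step1 z = 0.
Proof.
by move=> z0; rewrite /step1 !max_r ?(expr0n,mulr0,subr0,addr0,mul0r)//; lra.
Qed.

Lemma step_ge3 z : 3 <= z -> step z = 1.
Proof. by move=> z0; rewrite /step !max_l; [field|lra..]. Qed.

Lemma step1_ge3 z : 3 <= z -> step1 z = 0.
Proof. by move=> z0; rewrite /step1 !max_l; [field|lra..]. Qed.

Lemma step_bounds z : 0 <= step z <= 1.
Proof.
have [z0|z0] := leP z 0; first by rewrite step_le0// lexx ler01.
have [z3|z3] := leP 3 z; first by rewrite step_ge3// lexx ler01.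
have [z1|z1] := leP z 1; [|have [z2|z2] := leP z 2].
- rewrite /step (max_l (ltW z0)) !max_r ?(expr0n,mulr0,subr0,addr0)/=; try lra.
  apply/andP; split; first by rewrite divr_ge0// exprn_ge0// ltW.
  rewrite ler_pdivrMr// mul1r (@le_trans _ _ 1)// ?exprn_ile1// ?ltW//.
  lra.
- rewrite /step (max_l (ltW z0)) (max_l (_ : 0 <= z - 1)); last lra.
  rewrite !max_r ?(expr0n,mulr0,subr0,addr0)/=; try lra.
  have a0 : 0 <= z - 1 by lra.
  have a1 : z - 1 <= 1 by lra.
  have b0 := exprn_ge0 3 a0; have b1 := exprn_ile1 3 a0 a1.
  have c0 := sqr_ge0 (z - 1); have c1 := exprn_ile1 2 a0 a1.
  have -> : z ^+ 3 - 3 * (z - 1) ^+ 3 =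
     1 + 3 * (z - 1) + 3 * (z - 1) ^+ 2 - 2 * (z - 1) ^+ 3 by ring.
  have h1 : 0 <= (z - 1) ^+ 2 * (1 - (z - 1)) by apply: mulr_ge0 => //; lra.
  have h2 : 0 <= (1 - (z - 1)) ^+ 2 * (1 + 2 * (z - 1)).
    by apply: mulr_ge0; [exact: sqr_ge0|lra].
  by apply/andP; split; lra.
- have -> : step z = 1 - (3 - z) ^+ 3 / 6.
    have p0 : pos z = z by apply: max_l; lra.
    have p1 : pos (z - 1) = z - 1 by apply: max_l; lra.
    have p2 : pos (z - 2) = z - 2 by apply: max_l; lra.
    have p3 : pos (z - 3) = 0 by apply: max_r; lra.
    by rewrite /step p0 p1 p2 p3; field.
  have a0 : 0 <= 3 - z by lra.
  have a1 : 3 - z <= 1 by lra.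
  have b0 := exprn_ge0 3 a0; have b1 := exprn_ile1 3 a0 a1.
  by apply/andP; split; lra.
Qed.

Lemma step1_bounds z : 0 <= step1 z <= 1.
Proof.
have [z0|z0] := leP z 0; first by rewrite step1_le0// lexx ler01.
have [z3|z3] := leP 3 z; first by rewrite step1_ge3// lexx ler01.
have [z1|z1] := leP z 1; [|have [z2|z2] := leP z 2].
- rewrite /step1 (max_l (ltW z0)) !max_r ?(expr0n,mulr0,subr0,addr0)/=; try lra.
  have := exprn_ile1 2 (ltW z0) z1; have := sqr_ge0 z.
  by move=> ? ?; apply/andP; split; lra.
- rewrite /step1 (max_l (ltW z0)) (max_l (_ : 0 <= z - 1)); last lra.
  rewrite !max_r ?(expr0n,mulr0,subr0,addr0)/=; try lra.
  have a0 : 0 <= z - 1 by lra.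
  have a1 : z - 1 <= 1 by lra.
  have c0 := sqr_ge0 (z - 1); have c1 := exprn_ile1 2 a0 a1.
  have -> : z ^+ 2 - 3 * (z - 1) ^+ 2 = 1 + 2 * (z - 1) - 2 * (z - 1) ^+ 2 by ring.
  have : 0 <= (z - 1) * (1 - (z - 1)) by apply: mulr_ge0; lra.
  have : 0 <= (2 * (z - 1) - 1) ^+ 2 by exact: sqr_ge0.
  by move=> h1 h2; apply/andP; split; nra.
- have -> : step1 z = (3 - z) ^+ 2 / 2.
    have p0 : pos z = z by apply: max_l; lra.
    have p1 : pos (z - 1) = z - 1 by apply: max_l; lra.
    have p2 : pos (z - 2) = z - 2 by apply: max_l; lra.
    have p3 : pos (z - 3) = 0 by apply: max_r; lra.
    by rewrite /step1 p0 p1 p2 p3; field.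
  have a0 : 0 <= 3 - z by lra.
  have a1 : 3 - z <= 1 by lra.
  have := exprn_ile1 2 a0 a1; have := sqr_ge0 (3 - z).
  by move=> ? ?; apply/andP; split; lra.
Qed.

End smooth_step.

(** * The fundamental theorem of calculus on closed intervals *)

Section ftc_global.
Context {R : realType}.
Implicit Types (F f : R -> R) (a b : R).

Lemma continuous_integrable_itv f a b : continuous f ->
  mu.-integrable `[a, b] (EFin \o f).
Proof. by move=> cf; apply: within_integrable; exact: continuous_subspaceT. Qed.

Lemma integrable_itv_cst a b (k : R) :
  mu.-integrable `[a, b] (EFin \o (fun=> k)).
Proof. by apply: continuous_integrable_itv; exact: cst_continuous. Qed.

Lemma Rintegral_is_derive_in F f a b : a <= b ->
  (forall x : R, a <= x <= b -> is_derive x 1 F (f x)) ->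
  {within `[a, b], continuous f} ->
  \int[mu]_(x in `[a, b]) f x = F b - F a.
Proof.
rewrite le_eqVlt => /predU1P[->|ab] dF cf.
  by rewrite set_itv1 Rintegral_set1 subrr.
have cF x : a <= x <= b -> {for x, continuous F}.
  move=> /dF dFx; apply: differentiable_continuous; apply/derivable1_diffP.
  by case: dFx.
rewrite /Rintegral (@continuous_FTC2 _ f F)//.
- split.
  + by move=> x; rewrite in_itv/= => /andP[ax xb]; case: (dF x) => //; rewrite !ltW.
  + by apply: cvg_at_right_filter; apply: cF; rewrite lexx ltW.
  + by apply: cvg_at_left_filter; apply: cF; rewrite lexx ltW.
- move=> x; rewrite in_itv/= => /andP[ax xb]; rewrite derive1E.
  by case: (dF x) => //; rewrite !ltW.
Qed.

Lemma ac_on_is_derive_in F f a b :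
  (forall x : R, a <= x <= b -> is_derive x 1 F (f x)) ->
  {within `[a, b], continuous f} -> ac_on a b F f.
Proof.
move=> dF cf; split; first exact: within_integrable.
move=> x /andP[ax xb].
have -> : \int[mu]_(y in `[a, x]) f y = F x - F a.
  apply: Rintegral_is_derive_in => //.
  - by move=> y /andP[ay yx]; apply: dF; rewrite ay (le_trans yx).
  - by apply: continuous_subspaceW cf; apply: subset_itv; rewrite bnd_simp.
by rewrite addrC subrK.
Qed.

Lemma Rintegral_is_derive F f a b : a <= b ->
  (forall x : R, is_derive x 1 F (f x)) -> continuous f ->
  \int[mu]_(x in `[a, b]) f x = F b - F a.
Proof.
move=> ab dF cf; apply: Rintegral_is_derive_in => //.
exact: continuous_subspaceT.
Qed.

Lemma is_derive_primitive f a b x : continuous f -> a < x -> x < b ->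
  is_derive x 1 (fun y : R => \int[mu]_(s in `[a, y]) f s) (f x).
Proof.
move=> cf ax xb.
have [] := @continuous_FTC1_closed _ f a x b xb _ ax (cf x).
  exact: continuous_integrable_itv.
by move=> d1 d2; apply: DeriveDef; [exact: d1|rewrite -derive1E; exact: d2].
Qed.

Lemma is_derive_scale_shift F f (c s : R) : s != 0 ->
  (forall x : R, is_derive x 1 F (f x)) ->
  forall x : R, is_derive x 1 (fun x => F ((x - c) / s)) (f ((x - c) / s) / s).
Proof.
move=> s0 dF x.
have h1 : is_derive x 1 (fun x : R => (x - c) / s) s^-1.
  by apply: is_derive_eq; rewrite /GRing.scale/= subr0 mulr0 add0r mulr1.
exact: (@is_derive1_comp _ F (fun x : R => (x - c) / s) x _ _
  (dF ((x - c) / s)) h1).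
Qed.

End ftc_global.

(** * The du Bois-Reymond lemma *)

Section du_bois_reymond.
Context {R : realType}.

(** Second derivatives are required because the weak identity admits only test functions of class
    C^{2,1}. The support stays away from [a] and [b], so that [phi] vanishes on the lateral sides of
    a box. *)
Definition C2_test (a b : R) (phi phi1 phi2 : R -> R) : Prop :=
  [/\ forall x : R, is_derive x 1 phi (phi1 x),
      forall x : R, is_derive x 1 phi1 (phi2 x),
      continuous phi2 &
      exists c d : R, [/\ a < c, c < d, d < b &
        forall x, x <= c \/ d <= x -> phi x = 0 /\ phi1 x = 0]].

Lemma Rintegral_support (A B : set R) (f : R -> R) : A `<=` B ->
  (forall x, B x -> ~ A x -> f x = 0) ->
  \int[mu]_(x in B) f x = \int[mu]_(x in A) f x.
Proof.
move=> AB f0; rewrite Rintegral_mkcond [RHS]Rintegral_mkcond.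
congr Rintegral; apply/funext => x; rewrite !patchE.
case: ifPn => [|/negP]; rewrite inE => Bx; case: ifPn => [|/negP]; rewrite inE => Ax //.
  exact: f0.
by have := AB _ Ax.
Qed.

(** The kernel has integral 1, is at most 1/s, and lives on [c, c + 3s]. This interval lies in the
    ball of radius 4s, whose measure is 8s; hence the factor 8. *)
Lemma bump_mean_bound (a b c : R) (f : R -> R) (s : R) :
  a < c -> 0 < s -> c + 3 * s < b ->
  mu.-integrable `[a, b] (EFin \o f) ->
  (`|\int[mu]_(x in `[a, b]) (f x * (step1 ((x - c) / s) / s)) - f c|%:E
    <= 8%:E * davg (f \_ `[a, b]) c (4 * s))%E.
Proof.
move=> ac s0 sb intf.
have s3 : 0 < 3 * s by rewrite mulr_gt0.
have cb : c < b by lra.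
have sn0 : s != 0 by rewrite gt_eqF.
have fcE : (f \_ `[a, b]) c = f c.
  by rewrite patchE mem_set//= in_itv/= (ltW ac) ltW.
pose beta x := step1 ((x - c) / s) / s.
have dbeta := is_derive_scale_shift c sn0 (@is_derive_step R).
have cbeta : continuous beta.
  apply: (@continuous_is_derive _ _ (fun x => step2 ((x - c) / s) / s * s^-1)).
  move=> x; have := is_derive_scale_shift c sn0 (@is_derive_step1 R) x.
  move=> h; rewrite /beta; apply: is_derive_eq.
  by rewrite /GRing.scale/= mulr0 add0r mulrC.
have JS : `[c, c + 3 * s] `<=` `[a, b].
  by apply: subset_itv; rewrite bnd_simp// ltW.
have ifJ : mu.-integrable `[c, c + 3 * s] (EFin \o f).
  by apply: integrableS intf.
have ifc : mu.-integrable `[c, c + 3 * s] (EFin \o (fun x => f x - f c)).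
  by apply: integrable_sub => //; apply: continuous_integrable_itv; exact: cst_continuous.
have beta1 : \int[mu]_(x in `[c, c + 3 * s]) beta x = 1.
  rewrite (@Rintegral_is_derive _ (fun x => step ((x - c) / s)))//; last lra.
  rewrite (_ : (c + 3 * s - c) / s = 3); last by field.
  by rewrite subrr mul0r step_ge3// [X in _ - X]step_le0// subr0.
have ifb : mu.-integrable `[c, c + 3 * s] (EFin \o (fun x => f x * beta x)).
  rewrite (_ : (fun x => f x * beta x) = (fun x => beta x * f x)); last first.
    by apply/funext => x; rewrite mulrC.
  by apply: within_integrableM => //; exact: continuous_subspaceT.
have ifcb : mu.-integrable `[c, c + 3 * s] (EFin \o (fun x => (f x - f c) * beta x)).
  rewrite (_ : (fun x => _ * beta x) = (fun x => beta x * (f x - f c))); last first.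
    by apply/funext => x; rewrite mulrC.
  by apply: within_integrableM => //; exact: continuous_subspaceT.
rewrite (@Rintegral_support `[c, c + 3 * s])//; last first.
  move=> x _ /=; rewrite in_itv/= => /negP; rewrite negb_and -!ltNge => /orP[xc|xc].
  - by rewrite step1_le0 ?mul0r ?mulr0// ler_pdivrMr// mul0r; lra.
  - by rewrite step1_ge3 ?mul0r ?mulr0// ler_pdivlMr//; lra.
have -> : \int[mu]_(x in `[c, c + 3 * s]) (f x * (step1 ((x - c) / s) / s)) - f c =
    \int[mu]_(x in `[c, c + 3 * s]) ((f x - f c) * beta x).
  have ibeta : mu.-integrable `[c, c + 3 * s] (EFin \o beta).
    exact: continuous_integrable_itv.
  have fcb : f c = \int[mu]_(x in `[c, c + 3 * s]) (f c * beta x).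
    by rewrite RintegralZl// beta1 mulr1.
  rewrite [in LHS]fcb -RintegralB//; last first.
    exact: integrable_mull.
  by apply: eq_Rintegral => x _; rewrite [RHS]mulrBl.
have bd := @Rintegral_norm_bound _ `[c, c + 3 * s] _ (fun x => f x - f c) s^-1
  (measurable_itv _) ifcb ifc.
have {}bd : `|\int[mu]_(x in `[c, c + 3 * s]) ((f x - f c) * beta x)| <=
    s^-1 * \int[mu]_(x in `[c, c + 3 * s]) `|f x - f c|.
  apply: bd => x _; rewrite normrM mulrC ler_wpM2r//.
  have /andP[h0 h1] := step1_bounds ((x - c) / s).
  rewrite /beta ger0_norm; last by rewrite divr_ge0// ltW.
  by rewrite ler_piMl// invr_ge0 ltW.
apply: (@le_trans _ _ (s^-1 * \int[mu]_(x in `[c, c + 3 * s]) `|f x - f c|)%:E).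
  by rewrite lee_fin.
rewrite /davg /iavg lebesgue_measure_ball; last by rewrite mulr_ge0// ltW.
rewrite muleA inver mulrn_eq0/= gt_eqF ?mulr_gt0//.
rewrite (_ : 8%:E * _ = (s^-1)%:E)%E; last by rewrite -EFinM; congr EFin; field.
rewrite EFinM.
apply: lee_wpmul2l; first by rewrite lee_fin invr_ge0 ltW.
rewrite /Rintegral fineK; last first.
  by apply: integrable_fin_num => //; exact: integrable_norm.
have mfab : measurable_fun [set: R] (f \_ `[a, b]).
  apply/(measurable_restrictT _ _).1 => //.
  by move/integrableP : intf => [/measurable_EFinP].
have -> : (\int[mu]_(x in `[c, (c + 3 * s)%R]) `|f x - f c|%:E =
  \int[mu]_(x in `[c, (c + 3 * s)%R]) `|((f \_ `[a, b]) x - (f \_ `[a, b]) c)%:E|)%E.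
  apply: eq_integral => x /set_mem xJ; rewrite fcE patchE mem_set//.
  exact: JS.
apply: ge0_subset_integral => //.
- exact: measurable_ball.
- apply/measurable_EFinP; apply: measurableT_comp => //.
  by apply: measurable_funB => //; exact: measurable_funTS.
- move=> x /=; rewrite in_itv/= => /andP[cx xc]; rewrite /ball/= distrC ger0_norm; lra.
Qed.

Lemma bump_mean_cvg (a b c : R) (f : R -> R) (s : R^nat) :
  a < c -> (forall n, 0 < s n) -> (forall n, c + 3 * s n < b) ->
  s @ \oo --> 0 ->
  mu.-integrable `[a, b] (EFin \o f) -> lebesgue_pt (f \_ `[a, b]) c ->
  \int[mu]_(x in `[a, b]) (f x * (step1 ((x - c) / s n) / s n))
    @[n --> \oo] --> f c.
Proof.
move=> ac s0 sb scvg intf lc.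
have s4 n : 0 < 4 * s n by rewrite mulr_gt0.
have s4cvg : (fun n => 4 * s n) @ \oo --> 0.
  by rewrite -(mulr0 4); apply: cvgM => //; exact: cvg_cst.
have dcvg : davg (f \_ `[a, b]) c (4 * s n) @[n --> \oo] --> 0%E.
  by move/cvge_at_rightP : lc; apply; split.
apply/subr_cvg0/norm_cvg0P.
have : (`|\int[mu]_(x in `[a, b]) (f x * (step1 ((x - c) / s n) / s n)) - f c|%:E
    @[n --> \oo] --> 0)%E.
  apply: (@squeeze_cvge _ _ _ _ (cst 0%E) _
    (fun n => 8%:E * davg (f \_ `[a, b]) c (4 * s n))%E).
  - apply: nearW => n; rewrite /= lee_fin normr_ge0/=.
    exact: bump_mean_bound.
  - exact: cvg_cst.
  - by rewrite -(mule0 8%:E); apply: cvgeZl.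
by move/fine_cvg.
Qed.

(** The test function is a smooth step up at [c] minus a smooth step up at [d]. It tends pointwise
    to the indicator of []c, d]], while its derivative is a difference of two kernels whose means
    converge at the Lebesgue points [c] and [d]. *)
Lemma increment_of_weak_derivative (a b : R) (Psi Delta : R -> R) :
  mu.-integrable `[a, b] (EFin \o Psi) ->
  mu.-integrable `[a, b] (EFin \o Delta) ->
  (forall phi phi1 phi2, C2_test a b phi phi1 phi2 ->
     \int[mu]_(x in `[a, b]) (Delta x * phi x) +
     \int[mu]_(x in `[a, b]) (Psi x * phi1 x) = 0) ->
  forall c d, a < c -> c < d -> d < b ->
    lebesgue_pt (Psi \_ `[a, b]) c -> lebesgue_pt (Psi \_ `[a, b]) d ->
    Psi d - Psi c = \int[mu]_(x in `]c, d]) Delta x.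
Proof.
move=> iPsi iDelta H c d ac cd db lc ld.
(* The factor 1/4 leaves room for the support of [phi n], which ends at [d + 3 * s n], to stay below
   [b]. *)
pose s (n : nat) := (Num.min (b - d) (d - c)) / 4 * n.+1%:R^-1.
have m0 : 0 < Num.min (b - d) (d - c) by rewrite lt_min !subr_gt0 db cd.
have s0 n : 0 < s n by rewrite mulr_gt0 ?invr_gt0 ?divr_gt0.
have sle n : s n <= (Num.min (b - d) (d - c)) / 4.
  apply: ler_piMr; first by rewrite divr_ge0 // ltW.
  by rewrite invf_le1 // ler1n.
have sd n : d + 3 * s n < b.
  have := sle n; have : Num.min (b - d) (d - c) <= b - d by rewrite ge_min lexx.
  by move: m0; lra.
have sc n : c + 3 * s n < b by have := sd n; lra.
have s_cvg : s @ \oo --> 0.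
  rewrite -(mulr0 (Num.min (b - d) (d - c) / 4)).
  apply: cvgM; first exact: cvg_cst.
  exact: cvg_harmonic.
pose phi n x := step ((x - c) / s n) - step ((x - d) / s n).
pose phi1 n x := step1 ((x - c) / s n) / s n - step1 ((x - d) / s n) / s n.
pose phi2 n x := step2 ((x - c) / s n) / s n / s n -
  step2 ((x - d) / s n) / s n / s n.
have test n : C2_test a b (phi n) (phi1 n) (phi2 n).
  have sn : s n != 0 by rewrite gt_eqF.
  split.
  - move=> x; have h1 := is_derive_scale_shift c sn (@is_derive_step R) x.
    have h2 := is_derive_scale_shift d sn (@is_derive_step R) x.
    exact: is_deriveB.
  - move=> x; have h1 := is_derive_scale_shift c sn (@is_derive_step1 R) x.
    have h2 := is_derive_scale_shift d sn (@is_derive_step1 R) x.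
    rewrite /phi1; apply: is_derive_eq.
    by rewrite /GRing.scale/= !mulr0 !add0r /phi2; ring.
  - have cs (e : R) : continuous (fun x : R => step2 ((x - e) / s n) / s n / s n).
      move=> x; apply: cvgM; last exact: cvg_cst.
      apply: cvgM; last exact: cvg_cst.
      apply: (@continuous_comp _ _ _ (fun x : R => (x - e) / s n) step2);
        last exact: continuous_step2.
      apply: cvgM; last exact: cvg_cst.
      by apply: cvgB => //; exact: cvg_cst.
    by move=> x; apply: cvgB; exact: cs.
  - exists c, (d + 3 * s n); split => //.
    + by have := s0 n; lra.
    + move=> x [xc|xd].
      * have h e : c <= e -> (x - e) / s n <= 0.
          by move=> ce; rewrite ler_pdivrMr// mul0r; lra.
        have hc := h _ (lexx c); have hd := h _ (ltW cd).
        by rewrite /phi /phi1 !step_le0// !step1_le0// mul0r subrr.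
      * have h e : e <= d -> 3 <= (x - e) / s n.
          by move=> ce; rewrite ler_pdivlMr//; lra.
        have hc := h _ (ltW cd); have hd := h _ (lexx d).
        by rewrite /phi /phi1 !step_ge3// !step1_ge3// mul0r !subrr.
have Hn n := H _ _ _ (test n).
have cc := bump_mean_cvg ac s0 sc s_cvg iPsi lc.
have dc := bump_mean_cvg (lt_trans ac cd) s0 sd s_cvg iPsi ld.
have cbeta n (e : R) : continuous (fun x : R => step1 ((x - e) / s n) / s n).
  apply: (@continuous_is_derive _ _ (fun x => step2 ((x - e) / s n) / s n * (s n)^-1)).
  move=> x; have sn : s n != 0 by rewrite gt_eqF.
  have := is_derive_scale_shift e sn (@is_derive_step1 R) x.
  move=> h; apply: is_derive_eq.
  by rewrite /GRing.scale/=; ring.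
have ib n (e : R) : mu.-integrable `[a, b]
    (EFin \o (fun x => Psi x * (step1 ((x - e) / s n) / s n))).
  rewrite (_ : (fun x => Psi x * _) =
    (fun x => (step1 ((x - e) / s n) / s n) * Psi x)); last first.
    by apply/funext => x; rewrite mulrC.
  by apply: within_integrableM => //; exact: continuous_subspaceT.
have PsiE n : \int[mu]_(x in `[a, b]) (Psi x * phi1 n x) =
    \int[mu]_(x in `[a, b]) (Psi x * (step1 ((x - c) / s n) / s n)) -
    \int[mu]_(x in `[a, b]) (Psi x * (step1 ((x - d) / s n) / s n)).
  by rewrite -RintegralB//; apply: eq_Rintegral => x _; rewrite mulrBr.
have lim1 : \int[mu]_(x in `[a, b]) (Psi x * phi1 n x) @[n --> \oo] -->
    Psi c - Psi d.
  under eq_fun do rewrite PsiE.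
  exact: cvgB.
have lim2 : \int[mu]_(x in `[a, b]) (Delta x * phi n x) @[n --> \oo] -->
    \int[mu]_(x in `]c, d]) Delta x.
  have mD : measurable_fun `[a, b] Delta.
    by move/integrableP : iDelta => [/measurable_EFinP].
  have cphi n : continuous (phi n).
    by have [h _ _ _] := test n; exact: (continuous_is_derive h).
  have phi01 n (x : R) : `|phi n x| <= 1.
    rewrite /phi; have /andP[h1 h2] := step_bounds ((x - c) / s n).
    have /andP[h3 h4] := step_bounds ((x - d) / s n).
    by rewrite ler_norml; apply/andP; split; lra.
  have pw (x : R) : a <= x <= b -> (EFin (Delta x * phi n x)) @[n --> \oo] -->
      EFin ((Delta \_ `]c, d]) x).
    move=> /andP[ax xb].
    have big (e : R) : e < x -> \forall n \near \oo, 3 <= (x - e) / s n.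
      move=> ex; have x0 : 0 < (x - e) / 3 by rewrite divr_gt0 ?subr_gt0.
      have /cvgr0Pnorm_lt/(_ _ x0) := s_cvg.
      apply: filterS => n; rewrite gtr0_norm// => h.
      by rewrite ler_pdivlMr//; lra.
    have small (e : R) n : x <= e -> (x - e) / s n <= 0.
      by move=> xe; rewrite ler_pdivrMr// mul0r subr_le0.
    apply: cvg_near_cst.
    rewrite patchE; case: ifPn => [|/negP]; rewrite inE/= in_itv/=.
    - move=> /andP[cx xd]; have := big _ cx; apply: filterS => n h.
      by rewrite /phi step_ge3// step_le0 ?small// subr0 mulr1.
    - move=> /negP; rewrite negb_and -leNgt -ltNge => /orP[xc|dx].
        apply: nearW => n; rewrite /phi !step_le0 ?subrr ?mulr0// small//.
        by rewrite (le_trans xc)// ltW.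
      have h1 := big _ dx; have h2 := big _ (lt_trans cd dx).
      by near=> n; rewrite /phi !step_ge3 ?subrr ?mulr0//; near: n.
  have [] := @dominated_convergence _ _ R mu `[a, b] (measurable_itv _)
    (fun n x => (Delta x * phi n x)%:E) (EFin \o (Delta \_ `]c, d]))
    (EFin \o (fun x => `|Delta x|)).
  - move=> n; apply/measurable_EFinP; apply: measurable_funM => //.
    by apply: measurable_funTS; exact: continuous_measurable_fun.
  - apply/measurable_EFinP.
    apply/measurable_restrict => //; apply: measurable_funS mD => //.
  - by apply: aeW => x /=; rewrite in_itv/=; exact: pw.
  - exact: integrable_norm.
  - apply: aeW => x n _ /=; rewrite lee_fin normrM ler_piMr//.
  - move=> ifin _ lim.
    rewrite [X in _ --> X](_ : _ = \int[mu]_(x in `[a, b]) (Delta \_ `]c, d]) x).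
      by apply: fine_cvg; rewrite /Rintegral fineK//; exact: integrable_fin_num.
    rewrite (@Rintegral_support `]c, d] `[a, b] (Delta \_ `]c, d])).
    + by apply: eq_Rintegral => x xcd; rewrite patchE xcd.
    + by apply: subset_itv; rewrite bnd_simp ltW.
    + by move=> x _ /= h; rewrite patchE memNset.
have L : \int[mu]_(x in `[a, b]) (Delta x * phi n x) +
    \int[mu]_(x in `[a, b]) (Psi x * phi1 n x) @[n --> \oo] -->
    \int[mu]_(x in `]c, d]) Delta x + (Psi c - Psi d) by exact: cvgD.
have L0 : \int[mu]_(x in `[a, b]) (Delta x * phi n x) +
    \int[mu]_(x in `[a, b]) (Psi x * phi1 n x) @[n --> \oo] --> (0 : R).
  by apply: cvg_near_cst; apply: nearW.
have E : \int[mu]_(x in `]c, d]) Delta x + (Psi c - Psi d) = 0.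
  by apply: (cvg_unique _ L L0); exact: Rhausdorff.
by lra.
Unshelve. all: by end_near. Qed.

Lemma ae_exists_itv (a b : R) (P : R -> Prop) : a < b ->
  {ae mu, forall x, P x} -> exists2 x, a < x < b & P x.
Proof.
move=> ab aeP; apply: contrapT => nP.
have : mu.-negligible `]a, b[%classic.
  apply: negligibleS aeP => x /=; rewrite in_itv/= => axb Px.
  by apply: nP; exists x.
move=> [A [mA A0 abA]].
have : (mu `]a, b[%classic <= mu A)%E by apply: le_measure => //; rewrite inE.
rewrite A0 lebesgue_measure_itv/= lte_fin ab -EFinB lee_fin.
by rewrite subr_le0 leNgt ab.
Qed.

(** Almost every point is a Lebesgue point of [Psi]. Fixing one of them, [c], determines the
    constant [k], and the increment formula between [c] and any other one gives the claim. *)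
Lemma du_bois_reymond (a b : R) (Psi Delta : R -> R) : a < b ->
  mu.-integrable `[a, b] (EFin \o Psi) ->
  mu.-integrable `[a, b] (EFin \o Delta) ->
  (forall phi phi1 phi2, C2_test a b phi phi1 phi2 ->
     \int[mu]_(x in `[a, b]) (Delta x * phi x) +
     \int[mu]_(x in `[a, b]) (Psi x * phi1 x) = 0) ->
  exists k : R, {ae mu, forall x : R, a < x < b ->
    Psi x = k + \int[mu]_(y in `[a, x]) Delta y}.
Proof.
move=> ab iPsi iDelta H.
have lae : {ae mu, forall x, lebesgue_pt (Psi \_ `[a, b]) x}.
  apply: lebesgue_differentiation.
  exact: integrable_locally_restrict.
have [c /andP[ac cb] lc] := ae_exists_itv ab lae.
exists (Psi c - \int[mu]_(y in `[a, c]) Delta y).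
apply: ae_imply lae => x lx /andP[ax xb].
have sub y z : a < y -> y < z -> z < b ->
    \int[mu]_(s in `[a, z]) Delta s - \int[mu]_(s in `[a, y]) Delta s =
    \int[mu]_(s in `]y, z]) Delta s.
  move=> ay yz zb.
  rewrite -(@Rintegral_itvB _ _ (BLeft a) (BRight z) y) ?bnd_simp//; last exact: ltW.
    by apply: integrable_itvS iDelta _ _; rewrite bnd_simp// ltW.
  exact: ltW.
have main := increment_of_weak_derivative iPsi iDelta H.
have [xc|cx|->] := ltgtP x c; last by rewrite subrK.
- have := main _ _ ax xc cb lx lc; rewrite -(sub _ _ ax xc cb); lra.
- have := main _ _ ac cx xb lc lx; rewrite -(sub _ _ ac cx xb); lra.
Qed.

End du_bois_reymond.

(** * Powers and the flux; continuity on the plane *)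

Lemma ler_powR_base (R : realType) (r x y : R) : 0 <= r -> 0 <= x -> x <= y ->
  x `^ r <= y `^ r.
Proof.
by move=> r0 x0 xy; apply: ge0_ler_powR; rewrite ?nnegrE// (le_trans x0).
Qed.

Section flux_theory.
Context {R : realType}.
Variable p : R.
Hypothesis p2 : 2 < p.
Implicit Types (q a b : R).

Definition flux q := `|q| `^ (p - 2) * q.

Let p20 : 0 < p - 2. Proof. by rewrite subr_gt0. Qed.
Let p10 : 0 < p - 1. Proof. by have := p2; lra. Qed.
Let p0 : 0 < p. Proof. by have := p2; lra. Qed.

Lemma fluxN q : flux (- q) = - flux q.
Proof. by rewrite /flux normrN mulrN. Qed.

Lemma flux_ge0E q : 0 <= q -> flux q = q `^ (p - 1).
Proof.
move=> q0; rewrite /flux ger0_norm// mulrC.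
rewrite (_ : p - 2 = (p - 1) - 1); last by ring.
by rewrite mulr_powRB1.
Qed.

Lemma norm_flux q : `|flux q| = `|q| `^ (p - 1).
Proof.
by rewrite -flux_ge0E// /flux normrM normr_id ger0_norm ?powR_ge0.
Qed.

(** The inequality is clear for the moduli, where r -> r^(p-1) is increasing. Passing from the
    moduli to [a] and [b] only replaces |a| |b| by the smaller a b in a term with the nonpositive
    factor - (A + B). *)
Lemma flux_monotone a b : 0 <= (flux a - flux b) * (a - b).
Proof.
pose A := `|a| `^ (p - 2); pose B := `|b| `^ (p - 2).
have A0 : 0 <= A by exact: powR_ge0.
have B0 : 0 <= B by exact: powR_ge0.
have key : 0 <= (A * `|a| - B * `|b|) * (`|a| - `|b|).
  have h (x y : R) : 0 <= x -> x <= y -> x `^ (p - 2) * x <= y `^ (p - 2) * y.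
    move=> x0 xy; apply: ler_pM => //; first exact: powR_ge0.
    by apply: ler_powR_base => //; exact: ltW.
  have [ab|ba] := leP `|a| `|b|.
    by apply: mulr_le0; rewrite subr_le0// h.
  by apply: mulr_ge0; rewrite subr_ge0 ?h// ltW.
apply: (le_trans key); rewrite /flux -/A -/B.
have ab : a * b <= `|a| * `|b| by rewrite -normrM ler_norm.
have -> : (A * `|a| - B * `|b|) * (`|a| - `|b|) =
   A * `|a| ^+ 2 + B * `|b| ^+ 2 - (A + B) * (`|a| * `|b|) by ring.
have -> : (A * a - B * b) * (a - b) =
   A * a ^+ 2 + B * b ^+ 2 - (A + B) * (a * b) by ring.
rewrite !real_normK ?num_real// lerD2l lerN2 ler_wpM2l// addr_ge0//.
Qed.

(** A crude Young inequality: |a|^(p-1) |b| is at most the p-th power of the larger modulus. *)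
Lemma norm_flux_mul a b : `|flux a| * `|b| <= `|a| `^ p + `|b| `^ p.
Proof.
have h (x y : R) : 0 <= x -> x <= y -> x `^ (p - 1) * y <= y `^ p.
  move=> x0 xy; have y0 := le_trans x0 xy.
  rewrite -(mulr_powRB1 y0 p0) mulrC ler_wpM2l//.
  by apply: ler_powR_base => //; exact: ltW.
rewrite norm_flux; have [ab|ba] := leP `|a| `|b|.
  by rewrite (le_trans (h _ _ _ ab))// lerDr powR_ge0.
have -> : `|a| `^ (p - 1) * `|b| = `|b| * `|a| `^ (p - 1) by rewrite mulrC.
apply: (@le_trans _ _ (`|a| * `|a| `^ (p - 1))).
  by rewrite ler_wpM2r ?powR_ge0// ltW.
by rewrite mulr_powRB1// lerDl powR_ge0.
Qed.

Lemma norm_flux_le1D a : `|flux a| <= 1 + `|a| `^ p.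
Proof. by have := norm_flux_mul a 1; rewrite normr1 mulr1 powR1 addrC. Qed.

Lemma continuous_powR (r : R) : 0 < r -> continuous (fun x : R => `|x| `^ r).
Proof.
move=> r0 x; have [x0|x0] := eqVneq x 0.
  rewrite x0; apply/cvgrPdist_le => e e0 /=.
  rewrite normr0 powR0 ?gt_eqF//.
  near=> y; rewrite sub0r normrN ger0_norm ?powR_ge0//.
  have ye : `|y| <= e `^ r^-1.
    near: y; exists (e `^ r^-1) => /=; first exact: powR_gt0.
    by move=> y /=; rewrite sub0r normrN => /ltW.
  have := ler_powR_base (ltW r0) (normr_ge0 y) ye => /le_trans; apply.
  by rewrite -powRrM mulVf ?gt_eqF// powRr1 // ltW.
have nx : 0 < `|x| by rewrite normr_gt0.
apply: (@cvg_comp _ _ _ (fun x : R => `|x|) (fun y => y `^ r) _ (nbhs `|x|)).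
  exact: norm_continuous.
suff : {for `|x|, continuous (fun y : R => y `^ r)} by [].
apply: differentiable_continuous; apply/derivable1_diffP.
by apply: derivable_powR; rewrite in_itv/= nx.
Unshelve. all: by end_near. Qed.

Lemma continuous_flux : continuous flux.
Proof. by move=> x; apply: cvgM; [exact: continuous_powR|exact: cvg_id]. Qed.

Lemma measurable_flux : measurable_fun [set: R] flux.
Proof. by apply: continuous_measurable_fun; exact: continuous_flux. Qed.

Lemma measurable_norm_powR (r : R) : measurable_fun [set: R] (fun x : R => `|x| `^ r).
Proof.
exact: (@measurableT_comp _ _ _ _ _ _ (fun x => x `^ r)) => //.
Qed.

End flux_theory.

(** The primitive from [a] vanishes on the whole interval, and its derivative at [x] is [f x]. *)
Lemma continuous_ge0_Rintegral_eq0 (R : realType) (f : R -> R) (a b : R) :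
  a < b -> continuous f -> (forall x, 0 <= f x) ->
  \int[mu]_(x in `[a, b]) f x = 0 -> forall x, a < x < b -> f x = 0.
Proof.
move=> ab cf f0 If x /andP[ax xb].
have F0 y : a <= y -> y <= b -> \int[mu]_(s in `[a, y]) f s = 0.
  move=> ay yb; apply/eqP; rewrite eq_le Rintegral_ge0// andbT -If.
  rewrite -subr_ge0 (@Rintegral_itvB _ _ (BLeft a) (BRight b) y) ?bnd_simp//.
    exact: Rintegral_ge0.
  exact: continuous_integrable_itv.
have [_ <-] := is_derive_primitive cf ax xb.
rewrite -(@derive_cst _ _ _ 0 x 1); apply: near_eq_derive.
near=> y; apply: F0.
- by apply/ltW; near: y; exact: lt_nbhsr.
- by apply/ltW; near: y; exact: lt_nbhsl.
Unshelve. all: by end_near. Qed.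

Lemma continuous_pair_fun (R : realType) (g h : R -> R) (f : R * R -> R) :
  continuous g -> continuous h -> continuous f ->
  continuous (fun x => f (g x, h x)).
Proof.
move=> cg ch cf x.
have fE : (fun z : R * R => f (z.1, z.2)) = f by apply/funext => -[].
have := @continuous2_cvg _ R R R (nbhs x) _ g h (fun a b => f (a, b)) (g x) (h x).
by apply; [rewrite fE; exact: cf|exact: cg|exact: ch].
Qed.

Lemma continuous_slice1 (R : realType) (f : R * R -> R) (x : R) :
  continuous f -> continuous (fun t => f (x, t)).
Proof.
by move=> cf; apply: continuous_pair_fun => // t; [exact: cvg_cst|exact: cvg_id].
Qed.

Lemma continuous_slice2 (R : realType) (f : R * R -> R) (t : R) :
  continuous f -> continuous (fun x => f (x, t)).
Proof.
by move=> cf; apply: continuous_pair_fun => // x; [exact: cvg_id|exact: cvg_cst].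
Qed.

Lemma continuous_fst_fun (R : realType) (f : R -> R) :
  continuous f -> continuous (fun z : R * R => f z.1).
Proof.
move=> cf [x t]; apply: (@cvg_comp _ _ _ fst f _ (nbhs x)); last exact: cf.
exact: (@cvg_fst _ _ (nbhs x) (nbhs t)).
Qed.

Lemma continuous_snd_fun (R : realType) (f : R -> R) :
  continuous f -> continuous (fun z : R * R => f z.2).
Proof.
move=> cf [x t]; apply: (@cvg_comp _ _ _ snd f _ (nbhs t)); last exact: cf.
exact: (@cvg_snd _ _ (nbhs x) (nbhs t)).
Qed.

Lemma continuous_bounded_itv (R : realType) (f : R -> R) (a b : R) : continuous f ->
  exists2 M, 0 < M & forall x, a <= x <= b -> `|f x| <= M.
Proof.
move=> cf; have := compact_bounded (continuous_compact (continuous_subspaceT cf)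
  (segment_compact (a := a) (b := b))).
move=> [M [_ HM]]; exists (`|M| + 1) => [|x xab]; first by rewrite ltr_wpDl.
apply: (HM (`|M| + 1)); first by rewrite (le_lt_trans (ler_norm _))// ltrDl.
by exists x => //=; rewrite in_itv.
Qed.

Lemma continuous_param_Rintegral (R : realType) (f : R * R -> R) (a b : R) :
  continuous f ->
  continuous (fun t => \int[mu]_(x in `[a, b]) f (x, t)).
Proof.
move=> cf t0.
have cfx t : continuous (fun x => f (x, t)).
  exact: continuous_slice2.
have cft x : continuous (fun t => f (x, t)).
  exact: continuous_slice1.
have cK : compact (`[a, b] `*` `[t0 - 1, t0 + 1]).
  by apply: compact_setX; exact: segment_compact.
have [M [Mreal HM]] := compact_bounded (continuous_compact
  (continuous_subspaceT cf) cK).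
have := @continuity_under_integral R _ _ mu (fun t x => f (x, t)) `[a, b]
  (measurable_itv _) (t0 - 1) (t0 + 1) _ _ (fun=> `|M| + 1).
apply.
- by move=> t _; exact: continuous_integrable_itv.
- by apply: aeW => x _ t _; exact: cft.
- by apply: continuous_integrable_itv; exact: cst_continuous.
- move=> t /=; rewrite in_itv/= => /andP[t1 t2]; apply: aeW => x xab.
  apply: (HM (`|M| + 1)); first by rewrite (le_lt_trans (ler_norm _))// ltrDl.
  by exists (x, t) => //; split => //=; rewrite in_itv/= !ltW.
- by rewrite inE/= in_itv/=; apply/andP; split; lra.
Qed.

(** * Integrals over boxes *)

Section tonelli_on_boxes.
Context {R : realType}.
Implicit Types (X Y : set R) (f : R * R -> \bar R) (k : R * R -> R).
Local Open Scope ereal_scope.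

(** An iterated integral over a box becomes one over the plane of the restricted function, the form
    to which the Fubini theorems apply. *)
Lemma integral_box X Y f :
  \int[mu]_(x in X) \int[mu]_(y in Y) f (x, y) =
  \int[mu]_x \int[mu]_y (f \_ (X `*` Y)) (x, y).
Proof.
rewrite integral_mkcond; apply: eq_integral => x _.
rewrite patchE; case: ifPn => [|/negP]; rewrite inE => xX.
  rewrite integral_mkcond; apply: eq_integral => y _.
  rewrite !patchE; congr (if _ then _ else _).
  by apply/idP/idP; rewrite !inE => //= -[].
by rewrite integral0_eq// => y _; rewrite patchE memNset//= => -[].
Qed.

Lemma integral_box_swap X Y f :
  \int[mu]_(y in Y) \int[mu]_(x in X) f (x, y) =
  \int[mu]_y \int[mu]_x (f \_ (X `*` Y)) (x, y).
Proof.
rewrite (@integral_box Y X (fun z => f (z.2, z.1))).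
apply: eq_integral => y _; apply: eq_integral => x _; rewrite !patchE/=.
congr (if _ then _ else _).
by apply/idP/idP; rewrite !inE /= => -[].
Qed.

Lemma measurable_box X Y f : measurable X -> measurable Y ->
  measurable_fun [set: R * R] f -> measurable_fun [set: R * R] (f \_ (X `*` Y)).
Proof.
move=> mX mY mf; apply/(measurable_restrictT _ _).1.
  exact: measurableX.
exact: measurable_funTS.
Qed.

Lemma tonelli_box X Y f : measurable X -> measurable Y ->
  measurable_fun [set: R * R] f -> (forall z, 0 <= f z) ->
  \int[mu]_(x in X) \int[mu]_(y in Y) f (x, y) =
  \int[mu]_(y in Y) \int[mu]_(x in X) f (x, y).
Proof.
move=> mX mY mf f0; rewrite integral_box integral_box_swap.
apply: (@fubini_tonelli _ _ _ _ _ mu mu (f \_ (X `*` Y))).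
- exact: measurable_box.
- by move=> z; rewrite patchE; case: ifP.
Qed.

Lemma integrable_box X Y k : measurable X -> measurable Y ->
  measurable_fun [set: R * R] k ->
  \int[mu]_(y in Y) \int[mu]_(x in X) `|k (x, y)|%:E < +oo ->
  (mu \x mu).-integrable setT ((EFin \o k) \_ (X `*` Y)).
Proof.
move=> mX mY mk koo; apply/(@integrable21ltyP _ _ _ _ _ mu mu).
  by apply: measurable_box => //; exact/measurable_EFinP.
rewrite (integral_box_swap X Y (fun z => `|k z|%:E)) in koo.
apply: le_lt_trans koo; rewrite le_eqVlt; apply/orP; left; apply/eqP.
apply: eq_integral => y _; apply: eq_integral => x _; rewrite !patchE.
by case: ifP => //= _; exact: abse0.
Qed.

Lemma ae_integrable_box1 X Y k : measurable X -> measurable Y ->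
  measurable_fun [set: R * R] k ->
  \int[mu]_(y in Y) \int[mu]_(x in X) `|k (x, y)|%:E < +oo ->
  {ae mu, forall x, X x -> mu.-integrable Y (EFin \o (fun y => k (x, y)))}.
Proof.
move=> mX mY mk koo; have := ae_integrable1 (integrable_box mX mY mk koo).
apply: ae_imply => x + Xx.
rewrite [in X in _ -> X]integrable_mkcond//; apply: eq_integrable => // y _.
rewrite !patchE; congr (if _ then _ else _).
by apply/idP/idP; rewrite !inE => //= -[].
Qed.

Lemma ae_integrable_box2 X Y k : measurable X -> measurable Y ->
  measurable_fun [set: R * R] k ->
  \int[mu]_(y in Y) \int[mu]_(x in X) `|k (x, y)|%:E < +oo ->
  {ae mu, forall y, Y y -> mu.-integrable X (EFin \o (fun x => k (x, y)))}.
Proof.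
move=> mX mY mk koo; have := ae_integrable2 (integrable_box mX mY mk koo).
apply: ae_imply => x + Xx.
rewrite [in X in _ -> X]integrable_mkcond//; apply: eq_integrable => // y _.
rewrite !patchE; congr (if _ then _ else _).
by apply/idP/idP; rewrite !inE => //= -[].
Qed.

Lemma measurable_slice1 f x : measurable_fun [set: R * R] f ->
  measurable_fun [set: R] (fun y => f (x, y)).
Proof. by move=> mf; exact: (measurableT_comp mf (@pair1_measurable _ _ _ _ x)). Qed.

Lemma measurable_slice2 f y : measurable_fun [set: R * R] f ->
  measurable_fun [set: R] (fun x => f (x, y)).
Proof. by move=> mf; exact: (measurableT_comp mf (@pair2_measurable _ _ _ _ y)). Qed.

Lemma measurable_rslice1 k x : measurable_fun [set: R * R] k ->
  measurable_fun [set: R] (fun y => k (x, y)).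
Proof. by move=> mf; exact: (measurableT_comp mf (@pair1_measurable _ _ _ _ x)). Qed.

Lemma measurable_rslice2 k y : measurable_fun [set: R * R] k ->
  measurable_fun [set: R] (fun x => k (x, y)).
Proof. by move=> mf; exact: (measurableT_comp mf (@pair2_measurable _ _ _ _ y)). Qed.

Lemma measurable_integral_slice X f : measurable X ->
  measurable_fun [set: R * R] f -> (forall z, 0 <= f z) ->
  measurable_fun [set: R] (fun y => \int[mu]_(x in X) f (x, y)).
Proof.
move=> mX mf f0.
have -> : (fun y => \int[mu]_(x in X) f (x, y)) =
    (fun y => \int[mu]_x (f \_ (X `*` setT)) (x, y)).
  apply/funext => y; rewrite integral_mkcond; apply: eq_integral => x _.
  rewrite !patchE; congr (if _ then _ else _).
  by apply/idP/idP; rewrite !inE //= => -[].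
apply: (@measurable_fun_fubini_tonelli_G _ _ _ _ _ mu (f \_ (X `*` setT))).
- exact: measurable_box.
- by move=> z; rewrite patchE; case: ifP.
Qed.

End tonelli_on_boxes.

(** Lebesgue differentiation along the intervals [x - h, x]. They shrink nicely with constant 4:
    such an interval lies in the ball of radius 2h, whose measure is 4h. A single null set serves
    all sequences [h], which matters because it is fixed before the sequence. *)
Lemma backward_mean_cvg (R : realType) (a b : R) (f : R -> R) :
  mu.-integrable `[a, b] (EFin \o f) ->
  {ae mu, forall x : R, a < x < b -> forall h : R^nat, (forall n, 0 < h n) ->
    h @ \oo --> 0 ->
    (h n)^-1 * \int[mu]_(y in `[x - h n, x]) f y @[n --> \oo] --> f x}.
Proof.
move=> fi.
have locf := integrable_locally_restrict (measurable_itv _) fi.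
have := lebesgue_differentiation locf; apply: ae_imply => x lx /andP[ax xb] h h0 hcvg.
pose E (x : R) n := `[x - h n, x]%classic.
have muE y n : mu (E y n) = (h n)%:E.
  rewrite /E lebesgue_measure_itv/= lte_fin gtrBl h0 -EFinD opprB addrC subrK//.
have h20 n : 0 < 2 * h n by rewrite mulr_gt0.
have nE y : nicely_shrinking y (E y).
  split=> [n|]; first exact: measurable_itv.
  exists (4, fun n => PosNum (h20 n)); split => //= [|n z|n].
  - by rewrite -(mulr0 2); apply: cvgM => //; exact: cvg_cst.
  - rewrite /E/= in_itv/= /ball/= => /andP[h1 h2].
    by rewrite ger0_norm ?subr_ge0//; have := h0 n; lra.
  - by rewrite (lebesgue_measure_ball _ (ltW _))// muE -EFinM lee_fin; lra.
have := nice_lebesgue_differentiation nE locf lx.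
have -> : (f \_ `[a, b]) x = f x.
  by rewrite patchE mem_set//= in_itv/= !ltW.
move=> /fine_cvg; apply: cvg_trans; apply: near_eq_cvg.
have xa : 0 < x - a by rewrite subr_gt0.
have /cvgr0Pnorm_lt/(_ _ xa) := hcvg.
apply: filterS => n; rewrite gtr0_norm// => hn.
have Eab : E x n `<=` `[a, b].
  by apply: subset_itv; rewrite bnd_simp ?(ltW xb)//; lra.
rewrite /= -/(E x n) muE inver gt_eqF// fineM//; last first.
  apply: integrable_fin_num; first exact: measurable_itv.
  apply: (@integrableS _ _ _ _ setT) => //; first exact: measurable_itv.
  rewrite integrable_mkcond// in fi; apply: eq_integrable fi => // y _.
  by rewrite /= !patchE; case: ifP.
congr (_ * _); apply: eq_Rintegral => y /set_mem yE.
by rewrite patchE mem_set//; exact: Eab.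
Qed.

Lemma ge0_integral_subset (R : realType) (A B : set R) (f : R -> \bar R) :
  measurable A -> measurable B -> measurable_fun [set: R] f ->
  (forall x, 0 <= f x)%E -> A `<=` B ->
  (\int[mu]_(x in A) f x <= \int[mu]_(x in B) f x)%E.
Proof.
move=> mA mB mf f0 AB; apply: ge0_subset_integral => //.
exact: measurable_funTS.
Qed.

Lemma ge0_integral_scale (R : realType) (A : set R) (f : R -> \bar R) (c : R) :
  measurable A -> measurable_fun [set: R] f -> (forall x, 0 <= f x)%E -> 0 <= c ->
  (\int[mu]_(x in A) (c%:E * f x) = c%:E * \int[mu]_(x in A) f x)%E.
Proof.
move=> mA mf f0 c0; apply: ge0_integralZl => //.
exact: measurable_funTS.
Qed.

Lemma ge0_integral_add (R : realType) (A : set R) (f g : R -> \bar R) :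
  measurable A -> measurable_fun A f -> measurable_fun A g ->
  (forall x, 0 <= f x)%E -> (forall x, 0 <= g x)%E ->
  (\int[mu]_(x in A) (f x + g x) = \int[mu]_(x in A) f x + \int[mu]_(x in A) g x)%E.
Proof. by move=> mA mf mg f0 g0; apply: ge0_integralD. Qed.

Section fatou_helpers.
Context {R : realType}.
Local Open Scope ereal_scope.

Lemma ae_neq (c : R) : {ae mu, forall x : R, x != c}.
Proof.
exists [set c]; split => //; first exact: lebesgue_measure_set1.
by move=> x /= /negP; rewrite negbK => /eqP.
Qed.

Lemma cvg_EFin_real (v : R^nat) (l : R) : v @ \oo --> l ->
  (v n)%:E @[n --> \oo] --> l%:E.
Proof. by move=> vl; apply: cvg_EFin => //; exact: nearW. Qed.

Lemma le_limn_einf_cvg (u : (\bar R)^nat) (v : R^nat) (l : R) :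
  (forall n, u n <= (v n)%:E) -> v @ \oo --> l -> limn_einf u <= l%:E.
Proof.
move=> uv vl; have vl' := cvg_EFin_real vl.
have [<- _] := cvg_limn_einf_sup vl'.
rewrite !limn_einf_lim; apply: lee_lim; [exact: is_cvg_einfs|exact: is_cvg_einfs|].
apply: nearW => n; apply: le_ereal_inf_tmp => _ /= [k kn <-].
by apply: le_trans (uv k); apply: ereal_inf_lbound; exists k.
Qed.

Lemma fatou_ae (X : set R) (f : (R -> \bar R)^nat) (g : R -> \bar R) :
  measurable X -> (forall n, measurable_fun X (f n)) ->
  (forall n x, 0 <= f n x) -> measurable_fun X g -> (forall x, 0 <= g x) ->
  {ae mu, forall x, X x -> g x <= limn_einf (f ^~ x)} ->
  \int[mu]_(x in X) g x <= limn_einf (fun n => \int[mu]_(x in X) f n x).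
Proof.
move=> mX mf f0 mg g0 gf.
apply: le_trans; last by apply: fatou.
apply: ae_ge0_le_integral => //.
- move=> x _; rewrite limn_einf_lim; apply: lime_ge; first exact: is_cvg_einfs.
  by apply: nearW => n; apply: le_ereal_inf_tmp => _ [k _ <-].
- apply: (emeasurable_fun_cvg (fun n x => einfs (f ^~ x) n)).
    exact: measurable_fun_einfs.
  by move=> x _; rewrite limn_einf_lim; exact: is_cvg_einfs.
Qed.

End fatou_helpers.

Lemma is_derive_sequence (R : realType) (F : R -> R) (x l : R) (h : R^nat) :
  is_derive x 1 F l -> (forall n, h n != 0) -> h @ \oo --> 0 ->
  (h n)^-1 * (F (x + h n) - F x) @[n --> \oo] --> l.
Proof.
move=> [dF <-] h0 hcvg.
have hd : h @ \oo --> (0 : R)^'.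
  move=> A [e /= e0 Ae]; have /cvgr0Pnorm_lt/(_ _ e0) := hcvg.
  by apply: filterS => n hn; apply: Ae => //=; rewrite sub0r normrN.
have dl : h^-1 *: (F (h *: 1 + x) - F x) @[h --> (0:R)^'] --> 'D_1 F x by exact: dF.
have := @cvg_comp _ _ _ h (fun h => h^-1 *: (F (h *: 1 + x) - F x)) _ _ _ hd dl.
apply: cvg_trans; apply: near_eq_cvg; apply: nearW => n /=.
by rewrite /GRing.scale/= mulr1 [h n + x]addrC.
Qed.

(** * Sub- and supersolutions in integrated form *)

Section weak_formulation.
Context {R : realType}.
Variable p : R.
Implicit Types (a b : R) (u q : R * R -> R).

(** Finite p-energy is asked only from times [t0 > T0] on, since the gradient of a weak solution is
    p-integrable only locally in (0, T]. *)
Definition space_profile a b (T0 T1 : R) u q : Prop :=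
  [/\ continuous u, measurable_fun [set: R * R] u,
      measurable_fun [set: R * R] q,
      {ae mu, forall t, T0 < t <= T1 ->
         ac_on a b (fun x => u (x, t)) (fun x => q (x, t))} &
      forall t0, T0 < t0 -> (\int[mu]_(t in `[t0, T1])
         \int[mu]_(x in `[a, b]) (`|q (x, t)| `^ p)%:E < +oo)%E].

(* The integrated form of u_t = (F(u_x))_x, with D for the increment of u. *)
Definition flux_primitive a b (t0 t1 : R) q (D : R -> R) : Prop :=
  mu.-integrable `[a, b] (EFin \o D) /\
  exists k : R, {ae mu, forall x : R, a < x < b ->
    \int[mu]_(s in `[t0, t1]) flux p (q (x, s)) =
      k + \int[mu]_(y in `[a, x]) D y}.

(** [D] is an exact x-derivative of the time-integrated flux, and the inequality sits between [D]
    and the increment of [u]. Integration by parts thus concerns identities only, and the sign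
    enters pointwise. *)
Definition subsolution a b (T0 T1 : R) u q : Prop :=
  space_profile a b T0 T1 u q /\
  forall t0 t1, T0 < t0 -> t0 < t1 -> t1 <= T1 ->
    exists2 D, flux_primitive a b t0 t1 q D &
      forall x, a <= x <= b -> u (x, t1) - u (x, t0) <= D x.

Definition supersolution a b (T0 T1 : R) u q : Prop :=
  space_profile a b T0 T1 u q /\
  forall t0 t1, T0 < t0 -> t0 < t1 -> t1 <= T1 ->
    exists2 D, flux_primitive a b t0 t1 q D &
      forall x, a <= x <= b -> D x <= u (x, t1) - u (x, t0).

Lemma integral_profile_le a b (T0 T1 : R) u q (t0 t1 : R) : space_profile a b T0 T1 u q ->
  T0 < t0 -> t1 <= T1 ->
  (\int[mu]_(t in `[t0, t1]) \int[mu]_(x in `[a, b])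
     (`|q (x, t)| `^ p)%:E < +oo)%E.
Proof.
move=> [_ _ mq _ qoo] t00 t11; apply: le_lt_trans (qoo t0 t00).
apply: ge0_subset_integral => //.
- apply: measurable_funTS.
  apply: (@measurable_integral_slice _ `[a, b] (fun z => (`|q z| `^ p)%:E)) => //.
  apply/measurable_EFinP.
  exact: (measurableT_comp (@measurable_norm_powR R p) mq).
- by move=> t _; apply: integral_ge0 => x _; rewrite lee_fin powR_ge0.
- by apply: subset_itv; rewrite bnd_simp.
Qed.

End weak_formulation.

(** * The comparison principle *)

(** The tangent inequality of the convex function x -> x_+^3. Applied at the later of two times, it
    replaces the chain rule in t. *)
Lemma pos_cube_convex (R : realType) (x y : R) :
  Num.max x 0 ^+ 3 - Num.max y 0 ^+ 3 <= 3 * (Num.max x 0 ^+ 2 * (x - y)).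
Proof.
have [x0|x0] := leP x 0.
  have : 0 <= Num.max y 0 ^+ 3 by rewrite exprn_ge0// le_max lexx orbT.
  by rewrite !expr0n/= mul0r mulr0; lra.
have h : x ^+ 3 - Num.max y 0 ^+ 3 <= 3 * (x ^+ 2 * (x - Num.max y 0)).
  set z := Num.max y 0; have z0 : 0 <= z by rewrite /z le_max lexx orbT.
  have : 0 <= (x - z) ^+ 2 * (2 * x + z).
    by apply: mulr_ge0; [exact: sqr_ge0|lra].
  by nra.
apply: (le_trans h); rewrite ler_pM2l// ler_wpM2l ?sqr_ge0// lerD2l lerN2.
by rewrite le_max lexx.
Qed.

Lemma EFin_Rintegral (R : realType) (A : set R) (f : R -> R) :
  measurable A -> mu.-integrable A (EFin \o f) ->
  (\int[mu]_(x in A) (f x)%:E = (\int[mu]_(x in A) f x)%:E)%E.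
Proof.
by move=> mA i; rewrite /Rintegral fineK//; exact: integrable_fin_num.
Qed.

Lemma integral_itv_cst (R : realType) (s l : R) (v : \bar R) : 0 < l ->
  (\int[mu]_(t in `[s, (s + l)%R]) v = l%:E * v)%E.
Proof.
move=> l0; rewrite integral_cst//= lebesgue_measure_itv/= lte_fin ltrDl l0 muleC -EFinB.
by rewrite addrC addKr.
Qed.

Section comparison.
Context {R : realType}.
Variables (p a b T0 T1 : R).
Hypotheses (p2 : 2 < p) (ab : a < b).
Variables (u1 q1 u2 q2 : R * R -> R).
Hypothesis sub1 : subsolution p a b T0 T1 u1 q1.
Hypothesis super2 : supersolution p a b T0 T1 u2 q2.
Hypothesis bdry_a : forall t, T0 <= t <= T1 -> u1 (a, t) <= u2 (a, t).
Hypothesis bdry_b : forall t, T0 <= t <= T1 -> u1 (b, t) <= u2 (b, t).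

Local Notation pos z := (Num.max (z) 0).

Let w z := u1 z - u2 z.
Let G z := flux p (q1 z) - flux p (q2 z).
(** [g] is the x-derivative of the multiplier [pos (w z) ^+ 2], and [K] the energy density that
    dominates the product of [G] and [g] even when they are taken at different times. *)
Let g z := 2 * pos (w z) * (q1 z - q2 z).
Let K z := `|q1 z| `^ p + `|q2 z| `^ p.
Let J t := \int[mu]_(x in `[a, b]) (pos (w (x, t)) ^+ 3).

Let mq1 : measurable_fun [set: R * R] q1. Proof. by have [[]] := sub1. Qed.
Let mq2 : measurable_fun [set: R * R] q2. Proof. by have [[]] := super2. Qed.

Let cw : continuous w.
Proof.
have [[c1 _ _ _ _] _] := sub1; have [[c2 _ _ _ _] _] := super2.
by move=> z; apply: cvgB; [exact: c1|exact: c2].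
Qed.

Let mw : measurable_fun [set: R * R] w.
Proof.
have [[_ m1 _ _ _] _] := sub1; have [[_ m2 _ _ _] _] := super2.
exact: measurable_funB.
Qed.

Let mG : measurable_fun [set: R * R] G.
Proof.
by apply: measurable_funB; exact: (measurableT_comp (measurable_flux p2)).
Qed.

Let mg : measurable_fun [set: R * R] g.
Proof.
apply: measurable_funM; last exact: measurable_funB.
apply: measurable_funM => //.
exact: (measurableT_comp (continuous_measurable_fun (@continuous_pos R)) mw).
Qed.

Let mK : measurable_fun [set: R * R] K.
Proof.
by apply: measurable_funD; exact: (measurableT_comp (@measurable_norm_powR R p)).
Qed.

Let K0 z : 0 <= K z. Proof. by rewrite /K addr_ge0// powR_ge0. Qed.

Let Koo t0 t1 : T0 < t0 -> t1 <= T1 ->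
  (\int[mu]_(t in `[t0, t1]) \int[mu]_(x in `[a, b]) (K (x, t))%:E < +oo)%E.
Proof.
move=> t00 t11.
have h1 := integral_profile_le sub1.1 t00 t11.
have h2 := integral_profile_le super2.1 t00 t11.
have mp (q : R * R -> R) : measurable_fun [set: R * R] q ->
    measurable_fun [set: R * R] (fun z => (`|q z| `^ p)%:E).
  move=> mq; apply/measurable_EFinP.
  exact: (measurableT_comp (@measurable_norm_powR R p) mq).
have p0 (q : R * R -> R) z : (0 <= (`|q z| `^ p)%:E :> \bar R)%E by rewrite lee_fin powR_ge0.
pose F (q : R * R -> R) t := (\int[mu]_(x in `[a, b]) (`|q (x, t)| `^ p)%:E)%E.
have mF q : measurable_fun [set: R * R] q -> measurable_fun `[t0, t1] (F q).
  move=> mq; apply: measurable_funTS.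
  by apply: (@measurable_integral_slice _ `[a, b] (fun z => (`|q z| `^ p)%:E)) => //; exact: mp.
have F0 q t : (0 <= F q t)%E by apply: integral_ge0 => x _; exact: p0.
rewrite [ltLHS](_ : _ = \int[mu]_(t in `[t0, t1]) (F q1 t + F q2 t))%E; last first.
  apply: eq_integral => t _; rewrite -ge0_integralD//.
  - by apply: measurable_funTS; exact: (measurable_slice2 _ (mp _ mq1)).
  - by apply: measurable_funTS; exact: (measurable_slice2 _ (mp _ mq2)).
rewrite ge0_integralD//; [|exact: mF|exact: mF].
apply: lte_add_pinfty; [exact: h1|exact: h2].
Qed.

Let flux_integrable (c d : R) (m q : R -> R) : measurable_fun [set: R] q ->
  mu.-integrable `[c, d] (EFin \o m) -> (forall s, `|q s| `^ p <= m s) ->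
  mu.-integrable `[c, d] (EFin \o (fun s => flux p (q s))).
Proof.
move=> mq im qm.
apply: (@le_integrable _ _ _ mu `[c, d] (measurable_itv _) _ (EFin \o (fun s => 1 + m s))).
- apply/measurable_EFinP; apply: measurable_funTS.
  exact: (measurableT_comp (measurable_flux p2) mq).
- move=> s _; rewrite /= lee_fin; apply: (le_trans (norm_flux_le1D p2 _)).
  by apply: le_trans (ler_norm _); rewrite lerD2l.
- by apply: integrable_add => //; exact: integrable_itv_cst.
Qed.

Let cpos3 t : continuous (fun x => pos (w (x, t)) ^+ 3).
Proof.
have cwt : continuous (fun x => w (x, t)).
  exact: continuous_slice2.
exact: continuous_pos_exp.
Qed.

Let ae_flux t0 t1 : T0 < t0 -> t1 <= T1 ->
  {ae mu, forall x, `[a, b]%classic x ->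
    mu.-integrable `[t0, t1] (EFin \o (fun s => K (x, s))) /\
    mu.-integrable `[t0, t1] (EFin \o (fun s => flux p (q1 (x, s)))) /\
    mu.-integrable `[t0, t1] (EFin \o (fun s => flux p (q2 (x, s))))}.
Proof.
move=> t00 t11.
have koo : (\int[mu]_(t in `[t0, t1]) \int[mu]_(x in `[a, b]) `|K (x, t)|%:E < +oo)%E.
  apply: le_lt_trans (Koo t00 t11); rewrite le_eqVlt; apply/orP; left.
  by apply/eqP; apply: eq_integral => t _; apply: eq_integral => x _; rewrite ger0_norm.
have := ae_integrable_box1 (measurable_itv _) (measurable_itv _) mK koo.
apply: ae_imply => x Kx xab; have iK := Kx xab; split => //.
split; apply: (flux_integrable (m := fun s => K (x, s))) => //.
- exact: (measurable_rslice1 _ mq1).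
- by move=> s; rewrite /K lerDl powR_ge0.
- exact: (measurable_rslice1 _ mq2).
- by move=> s; rewrite /K lerDr powR_ge0.
Qed.

(** Multiply D1 - D2 by w_+^2 at the time [t1] and integrate by parts in x; the boundary terms
    vanish because w <= 0 at [a] and [b]. Only [t1] must avoid a null set, where w(., t1) may fail
    to be absolutely continuous, while [t0] is arbitrary; later it is [t1] minus a small step. *)
Let weak_step : {ae mu, forall t1, T0 < t1 <= T1 -> forall t0, T0 < t0 < t1 ->
  exists Th : R -> R,
    [/\ {ae mu, forall x : R, a < x < b ->
          \int[mu]_(s in `[t0, t1]) G (x, s) = Th x},
        mu.-integrable `[a, b] (EFin \o (fun x => Th x * g (x, t1))) &
        3 * \int[mu]_(x in `[a, b]) (Th x * g (x, t1)) <= J t0 - J t1]}.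
Proof.
have [[_ _ _ ac1 _] S1] := sub1; have [[_ _ _ ac2 _] S2] := super2.
apply: ae_imply2 ac1 ac2 => t1 A1 A2 t11 t0 /andP[t00 t01].
have /andP[Tt1 t1T] := t11.
have {A1} A1 := A1 t11; have {A2} A2 := A2 t11.
have [D1 [iD1 [k1 F1]] d1] := S1 _ _ t00 t01 t1T.
have [D2 [iD2 [k2 F2]] d2] := S2 _ _ t00 t01 t1T.
pose D x := D1 x - D2 x.
have iD : mu.-integrable `[a, b] (EFin \o D) by exact: integrable_sub.
(* The absolutely continuous representative of the time-integrated flux difference, which itself is
   a primitive only up to a null set. *)
pose Th x := (k1 - k2) + \int[mu]_(y in `[a, x]) D y.
have acTh : ac_on a b Th D.
  by split => // x /andP[ax xb]; rewrite /Th set_itv1 Rintegral_set1 addr0.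
have acw : ac_on a b (fun x => w (x, t1)) (fun x => q1 (x, t1) - q2 (x, t1)).
  split; first by apply: integrable_sub => //; [exact: A1.1|exact: A2.1].
  move=> x xab; rewrite RintegralB//; first by rewrite /w A1.2// A2.2//; ring.
  - apply: integrable_itvS A1.1 _ _; rewrite bnd_simp//; by case/andP: xab.
  - apply: integrable_itvS A2.1 _ _; rewrite bnd_simp//; by case/andP: xab.
have acf := ac_on_pos_sqr (ltW ab) acw.
have [ip Hp] := ac_onM (ltW ab) acTh acf.
have ws c : (c == a) || (c == b) -> pos (w (c, t1)) = 0.
  have tT : T0 <= t1 <= T1 by rewrite ltW.
  by move=> /orP[]/eqP->; rewrite max_r// /w subr_le0 ?bdry_a ?bdry_b.
(* The product of [Th] and w_+^2 vanishes at both ends, so [Hs] says that the integral of its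
   density is 0. *)
have := Hp b; rewrite (ltW ab) lexx !ws ?eqxx ?orbT// expr0n/= !mulr0 add0r.
move=> /(_ isT) Hs.
have if1 : mu.-integrable `[a, b] (EFin \o (fun x => pos (w (x, t1)) ^+ 2 * D x)).
  by apply: within_integrableM => //; exact: ac_on_within (ltW ab) acf.
have if2 : mu.-integrable `[a, b] (EFin \o (fun x => Th x * g (x, t1))).
  by apply: within_integrableM (ac_on_within (ltW ab) acTh) acf.1.
exists Th; split => //.
- have aeI := ae_flux t00 t1T.
  apply: ae_imply3 F1 F2 aeI => x f1 f2 f3 xab.
  have /andP[ax xb] := xab.
  have xab' : `[a, b]%classic x by rewrite /= in_itv/= !ltW.
  have [_ [i1 i2]] := f3 xab'.
  rewrite RintegralB// f1// f2// /Th RintegralB//; first by ring.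
  + by apply: integrable_itvS iD1 _ _; rewrite bnd_simp// ltW.
  + by apply: integrable_itvS iD2 _ _; rewrite bnd_simp// ltW.
- rewrite RintegralD// in Hs.
  have iJ t : mu.-integrable `[a, b] (EFin \o (fun x => pos (w (x, t)) ^+ 3)).
    by apply: continuous_integrable_itv; exact: cpos3.
  have : J t1 - J t0 <= 3 * \int[mu]_(x in `[a, b]) (pos (w (x, t1)) ^+ 2 * D x).
    rewrite /J -RintegralB// -RintegralZl//; apply: le_Rintegral => //.
    + exact: integrable_sub.
    + exact: integrable_mull.
    + move=> x; rewrite /= in_itv/= => xab.
      have := d1 _ xab; have := d2 _ xab => e2 e1.
      have Dw : w (x, t1) - w (x, t0) <= D x by rewrite /w /D; lra.
      have P0 : 0 <= pos (w (x, t1)) ^+ 2 by exact: sqr_ge0.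
      apply: (@le_trans _ _ (3 * (pos (w (x, t1)) ^+ 2 * (w (x, t1) - w (x, t0))))).
        exact: pos_cube_convex.
      by rewrite ler_pM2l// ler_wpM2l.
  lra.
Qed.

Let Jc : continuous J.
Proof.
apply: (@continuous_param_Rintegral _ (fun z => pos (w z) ^+ 3)).
exact: continuous_pos_exp.
Qed.

Let J0 t : 0 <= J t.
Proof.
by apply: Rintegral_ge0 => x _; rewrite exprn_ge0// le_max lexx orbT.
Qed.

Section decay.
Variables (t0 t1 : R).
Hypotheses (t00 : T0 < t0) (t01 : t0 < t1) (t11 : t1 <= T1).

Let bound_pos : exists2 W : R, 0 <= W &
  forall x t, a <= x <= b -> t0 <= t <= t1 -> pos (w (x, t)) <= W.
Proof.
have cK : compact (`[a, b] `*` `[t0, t1]).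
  by apply: compact_setX; exact: segment_compact.
have [M [Mreal HM]] := compact_bounded (continuous_compact
  (continuous_subspaceT cw) cK).
exists (`|M| + 1); first by rewrite addr_ge0.
move=> x t xab tab.
have : `|w (x, t)| <= `|M| + 1.
  apply: (HM (`|M| + 1)); first by rewrite (le_lt_trans (ler_norm _))// ltrDl.
  by exists (x, t) => //; split; rewrite /= in_itv.
have := ler_norm (w (x, t)).
by rewrite ge_max => h1 h2; apply/andP; split; [lra|rewrite addr_ge0].
Qed.

Let W := projT1 (cid2 bound_pos).
Let W0 : 0 <= W. Proof. by rewrite /W; case: cid2. Qed.
Let HW x t : a <= x <= b -> t0 <= t <= t1 -> pos (w (x, t)) <= W.
Proof. by rewrite /W; case: cid2 => /= W' _; exact. Qed.

(** A factor 2W comes from [g]; another factor 2 comes from summing the four products bounded by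
    [norm_flux_mul], in which each p-th power occurs twice. *)
Let c := 4 * W.
Let c0 : 0 <= c. Proof. by rewrite mulr_ge0. Qed.

(* The values of the gradients at two different times are compared through
   |F(q)||q'| <= |q|^p + |q'|^p, which makes the integrand nonnegative. *)
Let dominated x s t : a <= x <= b -> t0 <= t <= t1 ->
  0 <= c * (K (x, s) + K (x, t)) + G (x, s) * g (x, t).
Proof.
move=> xab tab.
suff : `|G (x, s) * g (x, t)| <= c * (K (x, s) + K (x, t)).
  by rewrite ler_norml => /andP[h1 h2]; lra.
have h : `|G (x, s)| * `|q1 (x, t) - q2 (x, t)| <= 2 * (K (x, s) + K (x, t)).
  apply: (@le_trans _ _ ((`|flux p (q1 (x, s))| + `|flux p (q2 (x, s))|) *
      (`|q1 (x, t)| + `|q2 (x, t)|))).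
    by apply: ler_pM => //; exact: ler_normB.
  have h11 := norm_flux_mul p2 (q1 (x, s)) (q1 (x, t)).
  have h12 := norm_flux_mul p2 (q1 (x, s)) (q2 (x, t)).
  have h21 := norm_flux_mul p2 (q2 (x, s)) (q1 (x, t)).
  have h22 := norm_flux_mul p2 (q2 (x, s)) (q2 (x, t)).
  by rewrite mulrDl !mulrDr /K; lra.
have P0 : 0 <= pos (w (x, t)) by rewrite le_max lexx orbT.
rewrite /g normrM normrM (ger0_norm (_ : 0 <= 2 * pos (w (x, t)))); last by rewrite mulr_ge0.
rewrite mulrCA /c (_ : 4 * W * _ = 2 * W * (2 * (K (x, s) + K (x, t)))); last by ring.
by apply: ler_pM => //; [rewrite mulr_ge0|rewrite ler_pM2l// HW].
Qed.

Let h n := (t1 - t0) / 2 * n.+1%:R^-1.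
Let d0 : 0 < (t1 - t0) / 2. Proof. by rewrite divr_gt0 ?subr_gt0. Qed.
Let h0 n : 0 < h n. Proof. by rewrite mulr_gt0 ?invr_gt0. Qed.
Let hlt n : h n < t1 - t0.
Proof.
apply: (@le_lt_trans _ _ ((t1 - t0) / 2)); last by have := d0; lra.
by apply: ler_piMr; [exact: ltW|rewrite invf_le1 // ler1n].
Qed.
Let hcvg : h @ \oo --> 0.
Proof.
rewrite -(mulr0 ((t1 - t0) / 2)); apply: cvgM; first exact: cvg_cst.
exact: cvg_harmonic.
Qed.

(** The nonnegative integrand of [dominated] at the point ((x, t), s), divided by the step. [S]
    restricts s to the window [t - h, t], and [N] integrates s out. Extending by zero off [S] turns
    everything into Tonelli on the whole space. *)
Let Q n (z : (R * R) * R) := (h n)^-1 *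
  (c * (K (z.1.1, z.2) + K (z.1.1, z.1.2)) + G (z.1.1, z.2) * g z.1).
Let S n := [set z : (R * R) * R | (`[a, b]%classic z.1.1 /\
   `[t0 + h n, t1]%classic z.1.2) /\ (z.1.2 - h n <= z.2 /\ z.2 <= z.1.2)].
Let Phi n := (EFin \o Q n) \_ (S n).
Let N n (y : R * R) := (\int[mu]_s Phi n (y, s))%E.

Let Phi0 n z : (0 <= Phi n z)%E.
Proof.
rewrite /Phi patchE; case: ifPn => //; rewrite inE => -[[xab tab] _].
rewrite /= lee_fin mulr_ge0 ?invr_ge0 ?(ltW (h0 n))//.
move: xab tab; rewrite /= !in_itv/= => xab /andP[th tt].
have := @dominated z.1.1 z.2 z.1.2 xab; case: z xab th tt => [[x t] s]/= xab th tt.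
by apply; rewrite tt andbT (le_trans _ th)// lerDl ltW.
Qed.

Let mPhi n : measurable_fun setT (Phi n).
Proof.
have m11 : measurable_fun setT (fun z : (R * R) * R => z.1.1) by exact: measurableT_comp.
have m12 : measurable_fun setT (fun z : (R * R) * R => z.1.2) by exact: measurableT_comp.
have m2 : measurable_fun setT (fun z : (R * R) * R => z.2) by exact: measurable_snd.
have mxs : measurable_fun setT (fun z : (R * R) * R => (z.1.1, z.2)).
  exact: measurable_fun_pair.
have mxt : measurable_fun setT (fun z : (R * R) * R => (z.1.1, z.1.2)).
  exact: measurable_fun_pair.
apply/(measurable_restrictT _ _).1.
  have -> : S n = ([set z : (R * R) * R | `[a, b]%classic z.1.1] `&`
     [set z : (R * R) * R | `[t0 + h n, t1]%classic z.1.2]) `&`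
     ([set z : (R * R) * R | z.1.2 - h n <= z.2] `&` [set z : (R * R) * R | z.2 <= z.1.2]) by [].
  apply: measurableI; apply: measurableI.
  - by rewrite -[X in measurable X]setTI; exact: m11.
  - by rewrite -[X in measurable X]setTI; exact: m12.
  - rewrite -[X in measurable X]setTI; apply: measurable_fun_le => //.
    exact: measurable_funB.
  - by rewrite -[X in measurable X]setTI; apply: measurable_fun_le.
apply: measurable_funTS; apply/measurable_EFinP.
apply: measurable_funM => //; apply: measurable_funD.
- apply: measurable_funM => //; apply: measurable_funD.
  + exact: (measurableT_comp mK mxs).
  + exact: (measurableT_comp mK mxt).
- apply: measurable_funM; first exact: (measurableT_comp mG mxs).
  exact: (measurableT_comp mg).
Qed.

Let N0 n y : (0 <= N n y)%E. Proof. exact: integral_ge0. Qed.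

Let mN n : measurable_fun setT (N n).
Proof. exact: (measurable_fun_fubini_tonelli_F (m2 := mu) (Phi n) (mPhi n) (Phi0 n)). Qed.

Let NE n x t : `[a, b]%classic x -> `[t0 + h n, t1]%classic t ->
  mu.-integrable `[t0, t1] (EFin \o (fun s => K (x, s))) ->
  mu.-integrable `[t0, t1] (EFin \o (fun s => G (x, s))) ->
  N n (x, t) =
    (c * ((h n)^-1 * \int[mu]_(s in `[t - h n, t]) K (x, s)) + c * K (x, t) +
     g (x, t) * ((h n)^-1 * \int[mu]_(s in `[t - h n, t]) G (x, s)))%:E.
Proof.
move=> xX tD iK iG.
have hn0 := h0 n; have hn1 : h n != 0 by rewrite gt_eqF.
have tD' := tD; move: tD'; rewrite /= in_itv/= => /andP[th tt].
have iS (f : R -> R) : mu.-integrable `[t0, t1] (EFin \o f) ->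
    mu.-integrable `[t - h n, t] (EFin \o f).
  by move=> i; apply: integrable_itvS i _ _; rewrite bnd_simp//; lra.
have -> : N n (x, t) = (\int[mu]_(s in `[(t - h n)%R, t]) (Q n ((x, t), s))%:E)%E.
  rewrite [RHS]integral_mkcond; apply: eq_integral => s _; rewrite /Phi !patchE.
  congr (if _ then _ else _); apply/idP/idP; rewrite !inE /S/= in_itv/=.
    by move=> [_ [h1 h2]]; rewrite ?in_itv/= h1 h2.
  by rewrite ?in_itv/= => /andP[h1 h2]; split.
have iQ : mu.-integrable `[t - h n, t] (EFin \o (fun s => Q n ((x, t), s))).
  apply: integrable_mull => //; apply: integrable_add => //.
    apply: integrable_mull => //; apply: integrable_add => //; first exact: iS.
    exact: (integrable_itv_cst _ _ (K (x, t))).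
  rewrite (_ : (fun s => _) = (fun s => g (x, t) * G (x, s))); last first.
    by apply/funext => s; rewrite mulrC.
  by apply: integrable_mull => //; exact: iS.
rewrite -[LHS](@fineK R); last exact: integrable_fin_num.
rewrite -/(Rintegral _ _ _); congr EFin.
have -> : \int[mu]_(s in `[t - h n, t]) Q n ((x, t), s) =
   \int[mu]_(s in `[t - h n, t]) (((h n)^-1 * c * K (x, s) + (h n)^-1 * c * K (x, t)) +
      (h n)^-1 * g (x, t) * G (x, s)).
  by apply: eq_Rintegral => s _; rewrite /Q/=; ring.
have i1 := iS _ iK; have i2 := iS _ iG.
have i3 : mu.-integrable `[t - h n, t] (EFin \o (fun=> (h n)^-1 * c * K (x, t))).
  exact: integrable_itv_cst.
rewrite RintegralD//; last 2 first.
- by apply: integrable_add => //; exact: integrable_mull.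
- exact: integrable_mull.
rewrite RintegralD//; last exact: integrable_mull.
have -> : \int[mu]_(s in `[t - h n, t]) ((h n)^-1 * c * K (x, t)) =
    (h n)^-1 * c * K (x, t) * h n.
  rewrite Rintegral_cst//; congr (_ * _).
  by rewrite /= lebesgue_measure_itv/= lte_fin gtrBl hn0/= opprB addrC subrK.
by rewrite !RintegralZl//; field.
Qed.

Let iG_ae : {ae mu, forall x, `[a, b]%classic x ->
   mu.-integrable `[t0, t1] (EFin \o (fun s => K (x, s))) /\
   mu.-integrable `[t0, t1] (EFin \o (fun s => G (x, s)))}.
Proof.
apply: ae_imply (ae_flux t00 t11) => x H xX; have [i1 [i2 i3]] := H xX.
by split => //; exact: integrable_sub.
Qed.

(** Fatou's lemma is applied first in x, then in t. For almost every (x, t) the backward means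
    converge and [N n (x, t)] tends to 2 c K + g G, where g G >= 0 by monotonicity of the flux. *)
Let lower : (\int[mu]_(x in `[a, b]) \int[mu]_(t in `[t0, t1]) (2 * c * K (x, t))%:E <=
  limn_einf (fun n => \int[mu]_x \int[mu]_t N n (x, t)))%E.
Proof.
have mcK : measurable_fun [set: R * R] (fun z => (2 * c * K z)%:E).
  by apply/measurable_EFinP; exact: measurable_funM.
have cK0 z : (0 <= (2 * c * K z)%:E :> \bar R)%E by rewrite lee_fin !mulr_ge0.
have mNx n : measurable_fun [set: R] (fun x => \int[mu]_t N n (x, t))%E.
  exact: (measurable_fun_fubini_tonelli_F (m2 := mu) (N n) (mN n) (N0 n)).
have sub n : (\int[mu]_(x in `[a, b]) \int[mu]_t N n (x, t) <=
     \int[mu]_x \int[mu]_t N n (x, t))%E.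
  apply: ge0_subset_integral => //; first exact: mNx.
  by move=> x _; exact: integral_ge0.
apply: (@le_trans _ _ (limn_einf (fun n => \int[mu]_(x in `[a, b]) \int[mu]_t N n (x, t)))%E);
  last first.
  rewrite !limn_einf_lim; apply: lee_lim; [exact: is_cvg_einfs|exact: is_cvg_einfs|].
  apply: nearW => n; apply: le_ereal_inf_tmp => _ /= [k kn <-].
  by apply: le_trans (sub k); apply: ereal_inf_lbound; exists k.
apply: (fatou_ae (f := fun n x => \int[mu]_t N n (x, t))%E) => //.
- by move=> n; exact: measurable_funTS.
- by move=> n x; exact: integral_ge0.
- apply: measurable_funTS.
  apply: (@measurable_integral_slice _ `[t0, t1] (fun z => (2 * c * K (z.2, z.1))%:E)) => //.
  by apply: (measurableT_comp mcK); exact: measurable_fun_pair.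
- by move=> x; exact: integral_ge0.
apply: ae_imply iG_ae => x H xX; have [iK iG] := H xX.
have mNt n : measurable_fun [set: R] (fun t => N n (x, t)) by exact: measurable_slice1.
have subt n : (\int[mu]_(t in `[t0, t1]) N n (x, t) <= \int[mu]_t N n (x, t))%E.
  by apply: ge0_subset_integral => //; exact: mNt.
apply: (@le_trans _ _ (limn_einf (fun n => \int[mu]_(t in `[t0, t1]) N n (x, t)))%E);
  last first.
  rewrite !limn_einf_lim; apply: lee_lim; [exact: is_cvg_einfs|exact: is_cvg_einfs|].
  apply: nearW => n; apply: le_ereal_inf_tmp => _ /= [k kn <-].
  by apply: le_trans (subt k); apply: ereal_inf_lbound; exists k.
apply: (fatou_ae (f := fun n t => N n (x, t))) => //.
- by move=> n; exact: measurable_funTS.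
- apply: measurable_funTS; exact: (measurable_slice1 x mcK).
have aeK := backward_mean_cvg iK; have aeG := backward_mean_cvg iG.
apply: ae_imply3 (ae_imply2 (fun t h1 h2 => conj h1 h2) aeK aeG)
  (ae_neq t0) (ae_neq t1) => t [HK HG] t0t tt1 tD.
move: (tD); rewrite /= in_itv/= => /andP[t0t' tt1'].
have {t0t t0t'}t0t : t0 < t by rewrite lt_neqAle eq_sym t0t.
have {tt1 tt1'}tt1 : t < t1 by rewrite lt_neqAle tt1.
have t01t : t0 < t < t1 by rewrite t0t.
have lK := HK t01t h h0 hcvg; have lG := HG t01t h h0 hcvg.
have : N n (x, t) @[n --> \oo] -->
    (c * K (x, t) + c * K (x, t) + g (x, t) * G (x, t))%:E.
  have : (c * ((h n)^-1 * \int[mu]_(s in `[t - h n, t]) K (x, s)) + c * K (x, t) +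
     g (x, t) * ((h n)^-1 * \int[mu]_(s in `[t - h n, t]) G (x, s))) @[n --> \oo] -->
     (c * K (x, t) + c * K (x, t) + g (x, t) * G (x, t)).
    apply: cvgD; last by apply: cvgM => //; exact: cvg_cst.
    by apply: cvgD; [apply: cvgM => //; exact: cvg_cst|exact: cvg_cst].
  move=> /cvg_EFin_real; apply: cvg_trans; apply: near_eq_cvg.
  have tt0 : 0 < t - t0 by rewrite subr_gt0.
  have /cvgr0Pnorm_lt/(_ _ tt0) := hcvg.
  apply: filterS => n; rewrite gtr0_norm// => hn.
  by rewrite NE//= in_itv/= (ltW tt1) andbT; lra.
move=> /cvg_limn_einf_sup[-> _]; rewrite lee_fin.
have P0 : 0 <= pos (w (x, t)) by rewrite le_max lexx orbT.
have : 0 <= g (x, t) * G (x, t).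
  rewrite (_ : _ * _ = 2 * pos (w (x, t)) * (G (x, t) * (q1 (x, t) - q2 (x, t)))).
    by apply: mulr_ge0; [exact: mulr_ge0|exact: flux_monotone].
  by rewrite /g; ring.
lra.
Qed.

Let Ie := (\int[mu]_(t in `[t0, t1]) \int[mu]_(x in `[a, b]) (K (x, t))%:E)%E.
Let Ifin : Ie = (fine Ie)%:E.
Proof.
rewrite fineK// ge0_fin_numE; first exact: Koo.
by apply: integral_ge0 => t _; apply: integral_ge0 => x _; rewrite lee_fin.
Qed.

Let mEK : measurable_fun [set: R * R] (fun z => (K z)%:E).
Proof. exact/measurable_EFinP. Qed.
Let EK0 z : (0 <= (K z)%:E)%E. Proof. by rewrite lee_fin. Qed.

Let k s := (\int[mu]_(x in `[a, b]) (K (x, s))%:E)%E.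
Let k0 s : (0 <= k s)%E. Proof. exact: integral_ge0. Qed.
Let mk : measurable_fun [set: R] k.
Proof. exact: (measurable_integral_slice (measurable_itv `[a, b]) mEK EK0). Qed.

Let A n t := (\int[mu]_(x in `[a, b]) \int[mu]_(s in `[(t - h n)%R, t]) (K (x, s))%:E)%E.
Let AE n t : A n t = (\int[mu]_(s in `[(t - h n)%R, t]) k s)%E.
Proof. exact: (tonelli_box (measurable_itv _) (measurable_itv _) mEK EK0). Qed.

Let P n t := (((h n)^-1 * c)%:E * A n t + c%:E * k t)%E.

Let N_out n x t : ~ `[a, b]%classic x \/ ~ `[t0 + h n, t1]%classic t -> N n (x, t) = 0%E.
Proof.
move=> H; rewrite /N integral0_eq// => s _; rewrite /Phi patchE memNset//.
by move=> [[xX tD] _]; case: H.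
Qed.

(** This is [weak_step] between t - h and t, divided by 3h. The two values of [J] stand on opposite
    sides so that only nonnegative functions have to be integrated in t afterwards. *)
Let step_bound n : {ae mu, forall t, `[t0 + h n, t1]%classic t ->
  (\int[mu]_x N n (x, t) + ((3 * h n)^-1 * J t)%:E <=
   P n t + ((3 * h n)^-1 * J (t - h n))%:E)%E}.
Proof.
have koo : (\int[mu]_(t in `[t0, t1]) \int[mu]_(x in `[a, b]) `|K (x, t)|%:E < +oo)%E.
  apply: le_lt_trans (Koo t00 t11); rewrite le_eqVlt; apply/orP; left.
  by apply/eqP; apply: eq_integral => t _; apply: eq_integral => x _; rewrite ger0_norm.
have aeK2 := ae_integrable_box2 (measurable_itv _) (measurable_itv _) mK koo.
apply: ae_imply2 weak_step aeK2 => t ws iKt tD.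
have hn := h0 n; have hn1 : h n != 0 by rewrite gt_eqF.
have := tD; rewrite /= in_itv/= => /andP[th tt].
have tt0 : t0 < t by rewrite (lt_le_trans _ th)// ltrDl.
have tht : t0 <= t - h n by rewrite lerBrDr.
have tT : T0 < t <= T1 by rewrite (lt_trans t00 tt0) (le_trans tt).
have tth : T0 < t - h n < t.
  by rewrite gtrBl hn andbT (lt_le_trans t00).
have [Th [aeTh iTh Hs]] := ws tT _ tth.
have {iKt}iKt : mu.-integrable `[a, b] (EFin \o (fun x => K (x, t))).
  by apply: iKt; rewrite /= in_itv/= tt ltW.
pose k1 x := (\int[mu]_(s in `[(t - h n)%R, t]) (K (x, s))%:E)%E.
have mk1 : measurable_fun [set: R] k1.
  apply: (measurable_integral_slice (measurable_itv `[(t - h n)%R, t])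
    (f := fun z => (K (z.2, z.1))%:E)) => //.
  by apply: (measurableT_comp mEK); exact: measurable_fun_pair.
have k10 x : (0 <= k1 x)%E by exact: integral_ge0.
have A_le : (A n t <= Ie)%E.
  have sI : `[t - h n, t] `<=` `[t0, t1] by apply: subset_itv; rewrite bnd_simp.
  rewrite AE; exact: (ge0_integral_subset (measurable_itv _) (measurable_itv _) mk k0 sI).
have A0 : (0 <= A n t)%E.
  by apply: integral_ge0 => x _; apply: integral_ge0 => s _; rewrite lee_fin.
have Afin : A n t \is a fin_num.
  rewrite (ge0_fin_numE A0); apply: le_lt_trans A_le _.
  by rewrite Ifin; exact: ltry.
have kfin : k t \is a fin_num by exact: integrable_fin_num.
have c1 : (0 <= ((h n)^-1 * c)%:E)%E by rewrite lee_fin mulr_ge0// invr_ge0 ltW.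
have c2 : (0 <= c%:E)%E by rewrite lee_fin.
pose f1 x := (((h n)^-1 * c)%:E * k1 x + c%:E * (K (x, t))%:E)%E.
pose f2 x := ((h n)^-1 * (Th x * g (x, t)))%:E.
have mKt : measurable_fun [set: R] (fun x => (K (x, t))%:E) by exact: (measurable_slice2 t mEK).
have f1E : (\int[mu]_(x in `[a, b]) f1 x = P n t)%E.
  rewrite ge0_integral_add//.
  - by rewrite (ge0_integral_scale _ mk1)// (ge0_integral_scale _ mKt)// mulr_ge0// invr_ge0 ltW.
  - by apply: measurable_funeM; exact: measurable_funTS.
  - by apply: measurable_funeM; exact: measurable_funTS.
  - by move=> x; exact: (mule_ge0 c1 (k10 x)).
  - by move=> x; exact: (mule_ge0 c2 (EK0 (x, t))).
have f10 x : (0 <= f1 x)%E.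
  exact: (adde_ge0 (mule_ge0 c1 (k10 x)) (mule_ge0 c2 (EK0 (x, t)))).
have Pfin : P n t \is a fin_num.
  by rewrite /P fin_numD (fin_numM _ Afin)// (fin_numM _ kfin).
have if1 : mu.-integrable `[a, b] f1.
  apply/integrableP; split.
    by apply: emeasurable_funD; apply: measurable_funeM; exact: measurable_funTS.
  under eq_integral do rewrite gee0_abs//.
  rewrite f1E -ge0_fin_numE//.
  exact: (adde_ge0 (mule_ge0 c1 A0) (mule_ge0 c2 (k0 t))).
have if2 : mu.-integrable `[a, b] f2 by exact: integrable_mull.
have -> : (\int[mu]_x N n (x, t) = \int[mu]_(x in `[a, b]) N n (x, t))%E.
  rewrite [RHS]integral_mkcond; apply: eq_integral => x _; rewrite patchE.
  by case: ifPn => // /negP; rewrite inE => xX; rewrite N_out//; left.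
have -> : (\int[mu]_(x in `[a, b]) N n (x, t) = \int[mu]_(x in `[a, b]) (f1 x + f2 x))%E.
  apply: ae_eq_integral => //.
  - by apply: measurable_funTS; exact: (measurable_slice2 t (mN n)).
  - by apply: emeasurable_funD; [exact: measurable_int if1|exact: measurable_int if2].
  apply: ae_imply3 (ae_imply2 (fun x h1 h2 => conj h1 h2) aeTh iG_ae)
    (ae_neq a) (ae_neq b) => x [ThE iG] xa xb xX.
  have [iKx iGx] := iG xX.
  have xab : a < x < b.
    by move: xX; rewrite /= in_itv/= => /andP[ax xb'];
      rewrite lt_neqAle eq_sym xa ax lt_neqAle xb xb'.
  rewrite NE// ThE// /f1 /f2 /k1.
  have -> : (\int[mu]_(s in `[(t - h n)%R, t]) (K (x, s))%:E =
      (\int[mu]_(s in `[t - h n, t]) K (x, s))%:E)%E.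
    apply: (EFin_Rintegral (measurable_itv _)).
    by apply: integrable_itvS iKx _ _; rewrite bnd_simp.
  by rewrite -!EFinM -!EFinD; congr EFin; ring.
rewrite integralD// f1E -addeA leeD2l//.
have -> : (\int[mu]_(x in `[a, b]) f2 x =
    ((h n)^-1 * \int[mu]_(x in `[a, b]) (Th x * g (x, t)))%:E)%E.
  by rewrite -RintegralZl//; exact: (EFin_Rintegral (measurable_itv _) if2).
rewrite -EFinD lee_fin.
set I := \int[mu]_(x in `[a, b]) (Th x * g (x, t)) in Hs *.
rewrite -subr_ge0 (_ : _ - _ = (3 * h n)^-1 * (J (t - h n) - J t - 3 * I)); last by field.
by apply: mulr_ge0; [rewrite invr_ge0 mulr_ge0// ltW|rewrite subr_ge0].
Qed.

Let mWindow : forall n, measurable [set z : R * R | z.1 - h n <= z.2 /\ z.2 <= z.1].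
Proof.
move=> n.
have m1 : measurable_fun setT (fun z : R * R => z.1) by exact: measurable_fst.
have m2 : measurable_fun setT (fun z : R * R => z.2) by exact: measurable_snd.
have -> : [set z : R * R | z.1 - h n <= z.2 /\ z.2 <= z.1] =
  [set z : R * R | z.1 - h n <= z.2] `&` [set z : R * R | z.2 <= z.1] by [].
apply: measurableI.
- rewrite -[X in measurable X]setTI; apply: measurable_fun_le => //.
  exact: measurable_funB.
- by rewrite -[X in measurable X]setTI; apply: measurable_fun_le.
Qed.

Let mk2 : measurable_fun setT (fun z : R * R => k z.2).
Proof. exact: (measurableT_comp mk measurable_snd). Qed.

Let mL n : measurable_fun setT ((fun z : R * R => k z.2) \_
  [set z : R * R | `[t0 + h n, t1]%classic z.1 /\ (z.1 - h n <= z.2 /\ z.2 <= z.1)]).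
Proof.
have m1 : measurable_fun setT (fun z : R * R => z.1) by exact: measurable_fst.
apply: (measurable_restrictT _ _).1; last exact: measurable_funTS mk2.
have -> : [set z : R * R | `[t0 + h n, t1]%classic z.1 /\ (z.1 - h n <= z.2 /\ z.2 <= z.1)] =
   [set z : R * R | `[t0 + h n, t1]%classic z.1] `&`
   [set z : R * R | z.1 - h n <= z.2 /\ z.2 <= z.1] by [].
apply: measurableI; last exact: mWindow.
by rewrite -[X in measurable X]setTI; exact: m1.
Qed.

Let mA n : measurable_fun [set: R] (A n).
Proof.
pose L : R * R -> \bar R := (fun z : R * R => k z.2) \_
  [set z : R * R | z.1 - h n <= z.2 /\ z.2 <= z.1].
have h1 : measurable_fun setT L.
  by apply: (measurable_restrictT _ _).1; [exact: mWindow|exact: measurable_funTS mk2].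
have L0 z : (0 <= L z)%E by rewrite /L patchE; case: ifP.
have := measurable_fun_fubini_tonelli_F (m2 := mu) L h1 L0.
apply: eq_measurable_fun => t _.
rewrite AE integral_mkcond; apply: eq_integral => s _.
rewrite /L !patchE; congr (if _ then _ else _); apply/idP/idP; rewrite !inE /= in_itv/=.
  by move=> [h2 h3]; rewrite h2 h3.
by move=> /andP[h2 h3]; split.
Qed.

(** After exchanging the integrals, a given s is counted only for t in [s, s + h], a set of measure
    h. *)
Let mean_bound n : (\int[mu]_(t in `[(t0 + h n)%R, t1]) A n t <= (h n)%:E * Ie)%E.
Proof.
have hn := h0 n.
pose D := [set z : R * R | `[t0 + h n, t1]%classic z.1 /\ (z.1 - h n <= z.2 /\ z.2 <= z.1)].
pose L := (fun z : R * R => k z.2) \_ D.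
have mL' : measurable_fun setT L by exact: mL.
have L0 z : (0 <= L z)%E by rewrite /L patchE; case: ifP.
have -> : (\int[mu]_(t in `[(t0 + h n)%R, t1]) A n t = \int[mu]_t \int[mu]_s L (t, s))%E.
  rewrite integral_mkcond; apply: eq_integral => t _; rewrite patchE.
  case: ifPn => [|/negP]; rewrite inE => tD.
    rewrite AE integral_mkcond; apply: eq_integral => s _; rewrite /L !patchE.
    congr (if _ then _ else _); apply/idP/idP; rewrite !inE /D/=.
      by rewrite in_itv/= => /andP[h1 h2]; split.
    by move=> [_ [h1 h2]]; rewrite in_itv/= h1 h2.
  rewrite integral0_eq// => s _; rewrite /L patchE memNset//.
  by move=> [].
rewrite (@fubini_tonelli _ _ _ _ _ mu mu L mL' L0).
have -> : ((h n)%:E * Ie = \int[mu]_(s in `[t0, t1]) ((h n)%:E * k s))%E.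
  by rewrite (ge0_integral_scale _ mk)// ltW.
rewrite [leRHS]integral_mkcond.
have mhk : measurable_fun [set: R] (fun s => (h n)%:E * k s)%E.
  exact: (measurable_funeM _ mk).
apply: ge0_le_integral.
- exact: measurableT.
- by move=> s _; apply: integral_ge0 => t _; exact: L0.
- exact: (measurable_fun_fubini_tonelli_G (m1 := mu) L mL' L0).
- apply: (measurable_restrictT _ _).1; first exact: measurable_itv.
  exact: measurable_funTS mhk.
move=> s _; rewrite patchE; case: ifPn => [_|/negP sD].
  rewrite -(integral_itv_cst s (k s) hn) [leRHS]integral_mkcond.
  apply: ge0_le_integral.
  - exact: measurableT.
  - by move=> t _; exact: L0.
  - exact: (measurable_slice2 s mL').
  - apply: (measurable_restrictT _ _).1; first exact: measurable_itv.
    exact: measurable_cst.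
  - move=> t _; rewrite /L !patchE; case: ifPn => [|_].
      rewrite inE => -[_ /= [h1 h2]]; rewrite mem_set//= in_itv/= h2/=.
      by move: h1; rewrite lerBlDr.
    by case: ifP => _ //; exact: k0.
rewrite integral0_eq// => t _; rewrite /L patchE memNset// => -[/=].
rewrite in_itv/= => /andP[h1 h2] [h3 h4]; apply: sD; rewrite inE/= in_itv/=.
by apply/andP; split; lra.
Qed.

Let j1 n := \int[mu]_(t in `[t0 + h n, t1]) ((3 * h n)^-1 * J t).
Let j2 n := \int[mu]_(t in `[t0 + h n, t1]) ((3 * h n)^-1 * J (t - h n)).

(** Integrate [step_bound] in t. The majorant [P] contributes at most 2 c Ie: one half from the
    averaged [K], by [mean_bound], and one half from [K] at the time t. *)
Let upper n : (\int[mu]_x \int[mu]_t N n (x, t) <=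
  (2 * c * fine Ie + (j2 n - j1 n))%:E)%E.
Proof.
have hn := h0 n; have hn1 : h n != 0 by rewrite gt_eqF.
rewrite (@fubini_tonelli _ _ _ _ _ mu mu (N n) (mN n) (N0 n)).
have -> : (\int[mu]_t \int[mu]_x N n (x, t) =
    \int[mu]_(t in `[(t0 + h n)%R, t1]) \int[mu]_x N n (x, t))%E.
  rewrite [RHS]integral_mkcond; apply: eq_integral => t _; rewrite patchE.
  case: ifPn => // /negP; rewrite inE => tD.
  by rewrite integral0_eq// => x _; rewrite N_out//; right.
have cJ1 : continuous (fun t => (3 * h n)^-1 * J t).
  by move=> t; apply: cvgM; [exact: cvg_cst|exact: Jc].
have cJ2 : continuous (fun t => (3 * h n)^-1 * J (t - h n)).
  move=> t; apply: cvgM; first exact: cvg_cst.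
  apply: (@cvg_comp _ _ _ (fun t => t - h n) J _ (nbhs (t - h n))); last exact: Jc.
  by apply: cvgB => //; exact: cvg_cst.
have EJ (f : R -> R) : continuous f ->
    (\int[mu]_(t in `[(t0 + h n)%R, t1]) (f t)%:E =
     (\int[mu]_(t in `[t0 + h n, t1]) f t)%:E)%E.
  move=> cf; apply: (EFin_Rintegral (measurable_itv _)).
  exact: continuous_integrable_itv.
have mY : measurable_fun [set: R] (fun t => \int[mu]_x N n (x, t))%E.
  exact: (measurable_fun_fubini_tonelli_G (m1 := mu) (N n) (mN n) (N0 n)).
have h3 : 0 <= (3 * h n)^-1 by rewrite invr_ge0 mulr_ge0// ltW.
have mJ (f : R -> R) : continuous f -> measurable_fun `[t0 + h n, t1] (EFin \o f).
  move=> cf; apply/measurable_EFinP; apply: measurable_funTS.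
  exact: continuous_measurable_fun.
have c1 : 0 <= (h n)^-1 * c by rewrite mulr_ge0// invr_ge0 ltW.
have A0 t : (0 <= A n t)%E.
  by apply: integral_ge0 => x _; apply: integral_ge0 => s _; rewrite lee_fin.
have c1e : (0 <= ((h n)^-1 * c)%:E)%E by rewrite lee_fin.
have c2e : (0 <= c%:E)%E by rewrite lee_fin.
have P0 t : (0 <= P n t)%E.
  exact: (adde_ge0 (mule_ge0 c1e (A0 t)) (mule_ge0 c2e (k0 t))).
have mP : measurable_fun `[t0 + h n, t1] (P n).
  apply: measurable_funTS; apply: emeasurable_funD.
    exact: (measurable_funeM _ (mA n)).
  exact: (measurable_funeM _ mk).
have mI := @measurable_itv R `[t0 + h n, t1].
pose Y t := (\int[mu]_x N n (x, t))%E.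
have Y0 t : (0 <= Y t)%E by apply: integral_ge0 => x _; exact: N0.
have mY' : measurable_fun `[t0 + h n, t1] Y by exact: measurable_funTS mY.
have J10 t : (0 <= ((3 * h n)^-1 * J t)%:E)%E by rewrite lee_fin; exact: mulr_ge0.
have H : (\int[mu]_(t in `[(t0 + h n)%R, t1]) (Y t + ((3 * h n)^-1 * J t)%:E) <=
   \int[mu]_(t in `[(t0 + h n)%R, t1]) (P n t + ((3 * h n)^-1 * J (t - h n))%:E))%E.
  apply: ae_ge0_le_integral.
  - exact: mI.
  - by move=> t _; exact: (adde_ge0 (Y0 t) (J10 t)).
  - by apply: emeasurable_funD; [exact: mY'|exact: (mJ _ cJ1)].
  - by move=> t _; exact: (adde_ge0 (P0 t) (J10 _)).
  - by apply: emeasurable_funD; [exact: mP|exact: (mJ _ cJ2)].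
  - exact: step_bound.
rewrite (ge0_integral_add mI mY' (mJ _ cJ1) Y0 J10) in H.
rewrite (ge0_integral_add mI mP (mJ _ cJ2) P0 (fun t => J10 (t - h n))) in H.
rewrite (EJ _ cJ1) (EJ _ cJ2) in H.
have HP : (\int[mu]_(t in `[(t0 + h n)%R, t1]) P n t <= (2 * c * fine Ie)%:E)%E.
  rewrite ge0_integral_add.
  - rewrite (ge0_integral_scale mI (mA n) A0 c1).
    rewrite (ge0_integral_scale mI mk k0 c0).
    have -> : (2 * c * fine Ie)%:E = (((h n)^-1 * c)%:E * ((h n)%:E * Ie) + c%:E * Ie)%E.
      by rewrite [in RHS]Ifin -!EFinM -EFinD; congr EFin; field.
    have sI : `[t0 + h n, t1] `<=` `[t0, t1].
      by apply: subset_itv; rewrite bnd_simp// lerDl ltW.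
    apply: leeD; first exact: (lee_wpmul2l c1e (mean_bound n)).
    apply: (lee_wpmul2l c2e).
    exact: (ge0_integral_subset (measurable_itv _) (measurable_itv _) mk k0 sI).
  - exact: mI.
  - by apply: measurable_funTS; exact: (measurable_funeM _ (mA n)).
  - by apply: measurable_funTS; exact: (measurable_funeM _ mk).
  - by move=> t; exact: (mule_ge0 c1e (A0 t)).
  - by move=> t; exact: (mule_ge0 c2e (k0 t)).
rewrite EFinD EFinB addeA leeBrDr; last by [].
by apply: (le_trans H); rewrite leeD2r.
Qed.

(** With a primitive [F] of [J], the integrals of J(t - h) and J(t) cancel except near the ends,
    where difference quotients of [F] at [t0] and [t1] remain. *)
Let rest_cvg : (j2 n - j1 n) @[n --> \oo] --> (J t0 - J t1) / 3.
Proof.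
pose F y := \int[mu]_(s in `[t0 - 1, y]) J s.
have dF x : t0 - 1 < x -> x < t1 + 1 -> is_derive x 1 F (J x).
  exact: is_derive_primitive.
have e0 : t0 - 1 < t0 by lra.
have e1 : t0 < t1 + 1 by apply: (lt_trans t01); rewrite ltrDl.
have e2 : t0 - 1 < t1 by apply: lt_trans t01.
have e3 : t1 < t1 + 1 by lra.
have hN0 n : h n != 0 by rewrite gt_eqF.
have hn n : t0 + h n <= t1 by have := hlt n; lra.
have j1E n : j1 n = (3 * h n)^-1 * (F t1 - F (t0 + h n)).
  rewrite /j1 RintegralZl//; last exact: continuous_integrable_itv.
  congr (_ * _); apply: Rintegral_is_derive_in => //.
    by move=> x /andP[h1 h2]; apply: dF; have := h0 n; lra.
  exact: continuous_subspaceT.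
have cJs n : continuous (fun t => J (t - h n)).
  move=> t; apply: (@cvg_comp _ _ _ (fun t => t - h n) J _ (nbhs (t - h n))); last exact: Jc.
  by apply: cvgB => //; exact: cvg_cst.
have j2E n : j2 n = (3 * h n)^-1 * (F (t1 - h n) - F t0).
  rewrite /j2 RintegralZl//; last exact: continuous_integrable_itv.
  congr (_ * _).
  have -> : F (t1 - h n) - F t0 = F (t1 - h n) - F (t0 + h n - h n) by rewrite addrK.
  apply: (@Rintegral_is_derive_in _ (fun t => F (t - h n))) => //; last first.
    exact: continuous_subspaceT.
  move=> x /andP[h1 h2].
  have d1 : is_derive x 1 (fun t : R => t - h n) 1.
    by apply: is_derive_eq; rewrite subr0.
  have d2 : is_derive (x - h n) 1 F (J (x - h n)) by apply: dF; have := h0 n; lra.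
  have := @is_derive1_comp _ F (fun t : R => t - h n) x _ _ d2 d1.
  by rewrite mulr1.
have l0 : (h n)^-1 * (F (t0 + h n) - F t0) @[n --> \oo] --> J t0.
  by apply: is_derive_sequence => //; exact: dF.
have l1 : (- h n)^-1 * (F (t1 + - h n) - F t1) @[n --> \oo] --> J t1.
  apply: (is_derive_sequence (h := fun n => - h n)) => //.
  - exact: dF.
  - by move=> n; rewrite oppr_eq0.
  - by rewrite -oppr0; exact: cvgN.
have -> : (fun n => j2 n - j1 n) = (fun n => ((h n)^-1 * (F (t0 + h n) - F t0) -
    (- h n)^-1 * (F (t1 + - h n) - F t1)) / 3).
  by apply/funext => n; rewrite j1E j2E; field.
by apply: cvgM; [exact: cvgB|exact: cvg_cst].
Qed.

(** The lower and the upper bound contain the same finite term 2 c Ie; cancelling it leaves (J t0 -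
    J t1) / 3 >= 0. *)
Lemma energy_nonincreasing : J t1 <= J t0.
Proof.
have H : (\int[mu]_(x in `[a, b]) \int[mu]_(t in `[t0, t1]) (2 * c * K (x, t))%:E <=
    (2 * c * fine Ie + (J t0 - J t1) / 3)%:E)%E.
  apply: le_trans lower (le_limn_einf_cvg upper _).
  exact: (cvgD (cvg_cst (2 * c * fine Ie)) rest_cvg).
have mcK : measurable_fun [set: R * R] (fun z => (2 * c * K z)%:E).
  by apply/measurable_EFinP; exact: measurable_funM.
have cK0 z : (0 <= (2 * c * K z)%:E :> \bar R)%E by rewrite lee_fin !mulr_ge0.
rewrite (tonelli_box (measurable_itv _) (measurable_itv _) mcK cK0) in H.
have E : (\int[mu]_(t in `[t0, t1]) \int[mu]_(x in `[a, b]) (2 * c * K (x, t))%:E =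
   (2 * c * fine Ie)%:E)%E.
  have cc : 0 <= 2 * c by rewrite mulr_ge0.
  rewrite EFinM -Ifin -(ge0_integral_scale (measurable_itv _) mk k0 cc).
  apply: eq_integral => t _.
  exact: (ge0_integral_scale (measurable_itv _) (measurable_slice2 t mEK)
    (fun x => EK0 (x, t)) cc).
rewrite E lee_fin lerDl in H.
by rewrite -subr_ge0; rewrite pmulr_lge0 ?invr_gt0// in H.
Qed.

End decay.

Theorem comparison_principle :
  (forall x, a <= x <= b -> u1 (x, T0) <= u2 (x, T0)) ->
  forall x t, a <= x <= b -> T0 <= t <= T1 -> u1 (x, t) <= u2 (x, t).
Proof.
move=> init x t xab /andP[T0t tT1].
have JT0 : J T0 = 0.
  rewrite /J /Rintegral integral0_eq// => y; rewrite /= in_itv/= => yab.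
  by rewrite max_r ?expr0n// /w subr_le0 init.
have Jt : J t = 0.
  apply/eqP; rewrite eq_le J0 andbT leNgt; apply/negP => Jt0.
  move: T0t; rewrite le_eqVlt => /orP[/eqP T0t|T0t]; first by move: Jt0; rewrite -T0t JT0 ltxx.
  (* The energy inequality holds only between times after [T0]. Continuity of [J] provides such a
     time s with J s < J t, which contradicts the decay from s to t. *)
  have JT : J s @[s --> T0] --> J T0 by exact: Jc.
  have H : \forall s \near T0^'+, J s < J t.
    by apply: cvgr_lt (cvg_at_right_filter JT) _ _; rewrite JT0.
  have H1 : \forall s \near T0^'+, T0 < s by exact: nbhs_right_gt.
  have H2 : \forall s \near T0^'+, s < t by exact: nbhs_right_lt.
  have H3 : \forall s \near T0^'+, J s < J t /\ T0 < s < t.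
    by near=> s; split; [near: s|apply/andP; split; near: s].
  have [s [Js /andP[Ts st]]] := @filter_ex _ _ (at_right_proper_filter T0) _ H3.
  by have := energy_nonincreasing Ts st tT1; rewrite leNgt Js.
have tT : T0 <= t <= T1 by rewrite T0t.
have /andP[ax xb] := xab.
move: ax xb; rewrite le_eqVlt => /orP[/eqP<- _|ax]; first exact: bdry_a.
rewrite le_eqVlt => /orP[/eqP->|xb]; first exact: bdry_b.
have P30 y : 0 <= pos (w (y, t)) ^+ 3 by rewrite exprn_ge0// le_max lexx orbT.
have xab' : a < x < b by rewrite ax.
have /eqP := continuous_ge0_Rintegral_eq0 ab (@cpos3 t) P30 Jt xab'.
rewrite expf_eq0/= => /eqP wx; rewrite -subr_le0 -/(w (x, t)) -wx.
by rewrite le_max lexx.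
Unshelve. all: by end_near.
Qed.

End comparison.

(** * From the weak formulation to boxes *)

(** A real-valued section integral takes a default value wherever the extended one is infinite. The
    sections are integrable almost everywhere, so the two versions agree up to null sets and Fubini
    carries over. *)
Lemma Fubini_box_Rintegral (R : realType) (X Y : set R) (k : R * R -> R) :
  measurable X -> measurable Y -> measurable_fun [set: R * R] k ->
  (\int[mu]_(y in Y) \int[mu]_(x in X) `|k (x, y)|%:E < +oo)%E ->
  mu.-integrable X (EFin \o (fun x => \int[mu]_(y in Y) k (x, y))) /\
  \int[mu]_(y in Y) (\int[mu]_(x in X) k (x, y)) =
  \int[mu]_(x in X) (\int[mu]_(y in Y) k (x, y)).
Proof.
move=> mX mY mk koo.
have ik := integrable_box mX mY mk koo.
have iX := ae_integrable_box2 mX mY mk koo.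
have iY := ae_integrable_box1 mX mY mk koo.
have iF : mu.-integrable X (fun x => \int[mu]_(y in Y) (k (x, y))%:E)%E.
  have := integrable_fubini_F ik.
  rewrite [in X in _ -> X]integrable_mkcond//; apply: eq_integrable => // x _.
  rewrite /fubini_F patchE; case: ifPn => [|/negP]; rewrite inE => h.
    rewrite [RHS]integral_mkcond; apply: eq_integral => y _.
    rewrite !patchE; congr (if _ then _ else _).
    by apply/idP/idP; rewrite !inE => //= -[].
  rewrite integral0_eq// => y _; rewrite patchE memNset//.
  by move=> [].
have aeF : {ae mu, forall x, X x -> (\int[mu]_(y in Y) (k (x, y))%:E)%E =
    (\int[mu]_(y in Y) k (x, y))%:E}.
  by apply: ae_imply iY => x H xX; apply: EFin_Rintegral => //; exact: H.
have aeG : {ae mu, forall y, Y y -> (\int[mu]_(x in X) (k (x, y))%:E)%E =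
    (\int[mu]_(x in X) k (x, y))%:E}.
  by apply: ae_imply iX => x H xX; apply: EFin_Rintegral => //; exact: H.
have mG : measurable_fun Y (fun y => \int[mu]_(x in X) (k (x, y))%:E)%E.
  apply/(measurable_restrictT _ mY); have := measurable_fubini_G ik.
  apply: eq_measurable_fun => y _.
  rewrite /fubini_G patchE; case: ifPn => [|/negP]; rewrite inE => h.
    rewrite [RHS]integral_mkcond; apply: eq_integral => x _.
    rewrite !patchE; congr (if _ then _ else _).
    by apply/idP/idP; rewrite !inE => //= -[].
  rewrite integral0_eq// => x _; rewrite patchE memNset//.
  by move=> [].
have fine_meas (Z : set R) (F : R -> \bar R) : measurable_fun Z F ->
    measurable_fun Z (EFin \o (fine \o F)).
  move=> mF; apply/measurable_EFinP.
  exact: (measurableT_comp (fine_measurable _) mF).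
have mF := measurable_int _ iF.
split.
  apply/integrableP; split; first exact: fine_meas mF.
  have /integrableP[_] := iF; apply: le_lt_trans; rewrite le_eqVlt; apply/orP; left.
  apply/eqP; apply: ae_eq_integral => //.
  - by apply: measurableT_comp => //; exact: fine_meas mF.
  - by apply: measurableT_comp => //; exact: mF.
  - by apply: ae_imply aeF => x H xX; rewrite H.
rewrite {1 3}/Rintegral; congr fine.
have -> : (\int[mu]_(y in Y) (\int[mu]_(x in X) k (x, y))%:E =
    \int[mu]_(y in Y) \int[mu]_(x in X) (k (x, y))%:E)%E.
  apply: ae_eq_integral => //; first exact: fine_meas mG.
  by apply: ae_imply aeG => y H yY; rewrite H.
have -> : (\int[mu]_(x in X) (\int[mu]_(y in Y) k (x, y))%:E =
    \int[mu]_(x in X) \int[mu]_(y in Y) (k (x, y))%:E)%E.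
  apply: ae_eq_integral => //; first exact: fine_meas mF.
  by apply: ae_imply aeF => x H xX; rewrite H.
rewrite (integral_box X Y (fun z => (k z)%:E)) (integral_box_swap X Y (fun z => (k z)%:E)).
by rewrite -(Fubini ik).
Qed.

Lemma ae_flux_integrable (R : realType) (p a b t0 t1 : R) (q : R * R -> R) : 2 < p ->
  measurable_fun [set: R * R] q ->
  (\int[mu]_(t in `[t0, t1]) \int[mu]_(x in `[a, b]) (`|q (x, t)| `^ p)%:E < +oo)%E ->
  {ae mu, forall x, `[a, b]%classic x ->
    mu.-integrable `[t0, t1] (EFin \o (fun t => flux p (q (x, t))))}.
Proof.
move=> p2 mq qoo.
have mqp : measurable_fun [set: R * R] (fun z => `|q z| `^ p).
  exact: (measurableT_comp (@measurable_norm_powR R p) mq).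
have := @ae_integrable_box1 R `[a, b] `[t0, t1] _ (measurable_itv _) (measurable_itv _) mqp.
have -> : (\int[mu]_(y in `[t0, t1]) \int[mu]_(x in `[a, b]) `| `|q (x, y)| `^ p|%:E =
    \int[mu]_(t in `[t0, t1]) \int[mu]_(x in `[a, b]) (`|q (x, t)| `^ p)%:E)%E.
  by apply: eq_integral => t _; apply: eq_integral => x _; rewrite ger0_norm// powR_ge0.
move=> /(_ qoo); apply: ae_imply => x /[apply] h.
have : mu.-integrable `[t0, t1] (EFin \o (fun t => 1 + `|q (x, t)| `^ p)).
  by apply: integrable_add => //; exact: integrable_itv_cst.
apply: le_integrable => //.
  apply/measurable_EFinP; apply: measurable_funTS.
  exact: (measurableT_comp (measurable_flux p2) (measurable_rslice1 x mq)).
move=> t _; rewrite /= lee_fin [leRHS]ger0_norm ?addr_ge0 ?powR_ge0//.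
exact: norm_flux_le1D.
Qed.

Lemma within_continuous_ae_eq (R : realType) (a b : R) (f g : R -> R) : a < b ->
  {within `[a, b], continuous f} -> {within `[a, b], continuous g} ->
  {ae mu, forall x : R, a < x < b -> f x = g x} ->
  forall x, a <= x <= b -> f x = g x.
Proof.
move=> ab cf cg ae x xab; apply: contrapT => /eqP; rewrite -subr_eq0 => fgx.
have /continuous_within_itvP cfg : {within `[a, b], continuous (f \- g)}.
  by move=> z; apply: cvgB; [exact: cf|exact: cg].
have /subspace_continuousP H : {within `[a, b], continuous (f \- g)}.
  by move=> z; apply: cvgB; [exact: cf|exact: cg].
have xI : `[a, b]%classic x by rewrite /= in_itv.
have := H _ xI; move=> /(@cvgr_neq0 _ R R _ _ (f \- g) _)/(_ fgx).
rewrite near_withinE => -[d /= d0 Hd].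
pose l := Num.max a (x - d); pose r := Num.min b (x + d).
have /andP[ax xb] := xab.
have lr : l < r.
  by rewrite /l /r gt_max !lt_min; apply/andP; split; apply/andP; split => //; lra.
have [y /andP[ly yr] H2] := ae_exists_itv lr ae.
move: ly yr; rewrite /l /r gt_max lt_min => /andP[ay xy] /andP[yb yx].
have yab : a < y < b by rewrite ay.
have xyd : `|x - y| < d by rewrite ltr_distl; apply/andP; split; lra.
have yI : y \in `[a, b] by rewrite in_itv/= !ltW.
by have := Hd y xyd yI; rewrite H2// subrr eqxx.
Qed.

Section weak_to_box.
Context {R : realType}.
Variable p : R.
Hypothesis p2 : 2 < p.

Definition solution (a b T0 T1 : R) (u q : R * R -> R) : Prop :=
  space_profile p a b T0 T1 u q /\
  forall t0 t1, T0 < t0 -> t0 < t1 -> t1 <= T1 ->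
    flux_primitive p a b t0 t1 q (fun x => u (x, t1) - u (x, t0)).

Lemma solution_sub a b T0 T1 u q : solution a b T0 T1 u q ->
  subsolution p a b T0 T1 u q.
Proof.
by move=> [h1 h2]; split => // t0 t1 *; exists (fun x => u (x, t1) - u (x, t0)); first exact: h2.
Qed.

Lemma solution_super a b T0 T1 u q : solution a b T0 T1 u q ->
  supersolution p a b T0 T1 u q.
Proof.
by move=> [h1 h2]; split => // t0 t1 *; exists (fun x => u (x, t1) - u (x, t0)); first exact: h2.
Qed.

(** By du Bois-Reymond [f] agrees almost everywhere with a primitive of [g]; both are continuous,
    hence they agree on all of [a, b]. *)
Lemma weak_derivative_ac (f g : R -> R) (a b : R) : a < b -> continuous f ->
  weak_derivative f g -> ac_on a b f g.
Proof.
move=> ab cf [_ lg H].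
have ig : mu.-integrable `[a, b] (EFin \o g).
  have [mg _ goo] := lg.
  apply/integrableP; split.
    by apply/measurable_EFinP; exact: measurable_funTS.
  by apply: goo => //; exact: segment_compact.
have test phi phi1 phi2 : C2_test a b phi phi1 phi2 ->
    \int[mu]_(x in `[a, b]) (g x * phi x) + \int[mu]_(x in `[a, b]) (f x * phi1 x) = 0.
  move=> [d1 d2 _ [c [d [ac cd db sup]]]].
  have phi1E : derive1 phi = phi1.
    by apply/funext => x; rewrite derive1E; have [_ ->] := d1 x.
  have C : C1c phi.
    split; first by move=> x; have [] := d1 x.
      by rewrite phi1E; exact: continuous_is_derive d2.
    exists (`|c| + `|d|) => x xM.
    suff /sup[] : x <= c \/ d <= x by [].
    have hd := ler_norm d; have hc : - `|c| <= c by have := ler_norm (- c); rewrite normrN; lra.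
    have hc0 := normr_ge0 c; have hd0 := normr_ge0 d.
    have [x0|x0] := leP 0 x; rewrite ?(ger0_norm x0) ?(ltr0_norm x0) in xM.
      by right; lra.
    by left; lra.
  have out x : ~ `[a, b]%classic x -> phi x = 0 /\ phi1 x = 0.
    move=> /= /negP; rewrite in_itv/= negb_and -!ltNge => /orP[h|h]; apply: sup.
      by left; lra.
    by right; lra.
  have := H _ C; rewrite phi1E.
  rewrite (@Rintegral_support _ `[a, b] setT)//; last first.
    by move=> x _ /out[_ ->]; rewrite mulr0.
  rewrite (@Rintegral_support _ `[a, b] setT (fun x => g x * phi x))//; last first.
    by move=> x _ /out[-> _]; rewrite mulr0.
  by move=> ->; rewrite addrC addNr.
have [k Hk] := du_bois_reymond ab (continuous_integrable_itv a b cf) ig test.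
have ack : ac_on a b (fun x => k + \int[mu]_(y in `[a, x]) g y) g.
  by split => // x _; rewrite set_itv1 Rintegral_set1 addr0.
have E := within_continuous_ae_eq ab (continuous_subspaceT cf) (ac_on_within (ltW ab) ack) Hk.
split => // x xab; rewrite !E//; first by rewrite set_itv1 Rintegral_set1 addr0.
by rewrite lexx ltW.
Qed.

(** Du Bois-Reymond is applied to the time integral of the flux. Exchanging the order of integration
    is legitimate because the flux is at most 1 + |q|^p, which is integrable over the box. *)
Lemma C2_test_flux_primitive (a b t0 t1 : R) (q : R * R -> R) (D : R -> R) :
  a < b -> measurable_fun [set: R * R] q -> mu.-integrable `[a, b] (EFin \o D) ->
  (\int[mu]_(t in `[t0, t1]) \int[mu]_(x in `[a, b]) (`|q (x, t)| `^ p)%:E < +oo)%E ->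
  (forall phi phi1 phi2, C2_test a b phi phi1 phi2 ->
    \int[mu]_(x in `[a, b]) (D x * phi x) +
    \int[mu]_(t in `[t0, t1]) (\int[mu]_(x in `[a, b]) (flux p (q (x, t)) * phi1 x)) = 0) ->
  flux_primitive p a b t0 t1 q D.
Proof.
move=> ab mq iD qoo H; split => //.
have mfq : measurable_fun [set: R * R] (fun z => flux p (q z)).
  exact: (measurableT_comp (measurable_flux p2) mq).
have p0 z : (0 <= (`|q z| `^ p)%:E)%E by rewrite lee_fin powR_ge0.
have mqp : measurable_fun [set: R * R] (fun z => (`|q z| `^ p)%:E).
  by apply/measurable_EFinP; exact: (measurableT_comp (@measurable_norm_powR R p) mq).
have boxoo (M : R) : 0 <= M ->
    (\int[mu]_(t in `[t0, t1]) \int[mu]_(x in `[a, b]) (M * (1 + `|q (x, t)| `^ p))%:E < +oo)%E.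
  move=> M0.
  have E t : (\int[mu]_(x in `[a, b]) (M * (1 + `|q (x, t)| `^ p))%:E =
     (M * (b - a))%:E + M%:E * \int[mu]_(x in `[a, b]) (`|q (x, t)| `^ p)%:E)%E.
    have mqt := measurable_slice2 t mqp.
    under eq_integral do rewrite mulrDr mulr1 EFinD EFinM.
    rewrite ge0_integral_add//.
    - rewrite (ge0_integral_scale (measurable_itv _) mqt (fun x => p0 (x, t)) M0).
      by rewrite integral_cst//= lebesgue_measure_itv/= lte_fin ab -EFinB -EFinM.
    - by apply: measurable_funTS; exact: (measurable_funeM _ mqt).
    - by move=> x; rewrite mule_ge0// ?lee_fin.
  under eq_integral do rewrite E.
  have mI := measurable_integral_slice (measurable_itv `[a, b]) mqp p0.
  have I0 t : (0 <= \int[mu]_(x in `[a, b]) (`|q (x, t)| `^ p)%:E)%E by exact: integral_ge0.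
  rewrite ge0_integral_add//.
  - rewrite (ge0_integral_scale (measurable_itv _) mI I0 M0).
    apply: lte_add_pinfty; last by rewrite lte_mul_pinfty// lee_fin.
    rewrite integral_cst//= lebesgue_measure_itv/=.
    by case: ifP => _; rewrite -?EFinB -?EFinM ?mule0 ltry.
  - by apply: measurable_funTS; exact: (measurable_funeM _ mI).
  - by move=> x; rewrite lee_fin mulr_ge0// subr_ge0 ltW.
  - by move=> x; rewrite mule_ge0// lee_fin.
have swap (m : R -> R) M : measurable_fun [set: R] m -> (forall x, a <= x <= b -> `|m x| <= M) ->
    mu.-integrable `[a, b] (EFin \o (fun x => \int[mu]_(t in `[t0, t1]) (flux p (q (x, t)) * m x))) /\
    \int[mu]_(t in `[t0, t1]) (\int[mu]_(x in `[a, b]) (flux p (q (x, t)) * m x)) =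
    \int[mu]_(x in `[a, b]) (\int[mu]_(t in `[t0, t1]) (flux p (q (x, t)) * m x)).
  move=> mm mM.
  have M0 : 0 <= M by apply: le_trans (mM a _) => //; rewrite lexx ltW.
  have mk : measurable_fun [set: R * R] (fun z => flux p (q z) * m z.1).
    by apply: measurable_funM => //; exact: (measurableT_comp mm measurable_fst).
  apply: (Fubini_box_Rintegral (k := fun z => flux p (q z) * m z.1)) => //.
  apply: le_lt_trans (boxoo _ M0); apply: ge0_le_integral => //.
  - by move=> t _; exact: integral_ge0.
  - apply: measurable_funTS.
    apply: (measurable_integral_slice (measurable_itv `[a, b])
      (f := fun z => `|flux p (q z) * m z.1|%:E)) => //.
    by apply/measurable_EFinP; exact: measurableT_comp.
  - apply: measurable_funTS.
    apply: (measurable_integral_slice (measurable_itv `[a, b])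
      (f := fun z => (M * (1 + `|q z| `^ p))%:E)) => //.
      apply/measurable_EFinP; apply: measurable_funM => //; apply: measurable_funD => //.
      exact/measurable_EFinP.
    by move=> z; rewrite lee_fin mulr_ge0// addr_ge0// powR_ge0.
  - move=> t _; apply: ge0_le_integral => //.
    + apply: measurable_funTS; apply/measurable_EFinP.
      exact: (measurableT_comp (@normr_measurable R _) (measurable_rslice2 t mk)).
    + apply: measurable_funTS; apply/measurable_EFinP.
      apply: measurable_funM => //; apply: measurable_funD => //.
      by apply: (measurable_rslice2 t (k := fun z => `|q z| `^ p)); exact/measurable_EFinP.
    + move=> x; rewrite /= in_itv/= => xab; rewrite lee_fin normrM mulrC.
      by apply: ler_pM => //; [exact: mM|exact: norm_flux_le1D].
pose Psi x := \int[mu]_(t in `[t0, t1]) flux p (q (x, t)).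
have iP : mu.-integrable `[a, b] (EFin \o Psi).
  have n1 x : a <= x <= b -> `|1 : R| <= 1 by rewrite normr1.
  have [+ _] := swap (fun=> 1) 1 (measurable_cst _) n1.
  by apply: eq_integrable => // x _ /=; congr EFin; apply: eq_Rintegral => t _; rewrite mulr1.
have aei := ae_flux_integrable p2 mq qoo.
apply: (du_bois_reymond ab iP iD) => phi phi1 phi2 Cphi.
have [_ d2 _ _] := Cphi; have c1 := continuous_is_derive d2.
have [M _ HM] := continuous_bounded_itv a b c1.
have [i1 E] := swap phi1 M (continuous_measurable_fun c1) HM.
rewrite -(H _ _ _ Cphi) E; congr (_ + _).
rewrite /Rintegral; congr fine; apply: ae_eq_integral => //.
- apply/measurable_EFinP; apply: measurable_funM.
    by apply/measurable_EFinP; exact: measurable_int iP.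
  by apply: measurable_funTS; exact: continuous_measurable_fun.
- exact: measurable_int i1.
- apply: ae_imply aei => x H1 xI; congr EFin.
  rewrite -/(Rintegral mu `[t0, t1] (fun t => flux p (q (x, t)) * phi1 x)).
  by rewrite RintegralZr//; exact: (H1 xI).
Qed.

End weak_to_box.

(** The values of [u] at negative times are arbitrary; replacing them by the initial values gives a
    function continuous on the whole plane, as [space_profile] demands. *)
Definition time_clamp {R : realType} (u : R * R -> R) (z : R * R) : R :=
  u (z.1, Num.max z.2 0).

Section cauchy_to_box.
Context {R : realType}.
Variables (p : R) (u0 : R -> R) (u : R * R -> R).
Hypotheses (p2 : 2 < p) (Hu : cauchy_solution p +oo%E u0 u).
Let v := time_clamp u.

Lemma time_clampE x t : 0 <= t -> time_clamp u (x, t) = u (x, t).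
Proof. by move=> t0; rewrite /time_clamp/= max_l. Qed.

Let measurable_positive_time : measurable [set z : R * R | 0 < z.2].
Proof.
have -> : [set z : R * R | 0 < z.2] = [set: R * R] `&` (snd @^-1` `]0, +oo[).
  by rewrite setTI; apply/seteqP; split => z /=; rewrite in_itv/= andbT.
by apply: (measurable_snd measurableT); exact: measurable_itv.
Qed.

Let cv : continuous v.
Proof.
have [_ /subspace_continuousP cu _] := Hu.
move=> z; have zS : closed_strip +oo%E (z.1, Num.max z.2 0).
  by split; rewrite /= ?leey// le_max lexx orbT.
have := cu _ zS; apply: cvg_comp.
have cm : continuous (fun z : R * R => (z.1, Num.max z.2 0)).
  move=> [x t]; apply: (@cvg_pair _ _ _ _ (nbhs x) (nbhs (Num.max t 0))).
    exact: (@cvg_fst _ _ (nbhs x) (nbhs t)).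
  apply: cvg_pos; exact: (@cvg_snd _ _ (nbhs x) (nbhs t)).
move=> A; rewrite /within/= => HA.
have := cm z _ HA; rewrite /nbhs/=; apply: filterS => y /=; apply.
by split; rewrite /= ?leey// le_max lexx orbT.
Qed.

Let mv : measurable_fun [set: R * R] v.
Proof.
have [[_ mu_ _ _] _ _] := Hu.
have mS : measurable [set z : R * R | 0 < z.2].
  exact: measurable_positive_time.
have -> : [set: R * R] = [set z | 0 < z.2] `|` ~` [set z | 0 < z.2] by rewrite setUv.
apply/measurable_funU => //; first exact: measurableC; split.
- have -> : [set z : R * R | 0 < z.2] = strip +oo%E.
    by apply/seteqP; split => z /=; [move=> h; split => //; rewrite leey|case].
  apply: eq_measurable_fun mu_ => -[x t]; rewrite inE => -[/= t0 _].
  by rewrite /v time_clampE// ltW.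
- apply: (@eq_measurable_fun _ _ _ _ _ (fun z : R * R => v (z.1, 0))).
    move=> [x t]; rewrite inE /= => /negP; rewrite -leNgt => t0.
    by rewrite /v /time_clamp/= maxxx max_r.
  apply: measurable_funTS.
  have c0 : continuous (fun x => v (x, 0)).
    exact: continuous_slice2.
  exact: (measurableT_comp (continuous_measurable_fun c0) measurable_fst).
Qed.

(** Rectangles and test functions independent of t are enough to reach the integrated form. The
    slope is set to 0 outside the strip to be measurable on the plane, and one [q] serves all
    boxes. *)
Theorem cauchy_solution_on_boxes : exists q, forall a b T : R, a < b -> 0 < T ->
  solution p a b 0 T v q.
Proof.
have [[_ mu_ _ [ux [[_ mux aew Lp] W]]] _ _] := Hu.
have mS : measurable (strip (R := R) +oo%E).
  have -> : strip +oo%E = [set z : R * R | 0 < z.2].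
    by apply/seteqP; split => z /=; [case|move=> h; split => //; rewrite leey].
  exact: measurable_positive_time.
pose q := ux \_ (strip +oo%E).
have qE x t : 0 < t -> q (x, t) = ux (x, t).
  by move=> t0; rewrite /q patchE mem_set//; split => //=; rewrite leey.
have mq : measurable_fun [set: R * R] q by exact: (measurable_restrictT _ mS).1.
exists q => a b T ab T0.
have qoo t0 : 0 < t0 -> (\int[mu]_(t in `[t0, T])
         \int[mu]_(x in `[a, b]) (`|q (x, t)| `^ p)%:E < +oo)%E.
  (* The integrability hypothesis needs a nondegenerate time interval, whereas [t0] may be [T] or
     more. *)
  move=> t00; pose s := Num.min t0 (T / 2).
  have s0 : 0 < s by rewrite lt_min t00 divr_gt0.
  have sT : s < T by rewrite gt_min; apply/orP; right; lra.
  have := Lp a b s T ab s0 sT (leey _); apply: le_lt_trans.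
  have mqp : measurable_fun [set: R * R] (fun z => (`|q z| `^ p)%:E).
    apply/measurable_EFinP.
    exact: (measurableT_comp (@measurable_norm_powR R p) mq).
  have mvp : measurable_fun [set: R * R] (fun z => (`|v z| `^ p)%:E).
    apply/measurable_EFinP.
    exact: (measurableT_comp (@measurable_norm_powR R p) mv).
  have p0 (f : R * R -> R) z : (0 <= (`|f z| `^ p)%:E)%E by rewrite lee_fin powR_ge0.
  pose F t := (\int[mu]_(x in `[a, b]) (`|q (x, t)| `^ p)%:E)%E.
  have mF : measurable_fun [set: R] F.
    exact: (measurable_integral_slice (measurable_itv `[a, b]) mqp (p0 q)).
  have F0 t : (0 <= F t)%E by apply: integral_ge0 => x _; exact: p0.
  have sub : `[t0, T] `<=` `[s, T].
    by apply: subset_itv; rewrite bnd_simp// ge_min lexx.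
  apply: le_trans (ge0_integral_subset (measurable_itv _) (measurable_itv _) mF F0 sub) _.
  have -> : (\int[mu]_(t in `[s, T]) \int[mu]_(x in `[a, b])
      (`|u (x, t)| `^ p + `|ux (x, t)| `^ p)%:E =
    \int[mu]_(t in `[s, T]) \int[mu]_(x in `[a, b])
      ((`|v (x, t)| `^ p)%:E + (`|q (x, t)| `^ p)%:E))%E.
    apply: eq_integral => t; rewrite inE/= in_itv/= => /andP[st _].
    have t0' : 0 < t by exact: lt_le_trans st.
    apply: eq_integral => x _; rewrite /v time_clampE ?(ltW t0')// qE//.
  have mS2 : measurable_fun [set: R * R]
      (fun z => (`|v z| `^ p)%:E + (`|q z| `^ p)%:E)%E by exact: emeasurable_funD.
  have S0 z : (0 <= (`|v z| `^ p)%:E + (`|q z| `^ p)%:E)%E.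
    exact: (adde_ge0 (p0 v z) (p0 q z)).
  apply: ge0_le_integral.
  - exact: measurable_itv.
  - by move=> t _; exact: F0.
  - exact: measurable_funTS mF.
  - apply: measurable_funTS.
    exact: (measurable_integral_slice (measurable_itv `[a, b]) mS2 S0).
  - move=> t _; apply: ge0_le_integral.
    + exact: measurable_itv.
    + by move=> x _; exact: p0.
    + by apply: measurable_funTS; exact: (measurable_slice2 t mqp).
    + by apply: measurable_funTS; exact: (measurable_slice2 t mS2).
    + by move=> x _; exact: leeDr (p0 v _).
have sp : space_profile p a b 0 T v q.
  split => //.
  apply: ae_imply aew => t H /andP[t0 tT].
  have := H (conj t0 (leey _)); have -> : (fun x => u (x, t)) = (fun x => v (x, t)).
    by apply/funext => x; rewrite /v time_clampE// ltW.
  have -> : (fun x => ux (x, t)) = (fun x => q (x, t)).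
    by apply/funext => x; rewrite qE.
  apply: weak_derivative_ac => //.
  exact: continuous_slice2.
split => // t0 t1 t00 t01 t1T.
have cvt t : continuous (fun x => v (x, t)).
  exact: continuous_slice2.
apply: (C2_test_flux_primitive p2 ab mq).
- by apply: integrable_sub => //; exact: continuous_integrable_itv.
- exact: (integral_profile_le sp).
move=> phi phi1 phi2 [d1 d2 c2 [c [d [ac cd db sup]]]].
have c0 := continuous_is_derive d1; have c1 := continuous_is_derive d2.
have cst_C1 (y : R) : C1_on t0 t1 (fun=> y).
  split; first by apply: continuous_subspaceT => x; exact: cvg_cst.
  exists (fun=> 0); split; first by apply: continuous_subspaceT => x; exact: cvg_cst.
  by move=> t _; exact: is_derive_cst.
have C21 : C21_closure (region t0 t1 (fun=> a) (fun=> b)) (fun z => phi z.1)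
    (fun z => phi1 z.1) (fun z => phi2 z.1) (fun=> 0).
  split; try by apply: continuous_subspaceT; exact: continuous_fst_fun.
  - by apply: continuous_subspaceT => x; exact: cvg_cst.
  - by move=> z _; split; [exact: d1|exact: d2|exact: (is_derive_cst (phi z.1))].
have bd t : t0 <= t <= t1 -> phi a = 0 /\ phi b = 0.
  by move=> _; split; [have [|->] := sup a; rewrite ?(ltW ac)//; left|
    have [|->] := sup b; rewrite ?(ltW db)//; right].
have := W t0 t1 (fun=> a) (fun=> b) t00 t01 (leey _) (cst_C1 a) (cst_C1 b)
  (fun t _ => ab) _ _ _ _ C21 bd.
have uE t : 0 < t -> \int[mu]_(x in `[a, b]) (u (x, t) * phi (x, t).1) =
    \int[mu]_(x in `[a, b]) (v (x, t) * phi x).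
  by move=> tp; apply: eq_Rintegral => x _; rewrite /v time_clampE// ltW.
rewrite !uE//; last exact: lt_trans t01.
move=> E; rewrite -[RHS]E; congr (_ + _).
  rewrite -RintegralB//.
  - by apply: eq_Rintegral => x _; ring.
  - by apply: continuous_integrable_itv => x; apply: cvgM; [exact: cvt|exact: c0].
  - by apply: continuous_integrable_itv => x; apply: cvgM; [exact: cvt|exact: c0].
apply: eq_Rintegral => t; rewrite inE/= in_itv/= => /andP[tt0 tt1].
apply: eq_Rintegral => x _; rewrite mulr0 oppr0 add0r qE//.
exact: lt_le_trans tt0.
Qed.

End cauchy_to_box.

(** * Explicit sub- and supersolutions *)

Section positive_powers.
Context {R : realType}.
Implicit Types (a b c e x y : R).

(** Clamping the base at 0 discards the default value of the power at a negative base and makes the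
    function differentiable across 0 when a > 1. *)
Definition ppow a x := Num.max x 0 `^ a.

Lemma ppow_ge0 a x : 0 <= ppow a x. Proof. exact: powR_ge0. Qed.

Lemma ppow_le0 a x : 0 < a -> x <= 0 -> ppow a x = 0.
Proof. by move=> a0 x0; rewrite /ppow max_r// powR0// gt_eqF. Qed.

Lemma ppow_ge0E a x : 0 <= x -> ppow a x = x `^ a.
Proof. by move=> x0; rewrite /ppow max_l. Qed.

Lemma continuous_ppow a : 0 < a -> continuous (ppow a).
Proof.
move=> a0 x.
have -> : ppow a = (fun y => `|Num.max y 0| `^ a).
  by apply/funext => y; rewrite ger0_norm// le_max lexx orbT.
apply: (@cvg_comp _ _ _ (fun y => Num.max y 0) (fun y => `|y| `^ a) _
  (nbhs (Num.max x 0))); first exact: continuous_pos.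
exact: continuous_powR.
Qed.

Lemma ppow_mulr a x : 0 < a -> x * ppow a x = ppow (a + 1) x.
Proof.
move=> a0; have [x0|x0] := leP x 0.
  by rewrite !ppow_le0 ?mulr0// addr_gt0.
by rewrite !ppow_ge0E ?ltW// powRD ?(gt_eqF (addr_gt0 _ _))// powRr1 ?ltW// mulrC.
Qed.

Lemma is_derive_ppow a x : 1 < a -> is_derive x 1 (ppow a) (a * ppow (a - 1) x).
Proof.
move=> a1; have a0 : 0 < a by rewrite (lt_trans _ a1).
have a10 : 0 < a - 1 by rewrite subr_gt0.
have [x0|x0|->] := ltgtP x 0.
- rewrite (ppow_le0 a10 (ltW x0)) mulr0.
  apply: (@near_eq_is_derive _ _ _ (fun=> 0 : R)).
  near=> y; have y0 : y < 0 by near: y; exact: lt_nbhsl.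
  by rewrite ppow_le0// ltW.
-
  apply: (@near_eq_is_derive _ _ _ (fun y : R => y `^ a)).
    near=> y; have y0 : 0 < y by near: y; exact: lt_nbhsr.
    by rewrite ppow_ge0E// ltW.
  by rewrite ppow_ge0E ?ltW//; exact: is_derive1_powR.
- rewrite (ppow_le0 a10 (lexx 0)) mulr0 -[X in is_derive _ _ _ X](ppow_le0 a10 (lexx 0)).
  apply: (is_derive_caratheodory (g := ppow (a - 1))).
    by move=> y; rewrite (ppow_le0 a0 (lexx 0)) !subr0 ppow_mulr// subrK.
  exact: continuous_ppow.
Unshelve. all: by end_near. Qed.

(** The even power |x|^a and, below it, the odd power of the same modulus. As combinations of
    one-sided powers they are differentiable through 0 for a > 1, and each is, up to a factor, the
    derivative of the other with exponent one higher. *)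
Definition epow a x := ppow a x + ppow a (- x).
Definition opow a x := ppow a x - ppow a (- x).

Lemma continuous_epow a : 0 < a -> continuous (epow a).
Proof.
move=> a0 x; apply: cvgD; first exact: continuous_ppow.
apply: (@cvg_comp _ _ _ (fun y => - y) (ppow a) _ (nbhs (- x))); last exact: continuous_ppow.
by apply: cvgN; exact: cvg_id.
Qed.

Lemma continuous_opow a : 0 < a -> continuous (opow a).
Proof.
move=> a0 x; apply: cvgB; first exact: continuous_ppow.
apply: (@cvg_comp _ _ _ (fun y => - y) (ppow a) _ (nbhs (- x))); last exact: continuous_ppow.
by apply: cvgN; exact: cvg_id.
Qed.

Lemma is_derive_ppowN a x : 1 < a ->
  is_derive x 1 (fun y => ppow a (- y)) (- (a * ppow (a - 1) (- x))).
Proof.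
move=> a1; have h : is_derive x 1 (fun y : R => - y) (- 1).
  by apply: is_derive_eq.
have := @is_derive1_comp _ (ppow a) (fun y : R => - y) x _ _ (is_derive_ppow (- x) a1) h.
by rewrite mulrN1.
Qed.

Lemma is_derive_epow a x : 1 < a -> is_derive x 1 (epow a) (a * opow (a - 1) x).
Proof.
move=> a1; have h1 := is_derive_ppow x a1; have h2 := is_derive_ppowN x a1.
by rewrite /opow mulrBr; exact: is_deriveD.
Qed.

Lemma is_derive_opow a x : 1 < a -> is_derive x 1 (opow a) (a * epow (a - 1) x).
Proof.
move=> a1; have h1 := is_derive_ppow x a1; have h2 := is_derive_ppowN x a1.
by rewrite /epow mulrDr -[X in _ + X]opprK; exact: is_deriveB.
Qed.

Lemma opowN a x : opow a (- x) = - opow a x.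
Proof. by rewrite /opow opprK opprB. Qed.

Lemma epow_normr a x : 0 < a -> epow a x = `|x| `^ a.
Proof.
move=> a0; have [x0|x0] := leP 0 x.
  by rewrite /epow ppow_ge0E// ppow_le0 ?oppr_le0// addr0 ger0_norm.
by rewrite /epow ppow_le0 ?ltW// ppow_ge0E ?oppr_ge0 ?ltW// add0r ltr0_norm.
Qed.

Lemma flux_opow p c e x : 2 < p -> 0 <= c -> 0 < e ->
  flux p (c * opow e x) = c `^ (p - 1) * opow (e * (p - 1)) x.
Proof.
move=> p2 c0 e0.
have p1 : 0 < p - 1 by rewrite subr_gt0 (lt_trans _ p2)// ltr1n.
have H y : 0 <= y -> flux p (c * opow e y) = c `^ (p - 1) * opow (e * (p - 1)) y.
  move=> y0; have ny : - y <= 0 by rewrite oppr_le0.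
  rewrite /opow !(ppow_le0 _ ny)// ?mulr_gt0// !subr0 !ppow_ge0E//.
  rewrite flux_ge0E ?mulr_ge0 ?powR_ge0// powRM ?powR_ge0// -powRrM//.
have [x0|x0] := leP 0 x; first exact: H.
have := H (- x); rewrite oppr_ge0 (ltW x0) !opowN !mulrN fluxN => /(_ isT).
by move=> /oppr_inj.
Qed.

End positive_powers.

Section classical_profiles.
Context {R : realType}.
Variable p : R.
Hypothesis p2 : 2 < p.

Lemma bounded_box_lty (a b t0 t1 M : R) (q : R * R -> R) :
  measurable_fun [set: R * R] q ->
  (forall x t, a <= x <= b -> t0 <= t <= t1 -> `|q (x, t)| <= M) ->
  (\int[mu]_(t in `[t0, t1]) \int[mu]_(x in `[a, b]) (`|q (x, t)| `^ p)%:E < +oo)%E.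
Proof.
move=> mq qM.
have p0 : 0 <= p by rewrite (le_trans _ (ltW p2)).
have mqp : measurable_fun [set: R * R] (fun z => (`|q z| `^ p)%:E).
  by apply/measurable_EFinP; exact: (measurableT_comp (@measurable_norm_powR R p) mq).
have q0 z : (0 <= (`|q z| `^ p)%:E)%E by rewrite lee_fin powR_ge0.
have mui (c d : R) : exists l : R,
    forall k : R, (\int[mu]_(x in `[c, d]) k%:E = (k * l)%:E)%E.
  exists (if c < d then d - c else 0) => k.
  rewrite integral_cst//= lebesgue_measure_itv/= lte_fin.
  by case: ifP => cd; rewrite -?EFinB -?EFinM// mulr0 mule0.
have [l El] := mui a b; have [m Em] := mui t0 t1.
apply: (@le_lt_trans _ _ (\int[mu]_(t in `[t0, t1]) (`|M| `^ p * l)%:E)%E); last first.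
  by rewrite Em ltry.
apply: ge0_le_integral => //.
- by move=> t _; apply: integral_ge0 => x _; exact: q0.
- apply: measurable_funTS.
  exact: (measurable_integral_slice (measurable_itv `[a, b]) mqp q0).
- move=> t; rewrite /= in_itv/= => tI.
  rewrite -El; apply: ge0_le_integral => //.
  + by apply: measurable_funTS; exact: (measurable_slice2 t mqp).
  + move=> x; rewrite /= in_itv/= => xI; rewrite lee_fin ler_powR_base//.
    exact: (le_trans (qM _ _ xI tI) (ler_norm _)).
Qed.

Lemma space_profile_C1 (a b T0 T1 : R) (u q : R * R -> R) : a < b ->
  continuous u -> measurable_fun [set: R * R] u -> measurable_fun [set: R * R] q ->
  (forall x t, a <= x <= b -> T0 < t <= T1 -> is_derive x 1 (fun y => u (y, t)) (q (x, t))) ->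
  (forall t, T0 < t <= T1 -> continuous (fun x => q (x, t))) ->
  (exists M, forall x t, a <= x <= b -> T0 < t <= T1 -> `|q (x, t)| <= M) ->
  space_profile p a b T0 T1 u q.
Proof.
move=> ab cu m_u mq du cq [M qM]; split => //.
- apply: aeW => t tT; apply: ac_on_is_derive_in.
    by move=> x xab; exact: du.
  by apply: continuous_subspaceT; exact: cq.
- move=> t0 t00; apply: (@bounded_box_lty _ _ _ _ M) => // x t xI /andP[t0t tT].
  by apply: qM => //; rewrite tT andbT (lt_le_trans t00).
Qed.

Lemma flux_primitive_C1 (a b t0 t1 : R) (q : R * R -> R) (H D : R -> R) : a < b ->
  (forall x, a <= x <= b -> is_derive x 1 H (D x)) -> continuous D ->
  (forall x, a < x < b -> \int[mu]_(s in `[t0, t1]) flux p (q (x, s)) = H x) ->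
  flux_primitive p a b t0 t1 q D.
Proof.
move=> ab dH cD Hq.
have [iD HD] : ac_on a b H D.
  by apply: ac_on_is_derive_in => //; exact: continuous_subspaceT.
split=> //; exists (H a); apply: aeW => x xab; rewrite Hq// HD//.
by case/andP: xab => *; rewrite !ltW.
Qed.

Lemma fluxM (c q : R) : 0 <= c -> flux p (c * q) = c `^ (p - 1) * flux p q.
Proof.
move=> c0; rewrite /flux normrM (ger0_norm c0) powRM//.
have [->|cn] := eqVneq c 0.
  by rewrite !mul0r mulr0 powR0 ?mul0r// gt_eqF// subr_gt0 (lt_trans _ p2)// ltr1n.
rewrite [in RHS](_ : p - 1 = (p - 2) + 1); last by ring.
rewrite [in RHS]powRD ?powRr1//; first by ring.
by rewrite cn implybT.
Qed.

Section separated.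
Variables (a b T0 T1 kappa : R) (psi psi1 g theta : R -> R).
Hypotheses (ab : a < b) (dpsi : forall x : R, is_derive x 1 psi (psi1 x)).
Hypotheses (cpsi1 : continuous psi1).
Hypotheses (dflux : forall x : R, is_derive x 1 (fun y => flux p (psi1 y)) (g x)).
Hypotheses (cg : continuous g) (ctheta : continuous theta).
Hypotheses (theta0 : forall t, 0 <= theta t).
Hypothesis dtheta : forall t, T0 < t <= T1 ->
  is_derive t 1 theta (kappa * theta t `^ (p - 1)).

Let u (z : R * R) := psi z.1 * theta z.2.
Let q (z : R * R) := theta z.2 * psi1 z.1.

Let mf (f : R -> R) : continuous f -> measurable_fun [set: R * R] (fun z => f z.1).
Proof.
by move=> c; exact: (measurableT_comp (continuous_measurable_fun c) measurable_fst).
Qed.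

Let ms (f : R -> R) : continuous f -> measurable_fun [set: R * R] (fun z => f z.2).
Proof.
by move=> c; exact: (measurableT_comp (continuous_measurable_fun c) measurable_snd).
Qed.

Let cpsi : continuous psi := continuous_is_derive dpsi.

Let profile : space_profile p a b T0 T1 u q.
Proof.
apply: space_profile_C1 => //.
- by move=> z; apply: cvgM; [exact: continuous_fst_fun|exact: continuous_snd_fun].
- by apply: measurable_funM; [exact: mf|exact: ms].
- by apply: measurable_funM; [exact: ms|exact: mf].
- move=> x t _ _; rewrite /u /q/=.
  have := is_deriveM (dpsi x) (is_derive_cst (theta t) x 1).
  by rewrite /GRing.scale/= mulr0 add0r.
- move=> t _ x; apply: (@cvgM _ _ (nbhs x) _ (fun=> theta t) psi1); last exact: cpsi1.
  exact: cvg_cst.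
- have [M1 M10 H1] := continuous_bounded_itv a b cpsi1; have [M2 M20 H2] := continuous_bounded_itv T0 T1 ctheta.
  exists (M2 * M1) => x t xI /andP[t0 t1]; rewrite normrM ler_pM//; last exact: H1.
  by apply: H2; rewrite ltW.
Qed.

Let tau t0 t1 := \int[mu]_(s in `[t0, t1]) (theta s `^ (p - 1)).

Let cth : continuous (fun s => theta s `^ (p - 1)).
Proof.
have p1 : 0 < p - 1 by rewrite subr_gt0 (lt_trans _ p2)// ltr1n.
move=> s; apply: (@cvg_trans _ ((fun s => `|theta s| `^ (p - 1)) @ s)).
  by apply: near_eq_cvg; apply: nearW => r; rewrite ger0_norm.
rewrite -[X in X `^ _](ger0_norm (theta0 s)).
apply: (@cvg_comp _ _ _ theta (fun y => `|y| `^ (p - 1)) _ (nbhs (theta s))); first exact: ctheta.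
exact: continuous_powR.
Qed.

Let tau0 t0 t1 : 0 <= tau t0 t1.
Proof. by apply: Rintegral_ge0 => s _; exact: powR_ge0. Qed.

Let tauE t0 t1 : T0 < t0 -> t0 < t1 -> t1 <= T1 ->
  theta t1 - theta t0 = kappa * tau t0 t1.
Proof.
move=> h0 h1 h2; rewrite /tau -RintegralZl//; last exact: continuous_integrable_itv.
apply/esym; apply: Rintegral_is_derive_in; first exact: ltW.
- move=> t /andP[tt0 tt1]; apply: dtheta.
  by rewrite (lt_le_trans h0)//= (le_trans tt1).
- apply: continuous_subspaceT => s; apply: cvgM; [exact: cvg_cst|exact: cth].
Qed.

Let primitive t0 t1 : flux_primitive p a b t0 t1 q (fun x => tau t0 t1 * g x).
Proof.
apply: (@flux_primitive_C1 _ _ _ _ _ (fun x => tau t0 t1 * flux p (psi1 x)) _ ab).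
- by move=> x; apply: cvgM; [exact: cvg_cst|exact: cg].
- move=> x _; rewrite /tau -RintegralZr//; last exact: continuous_integrable_itv.
  by apply: eq_Rintegral => s _; rewrite /q/= fluxM.
Qed.

(** The flux is homogeneous of degree p - 1, and theta' = kappa theta^(p-1). Both sides of the
    equation thus carry the same time factor, whose integral is [tau], and only a condition on the
    profile [psi] remains. *)
Lemma separated_supersolution : (forall x, a <= x <= b -> g x <= kappa * psi x) ->
  supersolution p a b T0 T1 u q.
Proof.
move=> H; split => // t0 t1 h0 h1 h2; exists (fun x => tau t0 t1 * g x); first exact: primitive.
move=> x xI; rewrite /u/= -mulrBr tauE// mulrCA mulrA mulrC; apply: ler_wpM2r => //.
exact: H.
Qed.

Lemma separated_subsolution : (forall x, a <= x <= b -> kappa * psi x <= g x) ->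
  subsolution p a b T0 T1 u q.
Proof.
move=> H; split => // t0 t1 h0 h1 h2; exists (fun x => tau t0 t1 * g x); first exact: primitive.
move=> x xI; rewrite /u/= -mulrBr tauE// mulrCA mulrA [leRHS]mulrC; apply: ler_wpM2r => //.
exact: H.
Qed.

End separated.

End classical_profiles.

Section barriers.
Context {R : realType}.
Variable p : R.
Hypothesis p2 : 2 < p.

(* Time is clamped to [0, T] so that the barriers are continuous on the whole plane. *)
Definition growth_factor (lam T t : R) : R :=
  (1 - lam * Num.min (Num.max t 0) T) `^ (1 / (2 - p)).

Section growth_factor_theory.
Variables lam T : R.
Hypotheses (lam0 : 0 <= lam) (T0 : 0 < T) (lamT : lam * T < 1).

Let base_gt0 t : 0 < 1 - lam * Num.min (Num.max t 0) T.
Proof.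
rewrite subr_gt0; apply: le_lt_trans lamT; rewrite ler_wpM2l// ge_min lexx orbT //.
Qed.

Lemma growth_factor_ge0 t : 0 <= growth_factor lam T t.
Proof. exact: powR_ge0. Qed.

Lemma growth_factorE t : 0 <= t <= T ->
  growth_factor lam T t = (1 - lam * t) `^ (1 / (2 - p)).
Proof. by move=> /andP[t0 tT]; rewrite /growth_factor max_l// min_l. Qed.

Lemma growth_factor_ge1 t : 1 <= growth_factor lam T t.
Proof.
rewrite /growth_factor -[leLHS](powRr0 (1 - lam * Num.min (Num.max t 0) T)).
apply: ger_powR.
  rewrite base_gt0/= gerBl mulr_ge0// le_min (ltW T0) andbT.
  by rewrite le_max lexx orbT.
by rewrite mul1r invr_le0 subr_le0 ltW.
Qed.

Lemma continuous_growth_factor : continuous (growth_factor lam T).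
Proof.
move=> t; have b0 := base_gt0 t.
apply: (@cvg_comp _ _ _ (fun t => 1 - lam * Num.min (Num.max t 0) T)
  (fun y => y `^ (1 / (2 - p))) _ (nbhs (1 - lam * Num.min (Num.max t 0) T))).
  apply: cvgB; first exact: cvg_cst.
  apply: cvgM; first exact: cvg_cst.
  have minE (c : R) : Num.min c T = c - Num.max (c - T) 0.
    by have [cT|Tc] := leP c T; [rewrite max_r ?subr0// subr_le0|
      rewrite max_l ?subKr// subr_ge0 ltW].
  rewrite minE (_ : (fun x : R => Num.min (Num.max x 0) T) =
    fun x => Num.max x 0 - Num.max (Num.max x 0 - T) 0); last by apply/funext => x.
  have cp : Num.max x 0 @[x --> t] --> Num.max t 0 by exact: continuous_pos.
  by apply: cvgB => //; apply: cvg_pos; apply: cvgB => //; exact: cvg_cst.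
set y0 := 1 - _.
suff : {for y0, continuous (fun y : R => y `^ (1 / (2 - p)))} by [].
apply: differentiable_continuous; apply/derivable1_diffP.
by apply: derivable_powR; rewrite in_itv/= andbT.
Qed.

(** The exponent 1 / (2 - p) makes the derivative a multiple of the (p-1)-th power. The ends 0 and T
    are left out because the clamped time has corners there. *)
Lemma is_derive_growth_factor t : 0 < t < T ->
  is_derive t 1 (growth_factor lam T)
    (lam / (p - 2) * growth_factor lam T t `^ (p - 1)).
Proof.
move=> /andP[t0 tT].
have tI : 0 <= t <= T by rewrite !ltW.
apply: (@near_eq_is_derive _ _ _ (fun t : R => (1 - lam * t) `^ (1 / (2 - p)))).
  near=> s; rewrite growth_factorE//.
  have s0 : 0 < s by near: s; exact: lt_nbhsr.
  have sT : s < T by near: s; exact: lt_nbhsl.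
  by rewrite !ltW.
have b0 : 0 < 1 - lam * t.
  by have := base_gt0 t; rewrite max_l ?ltW// min_l ?ltW.
have h1 : is_derive t 1 (fun t : R => 1 - lam * t) (- lam).
  apply: (is_derive_caratheodory (g := fun=> - lam)); last exact: cvg_cst.
  by move=> x; ring.
have := @is_derive1_comp _ (fun y => y `^ (1 / (2 - p))) (fun t : R => 1 - lam * t) t _ _
  (is_derive1_powR _ b0) h1.
congr is_derive; rewrite growth_factorE// -powRrM.
have p20 : p - 2 != 0 by rewrite subr_eq0 gt_eqF.
have p20' : 2 - p != 0 by rewrite subr_eq0 lt_eqF.
have -> : 1 / (2 - p) * (p - 1) = 1 / (2 - p) - 1 by field.
rewrite mulrAC; congr (_ * _); field.
by rewrite p20.
Unshelve. all: by end_near. Qed.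

End growth_factor_theory.

Section power_profile.
Variables (A alpha y : R).
Hypotheses (A0 : 0 <= A) (alpha1 : 1 < alpha) (sigma0 : 0 <= alpha * (p - 2) - p).
(** The flux of the slope of |x - y|^alpha has a derivative of degree (alpha - 1)(p - 1) - 1, which
    exceeds alpha by this number. It is 0 exactly when alpha = p / (p - 2). *)
Local Notation sigma := (alpha * (p - 2) - p).
Local Notation b := (alpha + sigma + 1).

Let psi x := A * epow alpha (x - y).
Let psi1 x := (A * alpha) * opow (alpha - 1) (x - y).
Let cst := (A * alpha) `^ (p - 1) * b.
Let g x := cst * epow (alpha + sigma) (x - y).

Let as0 : 0 < alpha + sigma.
Proof. by have := alpha1; have := sigma0; lra. Qed.

Let shift (f : R -> R) (l x : R) : is_derive (x - y) 1 f l ->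
  is_derive x 1 (fun x => f (x - y)) l.
Proof.
move=> h; have h1 : is_derive x 1 (fun x : R => x - y) 1.
  by apply: is_derive_eq; rewrite subr0.
by have := @is_derive1_comp _ f (fun x : R => x - y) x _ _ h h1; rewrite mulr1.
Qed.

Let cshift (f : R -> R) : continuous f -> continuous (fun x => f (x - y)).
Proof.
move=> c x; apply: (@cvg_comp _ _ _ (fun x => x - y) f _ (nbhs (x - y))); last exact: c.
by apply: cvgB; [exact: cvg_id|exact: cvg_cst].
Qed.

Let dscale (f : R -> R) (c l x : R) : is_derive x 1 f l ->
  is_derive x 1 (fun x => c * f x) (c * l).
Proof.
move=> h; have := is_deriveM (is_derive_cst c x 1) h.
by rewrite /GRing.scale/= mulr0 addr0.
Qed.

Let dpsi (x : R) : is_derive x 1 psi (psi1 x).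
Proof.
rewrite /psi1 -mulrA; apply: dscale; apply: (shift (f := epow alpha)).
exact: is_derive_epow.
Qed.

Let cpsi1 : continuous psi1.
Proof.
move=> x; apply: cvgM; first exact: cvg_cst.
by apply: (cshift (f := opow (alpha - 1))); apply: continuous_opow; rewrite subr_gt0.
Qed.

Let dflux (x : R) : is_derive x 1 (fun x => flux p (psi1 x)) (g x).
Proof.
have -> : (fun x => flux p (psi1 x)) =
    (fun x => (A * alpha) `^ (p - 1) * opow b (x - y)).
  apply/funext => z; rewrite /psi1 flux_opow//.
  - by congr (_ * opow _ _); ring.
  - by rewrite mulr_ge0// (le_trans _ (ltW alpha1)).
  - by rewrite subr_gt0.
rewrite /g /cst -mulrA; apply: dscale; apply: (shift (f := opow b)).
rewrite -[X in epow X _](addrK 1); apply: is_derive_opow.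
by have := as0; lra.
Qed.

Let cg : continuous g.
Proof.
move=> x; apply: cvgM; first exact: cvg_cst.
by apply: (cshift (f := epow (alpha + sigma))); exact: continuous_epow.
Qed.

Let q (theta : R -> R) (z : R * R) := theta z.2 * psi1 z.1.

(** After division by |x - y|^alpha the condition on the profile reads cst |x - y|^sigma <= lam A /
    (p - 2). It is met by a large [lam] when sigma = 0 and by a small [rho] when sigma > 0. [T1 < T]
    keeps the times inside the clamp. *)
Lemma power_supersolution (l r T1 T lam rho : R) : l < r -> 0 <= lam -> 0 < T ->
  lam * T < 1 -> T1 < T ->
  (forall x, l <= x <= r -> `|x - y| <= rho) ->
  cst * rho `^ sigma <= lam / (p - 2) * A ->
  supersolution p l r 0 T1
    (fun z => A * epow alpha (z.1 - y) * growth_factor lam T z.2)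
    (q (growth_factor lam T)).
Proof.
move=> lr lam0 T0 lamT T1T xr H.
apply: (@separated_supersolution _ _ p2 l r 0 T1 (lam / (p - 2)) psi psi1 g
   (growth_factor lam T)) => //.
- exact: continuous_growth_factor.
- by move=> t; exact: growth_factor_ge0.
- by move=> t /andP[t0 tT1]; apply: is_derive_growth_factor => //; rewrite t0 (le_lt_trans tT1).
- move=> x /xr xrho; rewrite /g /psi !epow_normr//; last by rewrite (lt_trans _ alpha1).
  rewrite powRD; last by rewrite gt_eqF.
  rewrite mulrCA [leRHS]mulrA [leRHS]mulrC; apply: ler_wpM2l; first exact: powR_ge0.
  apply: le_trans H; apply: ler_wpM2l.
    rewrite /cst mulr_ge0 ?powR_ge0//; have := as0; lra.
  exact: ler_powR_base.
Qed.

(** The separated form with kappa = 0 and constant time factor, which explains the final [* 1]; the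
    flux of the slope is nondecreasing in x. *)
Lemma power_subsolution (l r T1 : R) : l < r ->
  subsolution p l r 0 T1 (fun z => A * epow alpha (z.1 - y) * 1) (q (fun=> 1)).
Proof.
move=> lr.
apply: (@separated_subsolution _ _ p2 l r 0 T1 0 psi psi1 g (fun=> 1)) => //.
- by move=> x; exact: cvg_cst.
- by move=> t _; rewrite mul0r; exact: is_derive_cst.
- move=> x _; rewrite mul0r /g mulr_ge0//; last by rewrite addr_ge0// ppow_ge0.
  by rewrite /cst mulr_ge0 ?powR_ge0//; have := as0; lra.
Qed.

End power_profile.

End barriers.

(** * The Barenblatt solution *)

Section barenblatt.
Context {R : realType}.
Variable p : R.
Hypothesis p2 : 2 < p.

(** The exponents of the one-dimensional self-similar solution t^(-k) f(x t^(-k)) with f(y) = (c0 -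
    c1 |y|^r)_+^m. The same k scales height and width, which conserves the mass. *)
Definition bar_time_exp : R := (2 * (p - 1))^-1.
Definition bar_space_exp : R := p / (p - 1).
Definition bar_height_exp : R := (p - 1) / (p - 2).
Local Notation k := bar_time_exp.
Local Notation r := bar_space_exp.
Local Notation m := bar_height_exp.
(* The value for which the flux of the profile f is - k y f(y); see [flux_bar_slope]. *)
Definition bar_curvature : R := k `^ (p - 1)^-1 / (m * r).
Local Notation c1 := bar_curvature.

Lemma bar_time_exp_gt0 : 0 < k.
Proof. by rewrite /bar_time_exp invr_gt0; have := p2; lra. Qed.
Lemma bar_space_exp_gt1 : 1 < r.
Proof. by rewrite /bar_space_exp ltr_pdivlMr; have := p2; lra. Qed.
Lemma bar_height_exp_gt1 : 1 < m.
Proof. by rewrite /bar_height_exp ltr_pdivlMr; have := p2; lra. Qed.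
Let p10 : 0 < p - 1. Proof. by have := p2; lra. Qed.
Let p20 : 0 < p - 2. Proof. by have := p2; lra. Qed.
Let r0 : 0 < r. Proof. exact: lt_trans bar_space_exp_gt1. Qed.
Let m0 : 0 < m. Proof. exact: lt_trans bar_height_exp_gt1. Qed.
Lemma bar_curvature_gt0 : 0 < c1.
Proof.
by apply: divr_gt0; [apply: powR_gt0; exact: bar_time_exp_gt0|exact: mulr_gt0].
Qed.

Definition bar_profile (c0 y : R) : R := ppow m (c0 - c1 * epow r y).
Definition bar_slope (c0 y : R) : R :=
  m * ppow (m - 1) (c0 - c1 * epow r y) * - (c1 * (r * opow (r - 1) y)).

Section profile.
Variable c0 : R.
Local Notation f := (bar_profile c0).
Local Notation f1 := (bar_slope c0).

Let dW (y : R) : is_derive y 1 (fun y => c0 - c1 * epow r y) (- (c1 * (r * opow (r - 1) y))).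
Proof.
have h := is_derive_epow y bar_space_exp_gt1.
have h1 := is_deriveM (is_derive_cst c1 y 1) h.
have := is_deriveB (is_derive_cst c0 y 1) h1.
by rewrite /GRing.scale/= mulr0 addr0 sub0r.
Qed.

Lemma is_derive_bar_profile (y : R) : is_derive y 1 f (f1 y).
Proof.
exact: (@is_derive1_comp _ (ppow m) (fun y => c0 - c1 * epow r y) y _ _
  (is_derive_ppow _ bar_height_exp_gt1) (dW y)).
Qed.

Lemma continuous_bar_profile : continuous f.
Proof. exact: continuous_is_derive is_derive_bar_profile. Qed.

Lemma continuous_bar_slope : continuous f1.
Proof.
have m1 : 0 < m - 1 by rewrite subr_gt0 bar_height_exp_gt1.
have r1 : 0 < r - 1 by rewrite subr_gt0 bar_space_exp_gt1.
have cW := continuous_is_derive dW.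
move=> y; apply: cvgM.
  apply: cvgM; first exact: cvg_cst.
  apply: (@cvg_comp _ _ _ (fun y => c0 - c1 * epow r y) (ppow (m - 1)) _
    (nbhs (c0 - c1 * epow r y))); first exact: cW.
  exact: continuous_ppow.
apply: cvgN; apply: cvgM; first exact: cvg_cst.
apply: cvgM; first exact: cvg_cst.
exact: continuous_opow.
Qed.

(** The profile equation, integrated once. It is what fixes the exponents and the curvature: (r -
    1)(p - 1) = 1, (m - 1)(p - 1) = m and (m c1 r)^(p-1) = k. *)
Lemma flux_bar_slope y : flux p (f1 y) = - (k * (y * f y)).
Proof.
set W := c0 - c1 * epow r y.
have -> : f1 y = - ((m * c1 * r * ppow (m - 1) W) * opow (r - 1) y).
  by rewrite /bar_slope -/W; ring.
have c10 := bar_curvature_gt0.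
have P0 := @ppow_ge0 _ (m - 1) W.
have r1 : 0 < r - 1 by rewrite subr_gt0 bar_space_exp_gt1.
have mcr : 0 <= m * c1 * r by apply/ltW/mulr_gt0 => //; exact: mulr_gt0.
rewrite fluxN flux_opow//; last exact: mulr_ge0.
congr (- _).
have p1n : p - 1 != 0 by rewrite gt_eqF.
have p2n : p - 2 != 0 by rewrite gt_eqF.
have -> : (r - 1) * (p - 1) = 1 by rewrite /bar_space_exp; field.
have -> : opow 1 y = y.
  rewrite /opow; have [y0|y0] := leP 0 y.
    by rewrite (ppow_le0 _ (_ : - y <= 0)) ?oppr_le0// subr0 ppow_ge0E// powRr1.
  by rewrite (ppow_le0 _ (ltW y0))// ppow_ge0E ?oppr_ge0 ?ltW// powRr1 ?oppr_ge0 ?ltW// sub0r opprK.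
rewrite powRM// /ppow -powRrM.
have -> : (m - 1) * (p - 1) = m by rewrite /bar_height_exp; field.
have -> : (m * c1 * r) `^ (p - 1) = k.
  have -> : m * c1 * r = k `^ (p - 1)^-1.
    by rewrite /bar_curvature; field; rewrite !gt_eqF.
  by rewrite -powRrM mulVf// powRr1// ltW// bar_time_exp_gt0.
by rewrite /bar_profile -/W -/(ppow m W); ring.
Qed.

End profile.

Section solution.
Variables (a b T0 T1 s0 c0 y : R).
Hypotheses (ab : a < b) (s00 : 0 < s0).
Local Notation f := (bar_profile c0).
Local Notation f1 := (bar_slope c0).

(** The singular initial time lies [s0] before [T0]; the clamp keeps the age positive at all times,
    hence the solution continuous on the plane. *)
Definition bar_age (T0 s0 t : R) : R := s0 + Num.max (t - T0) 0.
Definition bar_scale (T0 s0 t : R) : R := bar_age T0 s0 t `^ (- k).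
Local Notation age := (bar_age T0 s0).
Local Notation S := (bar_scale T0 s0).

Definition barenblatt (T0 s0 c0 y : R) (z : R * R) : R :=
  bar_scale T0 s0 z.2 * bar_profile c0 ((z.1 - y) * bar_scale T0 s0 z.2).
Definition barenblatt_slope (T0 s0 c0 y : R) (z : R * R) : R :=
  bar_scale T0 s0 z.2 ^+ 2 * bar_slope c0 ((z.1 - y) * bar_scale T0 s0 z.2).

Let age_gt0 t : 0 < age t.
Proof. by rewrite ltr_pwDl// le_max lexx orbT. Qed.

Lemma bar_scale_gt0 t : 0 < S t.
Proof. by rewrite powR_gt0. Qed.

Let cS : continuous S.
Proof.
move=> t; apply: (@cvg_comp _ _ _ age (fun x => x `^ (- k)) _ (nbhs (age t))).
  apply: cvgD; first exact: cvg_cst.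
  by apply: cvg_pos; apply: cvgB; [exact: cvg_id|exact: cvg_cst].
suff : {for age t, continuous (fun y : R => y `^ (- k))} by [].
apply: differentiable_continuous; apply/derivable1_diffP.
by apply: derivable_powR; rewrite in_itv/= age_gt0.
Qed.

Let dS (t : R) : T0 < t -> is_derive t 1 S (- k * S t / age t).
Proof.
move=> t0.
apply: (@near_eq_is_derive _ _ _ (fun t : R => (s0 + (t - T0)) `^ (- k))).
  near=> s; have s0' : T0 < s by near: s; exact: lt_nbhsr.
  by rewrite /bar_scale /bar_age max_l// subr_ge0 ltW.
have ageE : age t = s0 + (t - T0) by rewrite /bar_age max_l// subr_ge0 ltW.
have h1 : is_derive t 1 (fun t : R => s0 + (t - T0)) 1.
  apply: (is_derive_caratheodory (g := fun=> 1)); last exact: cvg_cst.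
  by move=> x; ring.
have a0 := age_gt0 t; rewrite ageE in a0.
have := @is_derive1_comp _ (fun y => y `^ (- k)) (fun t : R => s0 + (t - T0)) t _ _
  (is_derive1_powR _ a0) h1.
rewrite mulr1 /bar_scale ageE; congr is_derive.
rewrite -mulrA; congr (_ * _).
by rewrite powRD ?powR_inv1 ?(ltW a0)// (gt_eqF a0) implybT.
Unshelve. all: by end_near. Qed.

Let S_le t : S t <= s0 `^ (- k).
Proof.
rewrite /bar_scale !powRN lef_pV2 ?posrE ?powR_gt0//.
apply: ler_powR_base; [exact: ltW bar_time_exp_gt0|exact: ltW|].
by rewrite lerDl le_max lexx orbT.
Qed.

Let mS : measurable_fun [set: R * R] (fun z => S z.2).
Proof. exact: (measurableT_comp (continuous_measurable_fun cS) measurable_snd). Qed.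

Let mY : measurable_fun [set: R * R] (fun z => (z.1 - y) * S z.2).
Proof.
by apply: measurable_funM => //; apply: measurable_funB => //; exact: measurable_fst.
Qed.

Let cS2 : continuous (fun z : R * R => S z.2) := continuous_snd_fun cS.

Let cY : continuous (fun z : R * R => (z.1 - y) * S z.2).
Proof.
move=> [x t]; apply: cvgM; last exact: cS2.
apply: cvgB; last exact: cvg_cst.
exact: (@cvg_fst _ _ (nbhs x) (nbhs t)).
Qed.

Let dYx (t x : R) : is_derive x 1 (fun x => (x - y) * S t) (S t).
Proof.
apply: (is_derive_caratheodory (g := fun=> S t)); last exact: cvg_cst.
by move=> z; ring.
Qed.

Let Y := (`|a| + `|b| + `|y|) * s0 `^ (- k).

Let Ybound x t : a <= x <= b -> `|(x - y) * S t| <= Y.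
Proof.
move=> /andP[ax xb]; rewrite normrM (ger0_norm (ltW (bar_scale_gt0 t))) /Y.
apply: ler_pM => //; first exact: ltW (bar_scale_gt0 t).
have := ler_norm b; have := ler_norm (- a); have := ler_norm y; have := ler_norm (- y).
rewrite !normrN => h1 h2 h3 h4; have := normr_ge0 a; have := normr_ge0 b => h5 h6.
by rewrite ler_norml; apply/andP; split; lra.
Qed.

(** With a primitive [n] of the profile, the mass function n((x - y) S(t)) has x-derivative u and,
    by [flux_bar_slope], t-derivative F(u_x). The integrated flux is therefore an increment of this
    function in t. *)
Lemma barenblatt_solution :
  solution p a b T0 T1 (barenblatt T0 s0 c0 y) (barenblatt_slope T0 s0 c0 y).
Proof.
have cu : continuous (barenblatt T0 s0 c0 y).
  move=> z; apply: cvgM; first exact: cS2.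
  apply: (@cvg_comp _ _ _ (fun z : R * R => (z.1 - y) * S z.2) f _
    (nbhs ((z.1 - y) * S z.2))); first exact: cY.
  exact: continuous_bar_profile.
have profile : space_profile p a b T0 T1 (barenblatt T0 s0 c0 y) (barenblatt_slope T0 s0 c0 y).
  apply: space_profile_C1 => //.
  - apply: measurable_funM => //.
    exact: (measurableT_comp (continuous_measurable_fun (@continuous_bar_profile c0)) mY).
  - apply: measurable_funM; first exact: measurable_funX.
    exact: (measurableT_comp (continuous_measurable_fun (@continuous_bar_slope c0)) mY).
  - move=> x t _ _; rewrite /barenblatt /barenblatt_slope/=.
    have h := @is_derive1_comp _ f (fun x => (x - y) * S t) x _ _
      (is_derive_bar_profile c0 _) (dYx t x).
    have := is_deriveM (is_derive_cst (S t) x 1) h.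
    by congr is_derive; rewrite /GRing.scale/=; ring.
  - move=> t _ x; apply: (@cvgM _ _ (nbhs x) _ (fun=> S t ^+ 2)
      (fun x => f1 ((x - y) * S t))); first exact: cvg_cst.
    apply: (@cvg_comp _ _ _ (fun x => (x - y) * S t) f1 _ (nbhs ((x - y) * S t))).
      exact: continuous_is_derive (dYx t) x.
    exact: continuous_bar_slope.
  - have [M M0 HM] := continuous_bounded_itv (- Y) Y (@continuous_bar_slope c0).
    exists ((s0 `^ (- k)) ^+ 2 * M) => x t xI _.
    rewrite normrM; apply: ler_pM => //; last by apply: HM; rewrite -ler_norml; exact: Ybound.
    rewrite ger0_norm ?sqr_ge0// lerXn2r ?nnegrE ?powR_ge0 ?S_le//.
split => // t0 t1 t00 t01 t11.
pose n x := \int[mu]_(s in `[- Y - 1, x]) f s.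
have dn (x : R) : `|x| <= Y -> is_derive x 1 n (f x).
  rewrite ler_norml => /andP[h1 h2].
  apply: (@is_derive_primitive _ f (- Y - 1) (Y + 1)); last by lra.
    exact: continuous_bar_profile.
  lra.
have dH (t x : R) : a <= x <= b -> is_derive x 1 (fun x => n ((x - y) * S t)) (barenblatt T0 s0 c0 y (x, t)).
  move=> xI.
  have := @is_derive1_comp _ n (fun x => (x - y) * S t) x _ _
    (dn _ (Ybound t xI)) (dYx t x).
  by rewrite mulrC.
pose H x := n ((x - y) * S t1) - n ((x - y) * S t0).
pose D x := barenblatt T0 s0 c0 y (x, t1) - barenblatt T0 s0 c0 y (x, t0).
have dHD (x : R) : a <= x <= b -> is_derive x 1 H (D x).
  by move=> xI; exact: (is_deriveB (dH t1 x xI) (dH t0 x xI)).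
have cut t : continuous (fun x => barenblatt T0 s0 c0 y (x, t)).
  exact: continuous_slice2.
have cD : continuous D by move=> x; apply: cvgB; exact: cut.
suff HI x : a < x < b ->
    \int[mu]_(s in `[t0, t1]) flux p (barenblatt_slope T0 s0 c0 y (x, s)) = H x.
  exact: (flux_primitive_C1 ab dHD cD HI).
move=> /andP[ax xb].
have xI : a <= x <= b by rewrite !ltW.
have dN (s : R) : t0 <= s <= t1 -> is_derive s 1 (fun s => n ((x - y) * S s))
    (flux p (barenblatt_slope T0 s0 c0 y (x, s))).
  move=> /andP[s1 _]; have Ts : T0 < s by exact: lt_le_trans s1.
  have h1 : is_derive s 1 (fun s => (x - y) * S s) ((x - y) * (- k * S s / age s)).
    have := is_deriveM (is_derive_cst (x - y) s 1) (dS Ts).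
    by rewrite /GRing.scale/= mulr0 addr0.
  have h2 := @is_derive1_comp _ n (fun s => (x - y) * S s) s _ _ (dn _ (Ybound s xI)) h1.
  have E : flux p (barenblatt_slope T0 s0 c0 y (x, s)) =
      f ((x - y) * S s) * ((x - y) * (- k * S s / age s)).
    rewrite /barenblatt_slope/= fluxM// ?sqr_ge0// flux_bar_slope.
    have -> : (S s ^+ 2) `^ (p - 1) = (age s)^-1.
      rewrite -powR_mulrn ?powR_ge0// -!powRrM -powR_inv1 ?(ltW (age_gt0 s))//.
      by congr (_ `^ _); rewrite /bar_time_exp; field; rewrite gt_eqF.
    by ring.
  by rewrite E; exact: h2.
have cN : continuous (fun s => flux p (barenblatt_slope T0 s0 c0 y (x, s))).
  move=> s.
  apply: (@cvg_comp _ _ _ (fun s => barenblatt_slope T0 s0 c0 y (x, s)) (flux p) _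
    (nbhs (barenblatt_slope T0 s0 c0 y (x, s)))); last exact: continuous_flux.
  rewrite /barenblatt_slope/=; apply: (@cvgM _ _ (nbhs s) _ (fun s => S s ^+ 2)
      (fun s => f1 ((x - y) * S s))).
    by rewrite expr2; under eq_fun do rewrite expr2; apply: (@cvgM _ _ (nbhs s) _ S S); exact: cS.
  apply: (@cvg_comp _ _ _ (fun s => (x - y) * S s) f1 _ (nbhs ((x - y) * S s))).
    by apply: (@cvgM _ _ (nbhs s) _ (fun=> x - y) S); [exact: cvg_cst|exact: cS].
  exact: continuous_bar_slope.
exact: (Rintegral_is_derive_in (ltW t01) dN (continuous_subspaceT cN)).
Qed.

End solution.

End barenblatt.

(** * Reflection *)

Section reflection.
Context {R : realType}.
Variable c : R.

Let phi0 (x : measurableTypeR R) : measurableTypeR R := c - x.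
Let mphi : measurable_fun setT phi0.
Proof. by apply: measurable_funB => //; exact: measurable_cst. Qed.
Let phi_mixin := isMeasurableFun.Build _ _ _ _ _ mphi.
Let phi : {mfun measurableTypeR R >-> measurableTypeR R} := HB.pack phi0 phi_mixin.

(** By uniqueness of Lebesgue measure it is enough to treat half-open intervals, which go to
    intervals of the same length. *)
Lemma lebesgue_measure_reflect (A : set R) : measurable A ->
  pushforward mu phi A = mu A.
Proof.
move=> mA; apply/esym/lebesgue_measure_unique => //= _ [[a b]] _ <-.
have -> : pushforward mu phi `]a, b]%classic = mu `[c - b, c - a[%classic.
  rewrite /pushforward; congr (mu _); apply/seteqP; split => x /=; rewrite !in_itv/= /phi0.
    by move=> /andP[h1 h2]; apply/andP; split; lra.
  by move=> /andP[h1 h2]; apply/andP; split; lra.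
rewrite !lebesgue_measure_itv/= !lte_fin ltrD2l ltrN2.
by case: ifP => // _; rewrite -!EFinB; congr EFin; ring.
Qed.

Lemma ae_reflect (P : R -> Prop) : {ae mu, forall x, P x} -> {ae mu, forall x, P (c - x)}.
Proof.
move=> [A [mA A0 PA]]; exists (phi @^-1` A); split.
- by rewrite -[X in measurable X]setTI; exact: mphi.
- by have := lebesgue_measure_reflect mA; rewrite A0.
- by move=> x /= nP; apply: PA.
Qed.

Lemma ge0_integral_reflect (f : R -> \bar R) (a b : R) : measurable_fun [set: R] f ->
  (forall x, 0 <= f x)%E ->
  (\int[mu]_(x in `[a, b]) f (c - x)%R = \int[mu]_(x in `[(c - b)%R, (c - a)%R]) f x)%E.
Proof.
move=> mf f0; rewrite (_ : `[a, b]%classic = phi @^-1` `[c - b, c - a]%classic); last first.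
  apply/seteqP; split => x /=; rewrite !in_itv/= /phi0.
    by move=> /andP[h1 h2]; apply/andP; split; lra.
  by move=> /andP[h1 h2]; apply/andP; split; lra.
rewrite -(@ge0_integral_pushforward _ _ _ _ R phi mphi mu `[c - b, c - a]%classic f)//.
- by apply: eq_measure_integral => //= A mA AS; exact: lebesgue_measure_reflect.
- exact: measurable_funTS.
Qed.

Lemma integral_reflect (f : R -> \bar R) (a b : R) : measurable_fun [set: R] f ->
  (\int[mu]_(x in `[a, b]) f (c - x)%R = \int[mu]_(x in `[(c - b)%R, (c - a)%R]) f x)%E.
Proof.
move=> mf; rewrite integralE [RHS]integralE.
have E1 := ge0_integral_reflect a b (measurable_funepos mf) (funepos_ge0 f).
have E2 := ge0_integral_reflect a b (measurable_funeneg mf) (funeneg_ge0 f).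
have P1 (g : R -> \bar R) (x : R) : ((fun y : R => g (c - y)%R)^\+ x = g^\+ (c - x)%R)%E.
  by rewrite !funeposE.
have P2 (g : R -> \bar R) (x : R) : ((fun y : R => g (c - y)%R)^\- x = g^\- (c - x)%R)%E.
  by rewrite !funenegE.
congr (_ - _)%E; [rewrite -E1|rewrite -E2]; apply: eq_integral => x _; [exact: P1|exact: P2].
Qed.

Lemma Rintegral_reflect (f : R -> R) (a b : R) : measurable_fun [set: R] f ->
  \int[mu]_(x in `[a, b]) f (c - x) = \int[mu]_(x in `[c - b, c - a]) f x.
Proof.
move=> mf; rewrite /Rintegral; congr fine.
by apply: (integral_reflect (f := EFin \o f)); exact/measurable_EFinP.
Qed.

Lemma integrable_reflect (f : R -> R) (a b : R) : measurable_fun [set: R] f ->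
  mu.-integrable `[c - b, c - a] (EFin \o f) ->
  mu.-integrable `[a, b] (EFin \o (fun x => f (c - x))).
Proof.
move=> mf /integrableP[_ foo]; apply/integrableP; split.
  apply/measurable_EFinP; apply: measurable_funTS; exact: (measurableT_comp mf mphi).
rewrite (integral_reflect (f := fun x => `|(f x)%:E|%E))//.
by apply: measurableT_comp => //; exact/measurable_EFinP.
Qed.

Lemma ac_on_reflect (f g : R -> R) (a b : R) : a <= b -> measurable_fun [set: R] g ->
  ac_on (c - b) (c - a) f g -> ac_on a b (fun x => f (c - x)) (fun x => - g (c - x)).
Proof.
move=> ab mg [ig fE].
have ig' := integrable_reflect mg ig.
split.
  rewrite (_ : (fun x => - g (c - x)) = (fun x => -1 * g (c - x))).
    by apply: integrable_mull.
  by apply/funext => x; rewrite mulN1r.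
move=> x /andP[ax xb].
have -> : \int[mu]_(y in `[a, x]) - g (c - y) = - \int[mu]_(y in `[c - x, c - a]) g y.
  rewrite -Rintegral_reflect// -mulN1r -RintegralZl//.
    by apply: eq_Rintegral => y _; rewrite mulN1r.
  by apply: integrable_itvS ig' _ _; rewrite bnd_simp.
have h1 : c - b <= c - x by lra.
have h2 : c - x <= c - a by lra.
have := @ac_on_increment _ _ _ _ _ _ _ (conj ig fE) h1 h2 (lexx _).
rewrite Rintegral_itv_obnd_cbnd//; last first.
  by apply: integrable_itvS ig _ _; rewrite bnd_simp.
by move=> <-; ring.
Qed.

Lemma flux_primitive_reflect (p a b t0 t1 : R) (q : R * R -> R) (D : R -> R) :
  2 < p -> a <= b -> measurable_fun [set: R] D ->
  {ae mu, forall x, c - b < x < c - a ->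
    mu.-integrable `[t0, t1] (EFin \o (fun s => flux p (q (x, s))))} ->
  flux_primitive p (c - b) (c - a) t0 t1 q D ->
  flux_primitive p a b t0 t1 (fun z => - q (c - z.1, z.2)) (fun x => D (c - x)).
Proof.
move=> p2 ab mD iq [iD [k Hk]].
have iD' := integrable_reflect mD iD.
(* The reflected primitive starts at the other end of the interval, so the constant absorbs the
   integral of [D] over the whole interval. *)
split => //; exists (- k - \int[mu]_(y in `[c - b, c - a]) D y).
apply: ae_imply2 (ae_reflect Hk) (ae_reflect iq) => x H I /andP[ax xb].
have cx : c - b < c - x < c - a by apply/andP; split; lra.
have {}H := H cx; have {}I := I cx.
have -> : \int[mu]_(s in `[t0, t1]) flux p (- q (c - x, s)) =
    - \int[mu]_(s in `[t0, t1]) flux p (q (c - x, s)).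
  transitivity (\int[mu]_(s in `[t0, t1]) (-1 * flux p (q (c - x, s)))).
    by apply: eq_Rintegral => s _; rewrite fluxN mulN1r.
  by rewrite RintegralZl// mulN1r.
rewrite H.
have iS : mu.-integrable `[c - b, c - x] (EFin \o D).
  by apply: integrable_itvS iD _ _; rewrite bnd_simp//; lra.
have acD : ac_on (c - b) (c - a) (fun z => \int[mu]_(y in `[c - b, z]) D y) D.
  by split => // z _; rewrite set_itv1 Rintegral_set1 add0r.
have -> : \int[mu]_(y in `[a, x]) D (c - y) = \int[mu]_(y in `[c - x, c - a]) D y.
  exact: Rintegral_reflect.
have h1 : c - b <= c - x by lra.
have h2 : c - x <= c - a by lra.
have := ac_on_increment acD h1 h2 (lexx _).
rewrite Rintegral_itv_obnd_cbnd//; last first.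
  by apply: integrable_itvS iD _ _; rewrite bnd_simp.
by move=> <-; ring.
Qed.

End reflection.

Lemma solution_reflect (R : realType) (c p a b T0 T1 : R) (u q : R * R -> R) :
  2 < p -> a <= b ->
  solution p (c - b) (c - a) T0 T1 u q ->
  solution p a b T0 T1 (fun z => u (c - z.1, z.2)) (fun z => - q (c - z.1, z.2)).
Proof.
move=> p2 ab [sp fp]; have [cu m_u mq ac qoo] := sp.
have mcx : measurable_fun [set: R * R] (fun z : R * R => (c - z.1, z.2)).
  apply: measurable_fun_pair; last exact: measurable_snd.
  by apply: measurable_funB => //; exact: measurable_fst.
split.
  split.
  - have ccx : continuous (fun z : R * R => (c - z.1, z.2)).
      move=> [x t]; apply: (@cvg_pair _ _ _ _ (nbhs (c - x)) (nbhs t)).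
        by apply: cvgB; [exact: cvg_cst|exact: (@cvg_fst _ _ (nbhs x) (nbhs t))].
      exact: (@cvg_snd _ _ (nbhs x) (nbhs t)).
    move=> z; apply: (@cvg_comp _ _ _ (fun z : R * R => (c - z.1, z.2)) u _
      (nbhs (c - z.1, z.2))); [exact: ccx|exact: cu].
  - exact: (measurableT_comp m_u mcx).
  - by apply: measurableT_comp => //; exact: (measurableT_comp mq mcx).
  - apply: ae_imply ac => t H tT.
    apply: (@ac_on_reflect _ _ (fun x => u (x, t)) (fun x => q (x, t))) => //.
      exact: (measurable_rslice2 t mq).
    exact: H.
  - move=> t0 t00; apply: le_lt_trans (qoo t0 t00).
    rewrite le_eqVlt; apply/orP; left; apply/eqP; apply: eq_integral => t _.
    under eq_integral do rewrite normrN.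
    apply: (@ge0_integral_reflect _ c (fun x => (`|q (x, t)| `^ p)%:E)).
      apply/measurable_EFinP.
      exact: (measurableT_comp (@measurable_norm_powR R p) (measurable_rslice2 t mq)).
    by move=> x; rewrite lee_fin powR_ge0.
move=> t0 t1 t00 t01 t11.
apply: (@flux_primitive_reflect _ c p a b t0 t1 q (fun x => u (x, t1) - u (x, t0))) => //.
- by apply: measurable_funB; exact: measurable_rslice2.
- have := ae_flux_integrable p2 mq (integral_profile_le sp t00 t11).
  by apply: ae_imply => x H /andP[h1 h2]; apply: H; rewrite /= in_itv/= !ltW.
- exact: fp.
Qed.

(** * The Cauchy problem *)

Section application.
Context {R : realType}.
Variables (p : R) (u0 : R -> R) (v q : R * R -> R).
Hypothesis p2 : 2 < p.
Hypothesis vsol : forall a b T : R, a < b -> 0 < T -> solution p a b 0 T v q.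
Hypotheses (v_ge0 : forall z, 0 <= v z) (v_init : forall x, v (x, 0) = u0 x).
Hypothesis u0_right : forall x, 0 <= x -> u0 x = 0.
Variables (c xl : R).
Hypotheses (c_gt0 : 0 < c) (xl_lt0 : xl < 0).
Local Notation beta := (p / (p - 2)).
Hypothesis u0_left : forall x, xl <= x <= 0 -> u0 x <= c * `|x| `^ beta.

Let p20 : 0 < p - 2. Proof. by rewrite subr_gt0. Qed.
Let beta1 : 1 < beta. Proof. by rewrite ltr_pdivlMr//; have := p2; lra. Qed.
Let beta0 : 0 < beta. Proof. exact: lt_trans beta1. Qed.
Let sigma0 : beta * (p - 2) - p = 0.
Proof. by field; rewrite gt_eqF. Qed.

Let cv : continuous v.
Proof. by have [[]] := vsol (@ltr01 R) (@ltr01 R). Qed.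

(** For the exponent beta the radius drops out of the supersolution condition, so the life span [d]
    depends on [A] alone and not on y, l or r. The barrier vanishes at its centre y and pins v to 0
    there. *)
Lemma zero_barrier A : 0 < A -> exists2 d : R, 0 < d &
  forall l r y tau, l < r -> l <= y <= r -> 0 < tau -> tau <= d ->
    (forall x, l <= x <= r -> u0 x <= A * `|x - y| `^ beta) ->
    (forall t, 0 <= t <= tau -> v (l, t) <= A * `|l - y| `^ beta) ->
    (forall t, 0 <= t <= tau -> v (r, t) <= A * `|r - y| `^ beta) ->
  forall t, 0 <= t <= tau -> v (y, t) = 0.
Proof.
move=> A0.
have s0 : 0 <= beta * (p - 2) - p by rewrite sigma0.
pose cst := (A * beta) `^ (p - 1) * (beta + (beta * (p - 2) - p) + 1).
have cst0 : 0 <= cst by rewrite mulr_ge0 ?powR_ge0// sigma0 addr0 addr_ge0// ltW.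
(* This turns the condition of [power_supersolution] into an equality. *)
pose lam := cst * (p - 2) / A.
have lam0 : 0 <= lam.
  by apply: divr_ge0; [apply: mulr_ge0 => //; exact: ltW|exact: ltW].
have l1 : 0 < lam + 1 by rewrite ltr_wpDl.
pose T := (2 * (lam + 1))^-1.
have T0 : 0 < T by rewrite invr_gt0 mulr_gt0.
have lamT : lam * T < 1 by rewrite /T ltr_pdivrMr ?mulr_gt0//; lra.
exists (T / 2) => [|l r y tau lr yI tau0 tauT Hi Hl Hr t tI]; first exact: divr_gt0.
have tT : tau < T by lra.
pose rho := `|l - y| + `|r - y|.
have rhoP x : l <= x <= r -> `|x - y| <= rho.
  move=> /andP[lx xr]; rewrite /rho ler_norml.
  have := ler_norm (r - y); have := ler_norm (- (l - y)); rewrite normrN => h1 h2.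
  by have := normr_ge0 (l - y); have := normr_ge0 (r - y) => h3 h4; apply/andP; split; lra.
have cstE : cst * rho `^ (beta * (p - 2) - p) <= lam / (p - 2) * A.
  rewrite sigma0 powRr0 mulr1 /lam le_eqVlt; apply/orP; left; apply/eqP.
  by field; rewrite !gt_eqF.
have sup := power_supersolution p2 (ltW A0) beta1 s0 lr lam0 T0 lamT tT rhoP cstE.
have sub := solution_sub (vsol lr tau0).
have th1 := growth_factor_ge1 p2 lam0 T0 lamT.
have up x s : v (x, s) <= A * `|x - y| `^ beta ->
    v (x, s) <= A * epow beta (x - y) * growth_factor p lam T s.
  move=> h; rewrite epow_normr//; apply: le_trans h _.
  by apply: ler_peMr => //; rewrite mulr_ge0 ?powR_ge0 ?ltW.
have bl s : 0 <= s <= tau -> v (l, s) <= A * epow beta (l - y) * growth_factor p lam T s.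
  by move=> sI; apply: up; exact: Hl.
have br s : 0 <= s <= tau -> v (r, s) <= A * epow beta (r - y) * growth_factor p lam T s.
  by move=> sI; apply: up; exact: Hr.
have ini x : l <= x <= r -> v (x, 0) <= A * epow beta (x - y) * growth_factor p lam T 0.
  by move=> xI; apply: up; rewrite v_init; exact: Hi.
have := comparison_principle p2 lr sub sup bl br ini yI tI.
rewrite /= subrr epow_normr// normr0 powR0 ?gt_eqF// mulr0 mul0r => h.
by apply/eqP; rewrite eq_le h v_ge0.
Qed.

Let time_bound x : exists2 M, 0 < M & forall t, 0 <= t <= 1 -> v (x, t) <= M.
Proof.
have cx : continuous (fun t => v (x, t)).
  exact: continuous_slice1.
have [M M0 HM] := continuous_bounded_itv 0 1 cx.
by exists M => // t /HM; apply: le_trans; exact: ler_norm.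
Qed.

Let u0_le A x y : c <= A -> xl <= x -> 0 <= y -> u0 x <= A * `|x - y| `^ beta.
Proof.
move=> cA xlx y0; have A0 : 0 <= A by rewrite (le_trans _ cA)// ltW.
have [x0|x0] := leP 0 x; first by rewrite u0_right// mulr_ge0 ?powR_ge0.
apply: (@le_trans _ _ (c * `|x| `^ beta)); first by apply: u0_left; rewrite xlx ltW.
apply: ler_pM => //; first exact: ltW.
apply: ler_powR_base => //; first exact: ltW.
by rewrite !ltr0_norm//; lra.
Qed.

(** Barriers on [xl, 1] centred at y in [0, 1/2]. The ends are at distance at least |xl| and 1/2
    from y, so one [A] dominates the bounds of v there for all these y. *)
Lemma local_zero : exists2 d : R, 0 < d <= 1 &
  forall x t, 0 <= x <= 1 / 2 -> 0 <= t <= d -> v (x, t) = 0.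
Proof.
have [M1 M10 H1] := time_bound xl; have [M2 M20 H2] := time_bound 1.
have X0 : 0 < `|xl| `^ beta by rewrite powR_gt0// normr_gt0 lt_eqF.
have Y0 : 0 < (1 / 2 : R) `^ beta by rewrite powR_gt0// divr_gt0.
pose A := c + M1 / `|xl| `^ beta + M2 / (1 / 2) `^ beta.
have hM1 : 0 <= M1 / `|xl| `^ beta by rewrite divr_ge0 ?ltW.
have hM2 : 0 <= M2 / (1 / 2) `^ beta by rewrite divr_ge0 ?ltW.
have c0 := c_gt0; have cA : c <= A by rewrite /A; lra.
have A0 : 0 < A by rewrite (lt_le_trans c_gt0).
have [d d0 Hd] := zero_barrier A0.
exists (Num.min d 1) => [|y t /andP[y0 y1] tI].
  by rewrite lt_min d0 ltr01/= ge_min lexx orbT.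
have m0 : 0 < Num.min d 1 by rewrite lt_min d0 ltr01.
have md : Num.min d 1 <= d by rewrite ge_min lexx.
have xl0 := xl_lt0; have lr : xl < 1 by lra.
have yI : xl <= y <= 1 by apply/andP; split; lra.
have le1 s : 0 <= s <= Num.min d 1 -> 0 <= s <= 1.
  by move=> /andP[-> /le_trans]; apply; rewrite ge_min lexx orbT.
apply: (Hd xl 1 y _ lr yI m0 md) => //.
- by move=> x /andP[xx _]; exact: u0_le.
- move=> s /le1/H1 h; apply: (le_trans h).
  apply: (@le_trans _ _ (M1 / `|xl| `^ beta * `|xl| `^ beta)); first by rewrite divfK// gt_eqF.
  apply: ler_pM => //; first by rewrite /A; lra.
  apply: ler_powR_base => //; first exact: ltW.
  by rewrite !ltr0_norm//; lra.
- move=> s /le1/H2 h; apply: (le_trans h).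
  apply: (@le_trans _ _ (M2 / (1 / 2) `^ beta * (1 / 2) `^ beta)); first by rewrite divfK// gt_eqF.
  apply: ler_pM => //; first by rewrite /A; lra.
  apply: ler_powR_base; [exact: ltW|by rewrite divr_ge0|].
  by rewrite ger0_norm; lra.
Qed.

Lemma solution_later a b T0 T0' T1 w r : T0 <= T0' ->
  solution p a b T0 T1 w r -> solution p a b T0' T1 w r.
Proof.
move=> T00 [[cw m_w mr ac roo] fp]; split; first split => //.
- apply: ae_imply ac => t H /andP[t0 t1]; apply: H.
  by rewrite t1 andbT (le_lt_trans T00).
- by move=> t0 t00; apply: roo; exact: le_lt_trans t00.
- by move=> t0 t1 t00; apply: fp; exact: le_lt_trans t00.
Qed.

Section propagation.
Variable d0 : R.
Hypothesis d0_gt0 : 0 < d0.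
Hypothesis v_zero : forall x t, 0 <= x <= 1 / 2 -> 0 <= t <= d0 -> v (x, t) = 0.

(* The solution is compared with its reflection in the midpoint of [x, y]. *)
Lemma monotone_on_right x y t : 0 <= x <= y -> 0 <= t <= d0 -> v (x, t) <= v (y, t).
Proof.
move=> /andP[x0]; rewrite le_eqVlt => /orP[/eqP->//|xy] tI.
pose m := (x + y) / 2; have m0 : 0 < m by rewrite divr_gt0//; lra.
have cm : (x + y) - m = m by rewrite /m; field.
have cm' : (x + y) - m < (x + y) - 0 by rewrite subr0 cm; lra.
have sol2 := solution_reflect p2 (ltW m0) (vsol cm' d0_gt0).
have z0 s : 0 <= s <= d0 -> v (0, s) = 0.
  by move=> sI; apply: v_zero => //; rewrite lexx divr_ge0.
(* At 0 the solution vanishes and lies below its nonnegative reflection; at the midpoint the two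
   coincide. *)
have bl s : 0 <= s <= d0 -> v (0, s) <= v (x + y - 0, s).
  by move=> /z0 ->.
have br s : 0 <= s <= d0 -> v (m, s) <= v (x + y - m, s).
  by rewrite cm.
have ini z : 0 <= z <= m -> v (z, 0) <= v (x + y - z, 0).
  by move=> /andP[z_0 _]; rewrite v_init u0_right.
have xI : 0 <= x <= m by rewrite x0 /m; lra.
have := comparison_principle p2 m0 (solution_sub (vsol m0 d0_gt0)) (solution_super sol2)
  bl br ini xI tI.
by rewrite /= addrC addKr.
Qed.

Local Notation k := (bar_time_exp p).
Local Notation br_ := (bar_space_exp p).
Local Notation bm := (bar_height_exp p).
Local Notation c1 := (bar_curvature p).

(* A Barenblatt solution centred at 2L needs a time independent of L to spread from
   radius L to radius 2L; its initial height is a multiple of L^beta. *)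
Lemma growth_on_right : exists2 K : R, 0 < K &
  forall L t, 0 <= L -> 0 <= t <= d0 / 2 -> v (L, t) <= K * L `^ beta.
Proof.
have k0 : 0 < k := bar_time_exp_gt0 p2.
have c10 : 0 < c1 := bar_curvature_gt0 p2.
have r0 : 0 < br_ := lt_trans ltr01 (bar_space_exp_gt1 p2).
have m0 : 0 < bm := lt_trans ltr01 (bar_height_exp_gt1 p2).
have two1 : 1 < (2 : R) `^ k^-1.
  have : (1 : R) `^ k^-1 < 2 `^ k^-1.
    have ki : 0 < k^-1 by rewrite invr_gt0.
    have n1 : (1 : R) \in Num.nneg by rewrite nnegrE.
    have n2 : (2 : R) \in Num.nneg by rewrite nnegrE.
    by apply: (gt0_ltr_powR ki n1 n2); rewrite ltr1n.
  by rewrite powR1.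
pose delta := d0 / 2; have de0 : 0 < delta by rewrite divr_gt0.
(* The initial age for which the scale t^(-k) is halved, and the radius doubled, after exactly the
   time [delta]. *)
pose s0 := delta / (2 `^ k^-1 - 1).
have s00 : 0 < s0 by rewrite divr_gt0// subr_gt0.
have s0E : s0 + delta = s0 * 2 `^ k^-1.
  by rewrite /s0; field; rewrite subr_eq0 gt_eqF.
pose S0 := s0 `^ (- k); have S00 : 0 < S0 by rewrite powR_gt0.
have rmE : br_ * bm = beta.
  by rewrite /bar_space_exp /bar_height_exp; field; apply/andP; split; rewrite gt_eqF//; have := p2; lra.
(* This times L^beta is the maximal height S0 c0^m of the Barenblatt solution below at the time
   [t0], because r m = beta. *)
exists (S0 * (c1 `^ bm * S0 `^ beta)); first by rewrite !mulr_gt0// powR_gt0.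
move=> L t0 L0 /andP[t00 t0d]; rewrite leNgt; apply/negP => big.
have [Lh|hL] := leP L (1 / 2).
  move: big; rewrite v_zero ?L0//; last by rewrite t00; lra.
  by rewrite ltNge !mulr_ge0 ?powR_ge0// ltW.
have L1 : 0 < L by lra.
(* Makes the support at the time [t0] the interval of radius L around 2L, that is [L, 3L]. *)
pose c0 := c1 * (L * S0) `^ br_.
pose B := barenblatt p t0 s0 c0 (2 * L).
have LS0 : 0 <= L * S0 by rewrite mulr_ge0 ?ltW.
have fz y : L * S0 <= `|y| -> bar_profile p c0 y = 0.
  move=> yL; rewrite /bar_profile ppow_le0// subr_le0 ler_wpM2l ?(ltW c10)// epow_normr//.
  exact: ler_powR_base (ltW r0) LS0 yL.
have ft y : bar_profile p c0 y <= c0 `^ bm.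
  have e0 : 0 <= epow br_ y by rewrite epow_normr// powR_ge0.
  apply: ler_powR_base; [exact: ltW|by rewrite le_max lexx orbT|].
  rewrite ge_max gerBl (mulr_ge0 (ltW c10) e0)/=.
  by apply: mulr_ge0; [exact: ltW|exact: powR_ge0].
have St0 : bar_scale p t0 s0 t0 = S0.
  by rewrite /bar_scale /bar_age subrr maxxx addr0.
have St1 : bar_scale p t0 s0 (t0 + delta) = S0 / 2.
  rewrite /bar_scale /bar_age addrAC subrr add0r max_l ?ltW// s0E powRM ?powR_ge0 ?ltW//.
  rewrite -/S0; congr (_ * _); rewrite -powRrM mulrN mulVf ?gt_eqF//.
  by rewrite powR_inv1.
have Sge t : t <= t0 + delta -> S0 / 2 <= bar_scale p t0 s0 t.
  move=> tt; rewrite -St1 /bar_scale !powRN lef_pV2 ?posrE ?powR_gt0//; last 2 first.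
  - by rewrite ltr_pwDl// le_max lexx orbT.
  - by rewrite ltr_pwDl// le_max lexx orbT.
  apply: ler_powR_base; first exact: ltW.
    by apply: addr_ge0; [exact: ltW|rewrite le_max lexx orbT].
  rewrite /bar_age lerD2l ge_max !le_max lexx orbT andbT; apply/orP; left; lra.
have lr : 0 < 4 * L by rewrite mulr_gt0.
have t1d : 0 < t0 + delta by rewrite ltr_wpDl.
have sub := solution_sub (barenblatt_solution p2 t0 (t0 + delta) c0 (2 * L) lr s00).
have sup := solution_super (solution_later t00 (vsol lr t1d)).
(* The lateral sides 0 and 4L are at distance 2L from the centre, and the support reaches them no
   earlier than [t0 + delta]. *)
have far x t : 2 * L <= `|x - 2 * L| -> t <= t0 + delta -> B (x, t) <= v (x, t).
  move=> xL tt; rewrite /B /barenblatt/= fz ?mulr0//.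
  have Sg := Sge _ tt; have S2 : 0 <= S0 / 2 by rewrite divr_ge0 ?ltW.
  rewrite normrM (ger0_norm (le_trans S2 Sg)).
  apply: (@le_trans _ _ (2 * L * (S0 / 2))); first by rewrite le_eqVlt; apply/orP; left; apply/eqP; field.
  by apply: ler_pM => //; exact: mulr_ge0.
have bl t : t0 <= t <= t0 + delta -> B (0, t) <= v (0, t).
  by move=> /andP[_ tt]; apply: far => //; rewrite sub0r normrN ger0_norm ?mulr_ge0.
have br t : t0 <= t <= t0 + delta -> B (4 * L, t) <= v (4 * L, t).
  move=> /andP[_ tt]; apply: far => //.
  by rewrite (_ : 4 * L - 2 * L = 2 * L); [rewrite ger0_norm ?mulr_ge0|ring].
(* On the initial support x >= L, so by monotonicity v(x, t0) >= v(L, t0), which by assumption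
   exceeds the maximal height. *)
have ini x : 0 <= x <= 4 * L -> B (x, t0) <= v (x, t0).
  move=> /andP[x_0 x4]; rewrite /B /barenblatt/= St0.
  have [xL|xL] := leP L `|x - 2 * L|.
    by rewrite fz ?mulr0// normrM (ger0_norm (ltW S00)) ler_wpM2r ?(ltW S00).
  have Lx : L <= x.
    by move: xL; rewrite ltr_norml => /andP[h1 _]; lra.
  have t0I : 0 <= t0 <= d0 by rewrite t00; lra.
  have Lxx : 0 <= L <= x by rewrite L0.
  apply: le_trans (monotone_on_right Lxx t0I); apply: le_trans (ltW big).
  rewrite -mulrA ler_wpM2l ?(ltW S00)//; apply: le_trans (ft _) _.
  rewrite /c0 (@powRM _ c1 _ bm (ltW c10) (powR_ge0 _ _)) -powRrM rmE.
  by rewrite (powRM beta L0 (ltW S00)) [L `^ _ * _]mulrC mulrA.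
(* The point 1/4 is at distance less than 2L from the centre, so the Barenblatt solution is positive
   there at [t0 + delta], a time up to which v is known to vanish there. *)
have xI : 0 <= (1 / 4 : R) <= 4 * L by apply/andP; split; lra.
have tI : t0 <= t0 + delta <= t0 + delta by rewrite lexx andbT lerDl ltW.
have := comparison_principle p2 lr sub sup bl br ini xI tI.
rewrite v_zero; last 2 first.
- by apply/andP; split; lra.
- by apply/andP; split; [exact: ltW|rewrite /delta; lra].
apply/negP; rewrite -ltNge /B /barenblatt/= St1.
set Y := (1 / 4 - 2 * L) * (S0 / 2).
have YL : `|Y| < L * S0.
  have S2 : 0 <= S0 / 2 by rewrite divr_ge0 ?ltW.
  rewrite /Y normrM (ger0_norm S2).
  have -> : L * S0 = 2 * L * (S0 / 2) by field.
  rewrite ltr_pM2r ?divr_gt0// ltr0_norm; lra.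
have W0 : 0 < c0 - c1 * epow br_ Y.
  rewrite subr_gt0 /c0 ltr_pM2l// epow_normr//.
  by apply: gt0_ltr_powR; rewrite ?nnegrE.
apply: mulr_gt0; first exact: divr_gt0.
by rewrite /bar_profile ppow_ge0E ?powR_gt0// ltW.
Qed.

(** Barriers on [xl, 2y + 1]. The right end is at distance y + 1 from y, and (2y + 1)^beta <= 2^beta
    (y + 1)^beta; the growth bound is thus dominated with a constant [A], and hence a time,
    independent of y. *)
Lemma zero_on_right : exists2 d : R, 0 < d &
  forall y t, 0 <= y -> 0 <= t <= d -> v (y, t) = 0.
Proof.
have [K K0 HK] := growth_on_right.
have [M1 M10 H1] := time_bound xl.
have X0 : 0 < `|xl| `^ beta by rewrite powR_gt0// normr_gt0 lt_eqF.
have Y0 : 0 < (2 : R) `^ beta by rewrite powR_gt0.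
pose A := c + M1 / `|xl| `^ beta + K * 2 `^ beta.
have hM1 : 0 <= M1 / `|xl| `^ beta by rewrite divr_ge0 ?ltW.
have hK : 0 <= K * 2 `^ beta by rewrite mulr_ge0 ?ltW.
have c0 := c_gt0; have cA : c <= A by rewrite /A; lra.
have A0 : 0 < A by rewrite (lt_le_trans c_gt0).
have [d d_0 Hd] := zero_barrier A0.
pose tau := Num.min d (Num.min (d0 / 2) 1).
have tau0 : 0 < tau by rewrite !lt_min d_0 divr_gt0//=.
have tau_d : tau <= d by rewrite ge_min lexx.
have tau_d0 : tau <= d0 / 2 by rewrite !ge_min lexx orbT.
have tau_1 : tau <= 1 by rewrite !ge_min lexx !orbT.
exists tau => // y t y0 tI.
have xl0 := xl_lt0; have lr : xl < 2 * y + 1 by lra.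
have yI : xl <= y <= 2 * y + 1 by apply/andP; split; lra.
apply: (Hd xl (2 * y + 1) y tau lr yI tau0 tau_d) => //.
- by move=> x /andP[xx _]; exact: u0_le.
- move=> s /andP[s0 s1]; have := H1 s; rewrite s0 (le_trans s1)// => /(_ isT) h.
  apply: (le_trans h).
  apply: (@le_trans _ _ (M1 / `|xl| `^ beta * `|xl| `^ beta)); first by rewrite divfK// gt_eqF.
  apply: ler_pM => //; first by rewrite /A; lra.
  apply: ler_powR_base => //; first exact: ltW.
  by rewrite !ltr0_norm//; lra.
- move=> s /andP[s0 s1]; have z0 : 0 <= 2 * y + 1 by lra.
  have sI : 0 <= s <= d0 / 2 by rewrite s0 (le_trans s1).
  apply: (le_trans (HK _ _ z0 sI)).
  have y1 : 0 <= y + 1 by lra.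
  apply: (@le_trans _ _ (K * 2 `^ beta * (y + 1) `^ beta)).
    rewrite -mulrA ler_wpM2l ?(ltW K0)// -powRM//.
    by apply: ler_powR_base => //; [exact: ltW|lra].
  rewrite (_ : 2 * y + 1 - y = y + 1); last by ring.
  rewrite (ger0_norm y1) ler_wpM2r ?powR_ge0//; rewrite /A; lra.
Qed.

End propagation.

End application.

(** * Initial data near 0 and the two-sided estimate on the left *)

Lemma positivity_sup0_right (R : realType) (f : R -> R) :
  (forall x, 0 <= f x) -> continuous f -> positivity_sup f = 0%E ->
  forall x, 0 <= x -> f x = 0.
Proof.
move=> f0 cf Hs.
have pos x : 0 < x -> f x = 0.
  move=> x0; apply/eqP; rewrite eq_le f0 andbT leNgt; apply/negP => fx.
  have : (x%:E <= positivity_sup f)%E by apply: ereal_sup_ubound; exists x.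
  by rewrite Hs lee_fin leNgt x0.
move=> x; rewrite le_eqVlt => /orP[/eqP <-|]; last exact: pos.
apply/eqP; rewrite eq_le f0 andbT leNgt; apply/negP => fx.
have /cvgr_gt/(_ _ fx) := cf 0.
move=> [d /= d0 Hd].
have d2 : 0 < d / 2 by rewrite divr_gt0.
have : 0 < f (d / 2).
  by apply: Hd => /=; rewrite sub0r normrN gtr0_norm//; lra.
by rewrite pos// ltxx.
Qed.

Lemma left_asymptotics (R : realType) (alpha C : R) (f : R -> R) :
  0 < alpha -> 0 < C -> f 0 = 0 ->
  f x / (C * (- x) `^ alpha) @[x --> 0^'-] --> (1 : R) ->
  forall e, 0 < e -> exists2 d : R, 0 < d &
    forall x, - d < x <= 0 ->
      (C - e) * `|x| `^ alpha <= f x /\ f x <= (C + e) * `|x| `^ alpha.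
Proof.
move=> a0 C0 f0 H e e0.
have eC : 0 < e / C by rewrite divr_gt0.
have [d /= d0 Hd] : \forall x \near 0^'-, `|1 - f x / (C * (- x) `^ alpha)| <= e / C.
  by move/cvgrPdist_le : H => /(_ _ eC).
exists d => // x /andP[dx]; rewrite le_eqVlt => /orP[/eqP->|x0].
  by rewrite f0 normr0 powR0 ?gt_eqF// !mulr0.
have xd : `|0 - x| < d by rewrite sub0r normrN ltr0_norm//; lra.
have := Hd x xd x0.
have X0 : 0 < (- x) `^ alpha by rewrite powR_gt0// oppr_gt0.
rewrite (ltr0_norm x0); set X := (- x) `^ alpha in X0 *.
have CX : 0 < C * X by rewrite mulr_gt0.
rewrite ler_distlC => /andP[h1 h2].
move: h1 h2; rewrite ler_pdivlMr// ler_pdivrMr// => h1 h2.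
have E1 : (1 - e / C) * (C * X) = (C - e) * X by field; rewrite gt_eqF.
have E2 : (1 + e / C) * (C * X) = (C + e) * X by field; rewrite gt_eqF.
by rewrite -E1 -E2.
Qed.

Section left_estimate.
Context {R : realType}.
Variables (p alpha C : R) (u0 : R -> R) (v q : R * R -> R).
Hypotheses (p2 : 2 < p) (alphaP : p / (p - 2) < alpha) (C0 : 0 < C).
Hypothesis vsol : forall a b T : R, a < b -> 0 < T -> solution p a b 0 T v q.
Hypotheses (v_ge0 : forall z, 0 <= v z) (v_init : forall x, v (x, 0) = u0 x).
Hypothesis u0_asym : forall e, 0 < e -> exists2 d : R, 0 < d &
    forall x, - d < x <= 0 ->
      (C - e) * `|x| `^ alpha <= u0 x /\ u0 x <= (C + e) * `|x| `^ alpha.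
Variable d1 : R.
Hypotheses (d1_gt0 : 0 < d1) (v_zero : forall t, 0 <= t <= d1 -> v (0, t) = 0).

(** Comparison on [- rho, 0] with powers centred at 0. Since alpha > beta, the excess exponent is
    positive, and a small [rho] makes the growth rate [eps] sufficient for a supersolution. *)
Lemma left_estimate eps : 0 < eps -> exists xe d : R, [/\ xe < 0, 0 < d, d <= d1 &
  forall x t, xe <= x <= 0 -> 0 <= t <= d ->
    (C - eps) * `|x| `^ alpha <= v (x, t) /\
    v (x, t) <= (C + eps) * `|x| `^ alpha * (1 - eps * t) `^ (1 / (2 - p))].
Proof.
move=> e0; have p20 : 0 < p - 2 by have := p2; lra.
have p_gt2 := p2; have C_0 := C0.
have a1 : 1 < alpha by apply: lt_trans alphaP; rewrite ltr_pdivlMr//; lra.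
have a0 : 0 < alpha by lra.
have s0 : 0 < alpha * (p - 2) - p.
  by rewrite subr_gt0 -ltr_pdivrMr.
(* Half of [eps] makes both inequalities strict at x = - rho and t = 0; they then persist for a
   short time by continuity. *)
have e20 : 0 < eps / 2 by rewrite divr_gt0.
have [d d0 Hd] := u0_asym e20.
pose A := C + eps; have A0 : 0 < A by rewrite addr_gt0.
pose cst := (A * alpha) `^ (p - 1) * (alpha + (alpha * (p - 2) - p) + 1).
have cst0 : 0 < cst.
  by rewrite mulr_gt0 ?powR_gt0 ?mulr_gt0//; lra.
pose M := eps / (p - 2) * A / cst.
have M0 : 0 < M by rewrite divr_gt0// mulr_gt0// divr_gt0.
(* The second entry is the radius at which the supersolution condition with [lam := eps] becomes an
   equality. *)
pose rho := Num.min (d / 2) (M `^ (alpha * (p - 2) - p)^-1).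
have rho0 : 0 < rho by rewrite lt_min divr_gt0//= powR_gt0.
have rho_d : rho < d by rewrite gt_min; apply/orP; left; lra.
have rhoM : cst * rho `^ (alpha * (p - 2) - p) <= eps / (p - 2) * A.
  rewrite mulrC -ler_pdivlMr// -/M.
  have -> : M = (M `^ (alpha * (p - 2) - p)^-1) `^ (alpha * (p - 2) - p).
    by rewrite -powRrM mulVf ?gt_eqF// powRr1// ltW.
  by apply: ler_powR_base; rewrite ?(ltW s0) ?(ltW rho0)// ge_min lexx orbT.
have lr : - rho < 0 by rewrite oppr_lt0.
pose X := `|- rho| `^ alpha.
have X0 : 0 < X by rewrite powR_gt0// normr_gt0 lt_eqF.
have rI : - d < - rho <= 0 by rewrite ltrN2 rho_d oppr_le0 ltW.
have [l1 l2] := Hd _ rI.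
have L1 : (C - eps) * X < v (- rho, 0).
  by rewrite v_init; apply: lt_le_trans l1; rewrite ltr_pM2r//; lra.
have L2 : v (- rho, 0) < A * X.
  by rewrite v_init; apply: le_lt_trans l2 _; rewrite /A ltr_pM2r//; lra.
have cv : continuous v by have [[]] := vsol (@ltr01 R) (@ltr01 R).
have cx : continuous (fun t => v (- rho, t)).
  exact: continuous_slice1.
have /cvgr_gt/(_ _ L1) [g1 /= g10 G1] := cx 0.
have /cvgr_lt/(_ _ L2) [g2 /= g20 G2] := cx 0.
pose T := (2 * eps)^-1; have T0 : 0 < T by rewrite invr_gt0 mulr_gt0.
have eT : eps * T < 1 by rewrite /T ltr_pdivrMr ?mulr_gt0//; lra.
pose tau := Num.min (Num.min d1 (T / 2)) (Num.min (g1 / 2) (g2 / 2)).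
have tau0 : 0 < tau by rewrite !lt_min d1_gt0 !divr_gt0.
have tau_d1 : tau <= d1 by rewrite !ge_min lexx.
have tau_T : tau < T by rewrite !gt_min; apply/orP; left; apply/orP; right; lra.
have tau_g1 : tau < g1 by rewrite !gt_min; apply/orP; right; apply/orP; left; lra.
have tau_g2 : tau < g2 by rewrite !gt_min; apply/orP; right; apply/orP; right; lra.
exists (- rho), tau; split => // x t xI tI.
have sol := vsol lr tau0.
have gl s : 0 <= s <= tau -> (C - eps) * X <= v (- rho, s) /\ v (- rho, s) <= A * X.
  move=> /andP[s_0 s1]; split; apply: ltW.
    by apply: G1 => /=; rewrite sub0r normrN ger0_norm// (le_lt_trans s1).
  by apply: G2 => /=; rewrite sub0r normrN ger0_norm// (le_lt_trans s1).
have z0 s : 0 <= s <= tau -> v (0, s) = 0.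
  by move=> /andP[s_0 s1]; apply: v_zero; rewrite s_0 (le_trans s1).
have ini y : - rho <= y <= 0 -> - d < y <= 0.
  by move=> /andP[h1 ->]; rewrite andbT (lt_le_trans _ h1)// ltrN2.
split.
(* A negative coefficient leaves nothing to compare, since v >= 0. *)
- have [Ce|Ce] := leP 0 (C - eps); last first.
    apply: le_trans (v_ge0 _); rewrite mulr_le0_ge0 ?powR_ge0//; exact: ltW.
  have sub := power_subsolution p2 0 Ce a1 (ltW s0) tau lr.
  have bl s : 0 <= s <= tau -> (C - eps) * epow alpha (- rho - 0) * 1 <= v (- rho, s).
    by move=> /gl[h _]; rewrite subr0 mulr1 epow_normr.
  have br s : 0 <= s <= tau -> (C - eps) * epow alpha (0 - 0) * 1 <= v (0, s).
    by move=> /z0 ->; rewrite subr0 mulr1 epow_normr// normr0 powR0 ?gt_eqF// mulr0.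
  have ii y : - rho <= y <= 0 -> (C - eps) * epow alpha (y - 0) * 1 <= v (y, 0).
    move=> /ini/Hd[h _]; rewrite subr0 mulr1 epow_normr// v_init; apply: le_trans h.
    by apply: ler_wpM2r; [exact: powR_ge0|lra].
  have := comparison_principle p2 lr sub (solution_super sol) bl br ii xI tI.
  by rewrite /= subr0 mulr1 epow_normr.
- have rhoP y : - rho <= y <= 0 -> `|y - 0| <= rho.
    by move=> /andP[h1 h2]; rewrite subr0 ler_norml h1/= (le_trans h2)// ltW.
  have sup := power_supersolution p2 (ltW A0) a1 (ltW s0) lr (ltW e0) T0 eT tau_T rhoP rhoM.
  have th1 := growth_factor_ge1 p2 (ltW e0) T0 eT.
  have up y s : v (y, s) <= A * `|y| `^ alpha ->
      v (y, s) <= A * epow alpha (y - 0) * growth_factor p eps T s.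
    move=> h; rewrite subr0 epow_normr//; apply: le_trans h _.
    by apply: ler_peMr => //; rewrite mulr_ge0 ?powR_ge0// ltW.
  have bl s : 0 <= s <= tau ->
      v (- rho, s) <= A * epow alpha (- rho - 0) * growth_factor p eps T s.
    by move=> /gl[_ h]; exact: up.
  have br s : 0 <= s <= tau ->
      v (0, s) <= A * epow alpha (0 - 0) * growth_factor p eps T s.
    by move=> /z0 h; apply: up; rewrite h mulr_ge0 ?powR_ge0// ltW.
  have ii y : - rho <= y <= 0 -> v (y, 0) <= A * epow alpha (y - 0) * growth_factor p eps T 0.
    move=> /ini/Hd[_ h]; apply: up; rewrite v_init; apply: le_trans h _.
    by apply: ler_wpM2r; [exact: powR_ge0|rewrite /A; lra].
  have := comparison_principle p2 lr (solution_sub sol) sup bl br ii xI tI.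
  rewrite /= subr0 epow_normr// growth_factorE//.
  by have /andP[-> h] := tI; rewrite (le_trans h)// ltW.
Qed.

End left_estimate.

Theorem mainTheorem11 (R : realType) (p alpha C : R)
    (u0 : R -> R) (u : R * R -> R) :
  2 < p -> p / (p - 2) < alpha -> 0 < C ->
  (forall x, 0 <= u0 x) -> continuous u0 ->
  growth_condition p u0 ->
  positivity_sup u0 = 0%E ->
  u0 x / (C * (- x) `^ alpha) @[x --> 0^'-] --> (1 : R) ->
  cauchy_solution p +oo%E u0 u ->
  initially_stationary u /\
  forall eps : R, 0 < eps ->
    exists xeps delta : R, [/\ xeps < 0, 0 < delta &
      forall x t : R, xeps <= x -> 0 <= t -> t <= delta ->
        (C - eps) * (Num.max (- x) 0) `^ alpha <= u (x, t) /\
        u (x, t) <= (C + eps) * (Num.max (- x) 0) `^ alpha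
                      * (1 - eps * t) `^ (1 / (2 - p))].
Proof.
move=> p2 alphaP C0 u0_ge0 cu0 _ supu0 ratio Hu.
have p20 : 0 < p - 2 by lra.
have b0 : 0 < p / (p - 2) by apply: divr_gt0 => //; lra.
have a0 : 0 < alpha by exact: lt_trans alphaP.
have [q vsol] := cauchy_solution_on_boxes p2 Hu.
set v := time_clamp u in vsol.
have [[u_ge0 _ _ _] _ u_init] := Hu.
have v_ge0 z : 0 <= v z.
  rewrite /v /time_clamp; have [t0|t0] := leP z.2 0; first by rewrite u_init.
  by apply: u_ge0; split; rewrite //= leey.
have v_init x : v (x, 0) = u0 x by rewrite /v time_clampE// u_init.
have u0_right := positivity_sup0_right u0_ge0 cu0 supu0.
have asym := left_asymptotics a0 C0 (u0_right 0 (lexx _)) ratio.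
have [d d0 Hd] := asym C C0.
(* Within the range of the asymptotics and with |x| < 1, where |x|^alpha <= |x|^beta turns the data
   into data below a barrier of exponent beta. *)
pose xl := - (Num.min d 1 / 2).
have m0 : 0 < Num.min d 1 by rewrite lt_min d0 ltr01.
have xl0 : xl < 0 by rewrite oppr_lt0 divr_gt0.
have C20 : 0 < C + C by rewrite addr_gt0.
have left x : xl <= x <= 0 -> u0 x <= (C + C) * `|x| `^ (p / (p - 2)).
  move=> /andP[xlx x0].
  have md : Num.min d 1 <= d by rewrite ge_min lexx.
  have m1 : Num.min d 1 <= 1 by rewrite ge_min lexx orbT.
  have dx : - d < x <= 0 by rewrite x0 andbT; rewrite /xl in xlx; lra.
  have [_ h] := Hd x dx; apply: le_trans h _; rewrite ler_wpM2l ?(ltW C20)//.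
  have [->|xn] := eqVneq x 0; first by rewrite normr0 !powR0 ?gt_eqF.
  apply: ger_powR; last exact: ltW.
  by rewrite normr_gt0 xn/= ler0_norm//; rewrite /xl in xlx; lra.
have [dz /andP[dz0 _] Hz] := local_zero p2 vsol v_ge0 v_init u0_right C20 xl0 left.
have [d1 d10 Hz1] := zero_on_right p2 vsol v_ge0 v_init u0_right C20 xl0 left dz0 Hz.
have vz t : 0 <= t <= d1 -> v (0, t) = 0 by exact: Hz1.
(* The bound [delta <= d1] is recorded so that v also vanishes on x >= 0 up to the time delta, which
   bounds the interface from above. *)
have main (eps : R) : 0 < eps -> exists xeps delta : R, [/\ xeps < 0, 0 < delta, delta <= d1 &
      forall x t : R, xeps <= x -> 0 <= t -> t <= delta ->
        (C - eps) * (Num.max (- x) 0) `^ alpha <= u (x, t) /\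
        u (x, t) <= (C + eps) * (Num.max (- x) 0) `^ alpha
                      * (1 - eps * t) `^ (1 / (2 - p))].
  move=> e0; have [xe [de [xe0 de0 ded H]]] :=
    left_estimate p2 alphaP C0 vsol v_ge0 v_init asym d10 vz e0.
  exists xe, de; split => // x t xx t0 td; have tI : 0 <= t <= de by rewrite t0.
  rewrite -(time_clampE u x t0) -/v.
  have [x0|x0] := leP x 0.
    rewrite max_l ?oppr_ge0// -(ler0_norm x0); apply: H => //.
    by rewrite xx.
  have mE : Num.max (- x) 0 = 0 by apply: max_r; rewrite oppr_le0 ltW.
  have vE : v (x, t) = 0 by apply: Hz1; [exact: ltW|rewrite t0 (le_trans td)].
  by rewrite mE vE powR0 ?gt_eqF// !mulr0 mul0r.
split; last first.
  by move=> eps /main[xe [de [h1 h2 _ h3]]]; exists xe, de; split.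
(* With eps = C / 2 the lower bound is positive at negative x arbitrarily close to 0, so the
   interface is not to the left of 0. *)
have C2 : 0 < C / 2 by rewrite divr_gt0.
have [xe [de [xe0 de0 ded H]]] := main _ C2.
exists de => // t t0 td; rewrite /interface /positivity_sup.
apply/eqP; rewrite eq_le; apply/andP; split.
  apply: ge_ereal_sup => _ [x /= ux <-]; rewrite lee_fin leNgt; apply/negP => x0.
  have vE : v (x, t) = 0 by apply: Hz1; [exact: ltW|rewrite t0 (le_trans td)].
  by move: ux; rewrite -(time_clampE u x t0) -/v vE ltxx.
apply/lee_subgt0Pr => e e0; rewrite sub0e.
pose x := Num.max xe (- (e / 2)).
have x0 : x < 0 by rewrite gt_max xe0 oppr_lt0 divr_gt0.
have xx : xe <= x by rewrite le_max lexx.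
have [h _] := H x t xx t0 td.
apply: (@le_trans _ _ x%:E).
  rewrite -EFinN lee_fin le_max; apply/orP; right; lra.
apply: ereal_sup_ubound; exists x => //=; apply: lt_le_trans h.
apply: mulr_gt0; first by lra.
by rewrite powR_gt0// lt_max oppr_gt0 x0.
Qed.
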